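(* Let $\Gamma$ be a finite simplicial graph with a maximal SIL-pair system $\{w_1,w_2,w_3\}$ and no additional components. Suppose the following conditions hold: (1) Each vertex $v$ in each simultaneously shared component either has $\Gamma-\mathrm{st}(v)$ connected, or defines only subordinate partial conjugations, all of whose supports contain a vertex that also defines subordinate partial conjugations. (2) The conjugation homomorphism $\varphi:K\to\mathrm{Aut}(H_3)$ is injective. Then $\mathrm{PSO}(A_\Gamma)$ is acylindrically hyperbolic if and only if there is no nontrivial partial conjugation defined by vertices in $\bigcap_i\mathrm{lk}(w_i)$.
   Context: $\Gamma$ is a finite simplicial graph with vertex set $V$ and edge set $E$; $A_\Gamma=\langle v\in V\mid [u,v]=1,\ \{u,v\}\in E\rangle$. $\mathrm{lk}(v)$ (resp. $\mathrm{st}(v)$) is the full subgraph spanned by the neighbours of $v$ (resp. the neighbours of $v$ and $v$ itself); $\Gamma-S$ is the full subgraph spanned by the vertices not in $S$. For a vertex $v$ and a connected component $C$ of $\Gamma-\mathrm{st}(v)$, the partial conjugation $P_v^C$ (defined by $v$, with support $C$) conjugates every vertex of $C$ by $v$ and fixes all other vertices; the same symbol denotes its image in $\mathrm{Out}(A_\Gamma)$, and ''nontrivial'' means nontrivial in $\mathrm{Out}(A_\Gamma)$. $\mathrm{PSO}(A_\Gamma)\le\mathrm{Out}(A_\Gamma)$ is the subgroup generated by all partial conjugations. SIL-pair: distinct non-adjacent vertices $a,b$ such that some connected component of $\Gamma-(\mathrm{lk}(a)\cap\mathrm{lk}(b))$ contains neither $a$ nor $b$. A set of vertices $\{w_1,\dots,w_n\}$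 ($n\ge2$) is a maximal SIL-pair system if, with $L=\bigcap_{i=1}^n\mathrm{lk}(w_i)$: (a) $(w_j,w_k)$ is a SIL-pair for all $j\ne k$; (b) $L=\mathrm{lk}(w_j)\cap\mathrm{lk}(w_k)$ for all $j\ne k$; (c) if $(v,w)$ is a SIL-pair with $|\mathrm{lk}(v)\cap\mathrm{lk}(w)|<|L|$, then there is a path from $v$ to $w$ in $\Gamma-(\mathrm{lk}(v)\cap\mathrm{lk}(w))$; (d) the component of $\Gamma-L$ containing $w_i$ does not contain $w_j$ for $j\ne i$; (e) if $(v,w_i)$ is a SIL-pair for some $i$, then $v$ lies in a component of $\Gamma-L$ containing some $w_k$. The simultaneously shared component $C_i$ is the component of $\Gamma-L$ containing $w_i$; a component of $\Gamma-L$ containing no $w_i$ is an additional component. Let $v\in C_i$ and let $C$ be a component of $\Gamma-\mathrm{st}(v)$. $P_v^C$ is dominant if $L\subset\mathrm{lk}(v)$ and $C=C_{i'}$ with $i'\ne i$. $P_v^C$ is subordinate if $L\subset\mathrm{lk}(v)$, $C\subset C_i$ and $C$ contains a vertex $w$ with $L\subset\mathrm{lk}(w)$. $P_v^C$ is of type (4) if $L\subset\mathrm{lk}(v)$, $C\subset C_i$ and no vertex $w\in C$ satisfies $L\subset\mathrm{lk}(w)$. $P_v^C$ is of type (5) if $L\not\subset\mathrm{lk}(v)$ and $C\subset C_i$. A vertex $v$ defines only subordinate partial conjugations if there is no nontrivial partial conjugation $P_v^C$ of type (4) or (5). $K$ is the subgroup of $\mathrm{PSO}(A_\Gamma)$ generated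 by all subordinate partial conjugations. $H_3$ is the subgroup generated by all $P_v^{C_3}$ with $v\in C_1\cup C_2$, $L\subset\mathrm{lk}(v)$, and all $P_v^{C_2}$ with $v\in C_3$, $L\subset\mathrm{lk}(v)$. Under condition (1), $K$ normalizes $H_3$ (one has $\mathrm{PSO}(A_\Gamma)=G\times(H_3\rtimes K)$, with $G$ generated by the partial conjugations defined by vertices in $L$), and $\varphi(k)(h)=khk^{-1}$ for $k\in K$, $h\in H_3$. A group is acylindrically hyperbolic if it admits a non-elementary (i.e. having two independent hyperbolic isometries) acylindrical isometric action on some hyperbolic metric space. *)

(* Defs.v *)
Set Warnings "-notation-overridden,-ambiguous-paths,-redundant-canonical-projection".
From HB Require Import structures.
From mathcomp Require Import all_boot all_order all_algebra generic_quotient.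
From mathcomp Require Import all_classical all_reals all_analysis.

Set Implicit Arguments.
Unset Strict Implicit.
Unset Printing Implicit Defensive.

Import Order.TTheory GRing.Theory Num.Theory.

Local Open Scope classical_set_scope.
Local Open Scope quotient_scope.
Local Open Scope group_scope.

(* A word is a sequence of letters; (x, true) stands for the generator x and
   (x, false) for its inverse. *)
Definition word (X : Type) := seq (X * bool).

Definition letter_inv (X : Type) (p : X * bool) := (p.1, ~~ p.2).

Definition word_inv (X : Type) (s : word X) : word X :=
  rev (map (@letter_inv X) s).

Inductive pres_eq (X : Type) (rels : set (word X)) : word X -> word X -> Prop :=
| pres_refl s : pres_eq rels s s
| pres_sym s t : pres_eq rels s t -> pres_eq rels t s
| pres_trans s t r : pres_eq rels s t -> pres_eq rels t r -> pres_eq rels s r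
| pres_cancel a p b :
    pres_eq rels (a ++ [:: p; letter_inv p] ++ b) (a ++ b)
| pres_relator a r b : rels r -> pres_eq rels (a ++ r ++ b) (a ++ b).

Section Presented.
Variables (X : choiceType) (rels : set (word X)).
Implicit Types (s t a b : word X).

Local Notation "s ~~> t" := (pres_eq rels s t) (at level 70).

Definition pres_eqb : rel (word X) := fun s t => `[< pres_eq rels s t >].

Lemma pres_eqb_refl : reflexive pres_eqb.
Proof. by move=> s; apply/asboolP; exact: pres_refl. Qed.

Lemma pres_eqb_sym : symmetric pres_eqb.
Proof. by move=> s t; apply/asboolP/asboolP; exact: pres_sym. Qed.

Lemma pres_eqb_trans : transitive pres_eqb.
Proof.
move=> t s r /asboolP st /asboolP tr; apply/asboolP; exact: pres_trans tr.
Qed.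

Canonical pres_equiv :=
  EquivRel pres_eqb pres_eqb_refl pres_eqb_sym pres_eqb_trans.

Definition presented : Type := {eq_quot pres_equiv}.

HB.instance Definition _ := Choice.on presented.
HB.instance Definition _ := EqQuotient.on presented.

Definition pres_class (s : word X) : presented := \pi_{eq_quot pres_equiv} s.

Lemma pres_classP s t : pres_class s = pres_class t <-> s ~~> t.
Proof. by split=> [/eqmodP/asboolP|st] //; apply/eqmodP/asboolP. Qed.

Lemma pres_classK (x : presented) : pres_class (repr x) = x.
Proof. exact: reprK. Qed.

Lemma pres_repr s : repr (pres_class s) ~~> s.
Proof. by apply/pres_classP; rewrite pres_classK. Qed.

Lemma pres_ctx a s t b : s ~~> t -> a ++ s ++ b ~~> a ++ t ++ b.
Proof.
elim=> {s t} [s|s t _|s t r _ IH1 _ IH2|c p d|c r d rr].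
- exact: pres_refl.
- exact: pres_sym.
- exact: pres_trans IH2.
- by have := pres_cancel rels (a ++ c) p (d ++ b); rewrite !catA.
- by have := pres_relator (a ++ c) (d ++ b) rr; rewrite !catA.
Qed.

Lemma pres_cat s s' t t' : s ~~> s' -> t ~~> t' -> s ++ t ~~> s' ++ t'.
Proof.
move=> ss tt; apply: (@pres_trans _ _ _ (s' ++ t)).
  exact: (@pres_ctx [::] _ _ t ss).
by have := @pres_ctx s' _ _ [::] tt; rewrite !cats0.
Qed.

Lemma word_inv_cat s t : word_inv (s ++ t) = word_inv t ++ word_inv s.
Proof. by rewrite /word_inv map_cat rev_cat. Qed.

Lemma letter_invK : involutive (@letter_inv X).
Proof. by case=> x e; rewrite /letter_inv /= negbK. Qed.

Lemma word_invK : involutive (@word_inv X).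
Proof.
by move=> s; rewrite /word_inv map_rev revK mapK //; exact: letter_invK.
Qed.

Lemma pres_mulV s : s ++ word_inv s ~~> [::].
Proof.
elim: s => [|p s IH]; first exact: pres_refl.
rewrite -cat1s word_inv_cat -catA [s ++ _]catA.
apply: pres_trans (pres_ctx [:: p] (word_inv [:: p]) IH) _.
exact: (pres_cancel rels [::] p [::]).
Qed.

Lemma pres_mulVs s : word_inv s ++ s ~~> [::].
Proof. by rewrite -[X in _ ++ X]word_invK; exact: pres_mulV. Qed.

Lemma pres_inv s t : s ~~> t -> word_inv s ~~> word_inv t.
Proof.
move=> st; apply: (@pres_trans _ _ _ (word_inv s ++ t ++ word_inv t)).
  apply: pres_sym; rewrite -[X in _ ~~> X]cats0.
  by apply: pres_cat; [exact: pres_refl|exact: pres_mulV].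
rewrite catA; apply: (@pres_cat _ [::]); last exact: pres_refl.
apply: (pres_trans _ (pres_mulVs s)); apply: pres_cat; first exact: pres_refl.
exact: pres_sym.
Qed.

Definition pres_mul (x y : presented) := pres_class (repr x ++ repr y).
Definition pres_one : presented := pres_class [::].
Definition pres_invg (x : presented) := pres_class (word_inv (repr x)).

Lemma pres_classM s t :
  pres_mul (pres_class s) (pres_class t) = pres_class (s ++ t).
Proof. by apply/pres_classP; apply: pres_cat; exact: pres_repr. Qed.

Lemma pres_classV s : pres_invg (pres_class s) = pres_class (word_inv s).
Proof. by apply/pres_classP; apply: pres_inv; exact: pres_repr. Qed.

Lemma pres_ind (P : presented -> Prop) :
  (forall s, P (pres_class s)) -> forall x, P x.
Proof. by move=> H x; rewrite -(pres_classK x). Qed.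

Lemma pres_mulA : associative pres_mul.
Proof.
elim/pres_ind=> s; elim/pres_ind=> t; elim/pres_ind=> r.
by rewrite !pres_classM catA.
Qed.

Lemma pres_mul1 : left_id pres_one pres_mul.
Proof. by elim/pres_ind=> s; rewrite pres_classM. Qed.

Lemma pres_mulr1 : right_id pres_one pres_mul.
Proof. by elim/pres_ind=> s; rewrite pres_classM cats0. Qed.

Lemma pres_mulVg : left_inverse pres_one pres_invg pres_mul.
Proof.
elim/pres_ind=> s; rewrite pres_classV pres_classM.
by apply/pres_classP; exact: pres_mulVs.
Qed.

Lemma pres_mulgV : right_inverse pres_one pres_invg pres_mul.
Proof.
elim/pres_ind=> s; rewrite pres_classV pres_classM.
by apply/pres_classP; exact: pres_mulV.
Qed.

HB.instance Definition _ := isGroup.Build presented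
  pres_mulA pres_mul1 pres_mulr1 pres_mulVg pres_mulgV.

Lemma pres_class_mul s t : pres_class s * pres_class t = pres_class (s ++ t).
Proof. exact: pres_classM. Qed.

Lemma pres_class_inv s : (pres_class s)^-1 = pres_class (word_inv s).
Proof. exact: pres_classV. Qed.

Definition pres_gen (x : X) : presented := pres_class [:: (x, true)].

Definition word_eval (H : groupType) (f : X -> H) (s : word X) : H :=
  \prod_(p <- s) (if p.2 then f p.1 else (f p.1)^-1).

Lemma word_eval_cat (H : groupType) (f : X -> H) s t :
  word_eval f (s ++ t) = word_eval f s * word_eval f t.
Proof. exact: big_cat. Qed.

Lemma word_eval_pres (H : groupType) (f : X -> H) :
  (forall r, rels r -> word_eval f r = 1) ->
  forall s t, s ~~> t -> word_eval f s = word_eval f t.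
Proof.
move=> fr s t; elim=> {s t} [//|s t _ ->//|s t r _ -> _ ->//|a p b|a r b rr].
- have pV : word_eval f [:: p; letter_inv p] = 1.
    rewrite /word_eval big_cons big_seq1.
    by case: p => x [] /=; rewrite ?mulgV ?mulVg.
  by rewrite !word_eval_cat pV mul1g.
- by rewrite !word_eval_cat (fr _ rr) mul1g.
Qed.

(* Universal property; meaningful when f kills every relator. *)
Definition pres_lift (H : groupType) (f : X -> H) (x : presented) : H :=
  word_eval f (repr x).

Section Lift.
Variables (H : groupType) (f : X -> H).
Hypothesis fr : forall r, rels r -> word_eval f r = 1.

Lemma pres_lift_class s : pres_lift f (pres_class s) = word_eval f s.
Proof. exact: (word_eval_pres fr (pres_repr s)). Qed.

Lemma pres_lift_gen x : pres_lift f (pres_gen x) = f x.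
Proof. by rewrite pres_lift_class /word_eval big_seq1. Qed.

Lemma pres_liftM : {morph pres_lift f : x y / x * y}.
Proof.
elim/pres_ind=> s; elim/pres_ind=> t.
by rewrite [_ * _]pres_classM !pres_lift_class word_eval_cat.
Qed.

End Lift.

Lemma pres_hom_ext (H : groupType) (f g : presented -> H) :
  {morph f : x y / x * y} -> {morph g : x y / x * y} ->
  (forall x, f (pres_gen x) = g (pres_gen x)) -> f =1 g.
Proof.
move=> fM gM fg.
have hom1 (h : presented -> H) : {morph h : x y / x * y} -> h 1 = 1.
  by move=> hM; apply: (@mulgI _ (h 1)); rewrite -hM !mulg1.
have homV (h : presented -> H) x : {morph h : x y / x * y} -> h x^-1 = (h x)^-1.
  by move=> hM; apply/esym/mulg1_eq; rewrite -hM mulgV hom1.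
elim/pres_ind; elim=> [|[x e] s IH]; first by rewrite !hom1.
have -> : pres_class ((x, e) :: s) = pres_class [:: (x, e)] * pres_class s.
  by rewrite [_ * _]pres_classM.
rewrite fM gM IH; congr (_ * _); case: e; first exact: fg.
have -> : pres_class [:: (x, false)] = (pres_gen x)^-1.
  by rewrite [_ ^-1]pres_classV.
by rewrite !homV // fg.
Qed.

End Presented.

Record aut (G : groupType) := Aut {
  aut_fun :> G -> G;
  aut_ifun : G -> G;
  aut_funK : cancel aut_fun aut_ifun;
  aut_ifunK : cancel aut_ifun aut_fun;
  autM : {morph aut_fun : x y / x * y} }.

Section AutGroup.
Variable G : groupType.
Implicit Types f g h : aut G.

Lemma aut_ext f g : f =1 g -> f = g.
Proof.
case: f g => [f f' fK f'K fM] [g g' gK g'K gM] /= /funext E; subst g.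
have E : f' = g' by apply/funext => x; rewrite -{1}[x]g'K fK.
subst g'; congr Aut; exact: Prop_irrelevance.
Qed.

HB.instance Definition _ := gen_eqMixin (aut G).
HB.instance Definition _ := gen_choiceMixin (aut G).

Definition aut_one : aut G :=
  @Aut G id id (fun=> erefl) (fun=> erefl) (fun _ _ => erefl).

Fact aut_mul_morph f g : {morph f \o g : x y / x * y}.
Proof. by move=> x y /=; rewrite !autM. Qed.

Definition aut_mul f g : aut G :=
  @Aut G (f \o g) (aut_ifun g \o aut_ifun f)
    (can_comp (@aut_funK _ f) (@aut_funK _ g))
    (can_comp (@aut_ifunK _ g) (@aut_ifunK _ f)) (aut_mul_morph f g).

Fact aut_inv_morph f : {morph aut_ifun f : x y / x * y}.
Proof.
by move=> x y; apply: (can_inj (@aut_funK _ f)); rewrite autM !aut_ifunK.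
Qed.

Definition aut_inv f : aut G :=
  Aut (@aut_ifunK _ f) (@aut_funK _ f) (aut_inv_morph f).

Fact aut_mulA : associative aut_mul.
Proof. by move=> f g h; exact: aut_ext. Qed.
Fact aut_mul1g : left_id aut_one aut_mul.
Proof. by move=> f; exact: aut_ext. Qed.
Fact aut_mulg1 : right_id aut_one aut_mul.
Proof. by move=> f; exact: aut_ext. Qed.
Fact aut_mulVg : left_inverse aut_one aut_inv aut_mul.
Proof. by move=> f; apply: aut_ext => x /=; rewrite aut_funK. Qed.
Fact aut_mulgV : right_inverse aut_one aut_inv aut_mul.
Proof. by move=> f; apply: aut_ext => x /=; rewrite aut_ifunK. Qed.

HB.instance Definition _ := isGroup.Build (aut G)
  aut_mulA aut_mul1g aut_mulg1 aut_mulVg aut_mulgV.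

End AutGroup.

Section Outer.
Variable G : groupType.
Implicit Types (f g h : aut G) (a b x y : G).

Fact inner_funK a : cancel (fun x => x ^ a^-1) (fun x => x ^ a).
Proof. by move=> x; rewrite conjgKV. Qed.
Fact inner_ifunK a : cancel (fun x => x ^ a) (fun x => x ^ a^-1).
Proof. by move=> x; rewrite conjgK. Qed.
Fact inner_morph a : {morph (fun x => x ^ a^-1) : x y / x * y}.
Proof. by move=> x y; rewrite conjMg. Qed.

(* x |-> a x a^-1; recall that x ^ a is a^-1 x a. *)
Definition inner a : aut G := Aut (inner_funK a) (inner_ifunK a) (inner_morph a).

Lemma innerM a b : inner (a * b) = inner a * inner b.
Proof. by apply: aut_ext => x /=; rewrite invgM conjgM. Qed.

Lemma inner1 : inner 1 = 1.
Proof. by apply: aut_ext => x /=; rewrite invg1 conjg1. Qed.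

Lemma innerJ f a : f * inner a = inner (f a) * f.
Proof.
apply: aut_ext => x; have fV y : f y^-1 = (f y)^-1.
  apply/esym/mulg1_eq; rewrite -autM mulgV.
  by apply: (@mulgI _ (f 1)); rewrite -autM !mulg1.
by rewrite /= !conjgE !autM !invgK fV.
Qed.

Definition out_eqb : rel (aut G) :=
  fun f g => `[< exists a, f = inner a * g >].

Lemma out_eqb_refl : reflexive out_eqb.
Proof. by move=> f; apply/asboolP; exists 1; rewrite inner1 mul1g. Qed.

Lemma out_eqb_sym : symmetric out_eqb.
Proof.
suff H f g : out_eqb f g -> out_eqb g f by move=> f g; apply/idP/idP => /H.
case/asboolP=> a ->; apply/asboolP; exists a^-1.
by rewrite mulgA -innerM mulVg inner1 mul1g.
Qed.

Lemma out_eqb_trans : transitive out_eqb.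
Proof.
move=> g f h /asboolP[a ->] /asboolP[b ->]; apply/asboolP; exists (a * b).
by rewrite innerM mulgA.
Qed.

Canonical out_equiv := EquivRel out_eqb out_eqb_refl out_eqb_sym out_eqb_trans.

Definition Out : Type := {eq_quot out_equiv}.

HB.instance Definition _ := Choice.on Out.
HB.instance Definition _ := EqQuotient.on Out.

Definition out_class f : Out := \pi_{eq_quot out_equiv} f.

Lemma out_classP f g : out_class f = out_class g <-> exists a, f = inner a * g.
Proof. by split=> [/eqmodP/asboolP|H] //; apply/eqmodP/asboolP. Qed.

Lemma out_classK (z : Out) : out_class (repr z) = z.
Proof. exact: reprK. Qed.

Lemma out_repr f : exists a, repr (out_class f) = inner a * f.
Proof. by apply/out_classP; rewrite out_classK. Qed.

Definition out_mul (x y : Out) : Out := out_class (repr x * repr y).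
Definition out_one : Out := out_class 1.
Definition out_inv (x : Out) : Out := out_class (repr x)^-1.

Lemma out_classM f g : out_mul (out_class f) (out_class g) = out_class (f * g).
Proof.
apply/out_classP; have [a ->] := out_repr f; have [b ->] := out_repr g.
by exists (a * f b); rewrite innerM !mulgA -(mulgA (inner a) f) (innerJ f b) !mulgA.
Qed.

Lemma out_classV f : out_inv (out_class f) = out_class f^-1.
Proof.
apply/out_classP; have [a ->] := out_repr f; exists (f^-1 a^-1).
rewrite -innerJ invgM; congr (_ * _).
by apply: mulg1_eq; rewrite -innerM mulgV inner1.
Qed.

Lemma out_ind (P : Out -> Prop) : (forall f, P (out_class f)) -> forall z, P z.
Proof. by move=> H z; rewrite -(out_classK z). Qed.

Fact out_mulA : associative out_mul.
Proof.
elim/out_ind=> f; elim/out_ind=> g; elim/out_ind=> h.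
by rewrite !out_classM mulgA.
Qed.
Fact out_mul1g : left_id out_one out_mul.
Proof. by elim/out_ind=> f; rewrite out_classM mul1g. Qed.
Fact out_mulg1 : right_id out_one out_mul.
Proof. by elim/out_ind=> f; rewrite out_classM mulg1. Qed.
Fact out_mulVg : left_inverse out_one out_inv out_mul.
Proof. by elim/out_ind=> f; rewrite out_classV out_classM mulVg. Qed.
Fact out_mulgV : right_inverse out_one out_inv out_mul.
Proof. by elim/out_ind=> f; rewrite out_classV out_classM mulgV. Qed.

HB.instance Definition _ := isGroup.Build Out
  out_mulA out_mul1g out_mulg1 out_mulVg out_mulgV.

End Outer.

Section Generated.
Variables (G : groupType) (S : set G).

Definition subgroup_generated : set G :=
  smallest (fun H : set G => group_closed [pred x | x \in H]) S.

Fact subgroup_generated_closed : group_closed [pred x | x \in subgroup_generated].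
Proof.
split=> [|x y]; first by apply/mem_set => H [[H1 _] _]; exact/set_mem.
move=> /set_mem xS /set_mem yS; apply/mem_set => H HS; have [[_ HF] _] := HS.
by apply/set_mem/HF; apply/mem_set; [exact: xS|exact: yS].
Qed.

(* The generated subgroup as a group in its own right. *)
Definition generated_group : Type :=
  {x : G | [pred x | x \in subgroup_generated] x}.

HB.instance Definition _ := Choice.on generated_group.
HB.instance Definition _ := SubType.on generated_group.
HB.instance Definition _ :=
  SubChoice_isSubGroup.Build G _ generated_group subgroup_generated_closed.

End Generated.

Section Acylindrical.
Local Open Scope ring_scope.
Variable R : realType.

Definition geodesic_segment (X : metricType R) (x y : X) (p : R -> X) : Prop :=
  [/\ p 0 = x, p (mdist x y) = y &
      forall s t, 0 <= s <= mdist x y -> 0 <= t <= mdist x y ->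
        mdist (p s) (p t) = `|s - t|].

Definition on_segment (X : metricType R) (x y : X) (p : R -> X) : set X :=
  [set p t | t in [set t | 0 <= t <= mdist x y]].

Definition geodesic_space (X : metricType R) : Prop :=
  forall x y : X, exists p, geodesic_segment x y p.

Definition thin_triangles (X : metricType R) (delta : R) : Prop :=
  forall (x y z : X) (p q r : R -> X),
    geodesic_segment x y p -> geodesic_segment y z q ->
    geodesic_segment x z r ->
    forall a, on_segment x y p a ->
      exists2 b, (on_segment y z q `|` on_segment x z r) b &
        mdist a b <= delta.

Definition hyperbolic_space (X : metricType R) : Prop :=
  geodesic_space X /\ exists delta, thin_triangles X delta.

(* (x | y)_o and equivalence of sequences at infinity: the points of the Gromov
   boundary are the classes, for same_end, of the sequences u with
   same_end o u u. *)
Definition gromov_product (X : metricType R) (o x y : X) : R :=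
  (mdist x o + mdist y o - mdist x y) / 2%:R.

Definition same_end (X : metricType R) (o : X) (u v : nat -> X) : Prop :=
  forall M : R, exists N : nat, forall i j : nat,
    (N <= i)%N -> (N <= j)%N -> M <= gromov_product o (u i) (v j).

Section Action.
Variables (G : groupType) (X : metricType R) (act : G -> X -> X).

Definition isometric_action : Prop :=
  [/\ forall x, act 1%g x = x,
      forall g h x, act (g * h)%g x = act g (act h x) &
      forall g x y, mdist (act g x) (act g y) = mdist x y].

Definition acylindrical_action : Prop :=
  forall e : R, 0 < e -> exists (r : R) (N : nat), forall x y : X,
    r <= mdist x y ->
    ([set g | mdist x (act g x) <= e /\ mdist y (act g y) <= e] #<= `I_N)%card.

Definition int_power (g : G) (n : int) : G :=
  match n with Posz k => (g ^+ k)%g | Negz k => (g ^- k.+1)%g end.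

(* Some orbit map n |-> g^n x of Z is a quasi-isometric embedding. *)
Definition hyperbolic_isometry (g : G) : Prop :=
  exists (x : X) (a b : R), [/\ 1 <= a, 0 <= b &
    forall m n : int,
      let d := mdist (act (int_power g m) x) (act (int_power g n) x) in
      `|m - n|%:~R / a - b <= d <= a * `|m - n|%:~R + b].

(* u represents a point of the limit set of the cyclic group generated by g. *)
Definition limit_sequence (g : G) (o : X) (u : nat -> X) : Prop :=
  (forall i, exists n : int, u i = act (int_power g n) o) /\ same_end o u u.

Definition independent_isometries (g h : G) : Prop :=
  forall (o : X) (u v : nat -> X),
    limit_sequence g o u -> limit_sequence h o v -> ~ same_end o u v.

Definition non_elementary_action : Prop :=
  exists g h : G, [/\ hyperbolic_isometry g, hyperbolic_isometry h &
    independent_isometries g h].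

End Action.

Definition acylindrically_hyperbolic (G : groupType) : Prop :=
  exists (X : metricType R) (act : G -> X -> X),
    [/\ hyperbolic_space X, isometric_action act, acylindrical_action act &
        non_elementary_action act].

End Acylindrical.

Record sgraph := SGraph {
  vertex :> finType;
  adj : rel vertex;
  adj_sym : symmetric adj;
  adj_irrefl : irreflexive adj }.

Section Graph.
Variable Gamma : sgraph.
Implicit Types (u v w : Gamma) (S C L W : {set Gamma}).

Definition lk v : {set Gamma} := [set u | adj v u].
Definition st v : {set Gamma} := v |: lk v.

(* Adjacency in the full subgraph Gamma - S. *)
Definition adj_minus S : rel Gamma :=
  [rel u v | [&& adj u v, u \notin S & v \notin S]].

(* The component of v in Gamma - S; meaningful for v outside S. *)
Definition component S v : {set Gamma} := [set u | connect (adj_minus S) v u].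

Definition components S : {set {set Gamma}} := [set component S v | v in ~: S].

Definition connected_minus S : Prop :=
  forall u v, u \notin S -> v \notin S -> connect (adj_minus S) u v.

Definition SIL_pair a b : Prop :=
  [/\ a != b, ~~ adj a b &
      exists2 C, C \in components (lk a :&: lk b) & a \notin C /\ b \notin C].

Definition common_link W : {set Gamma} := \bigcap_(w in W) lk w.

(* The simultaneously shared component of w in W. *)
Definition shared_component W w : {set Gamma} := component (common_link W) w.

Definition maximal_SIL_system W : Prop :=
  let L := common_link W in
  [/\ (2 <= #|W|)%N,
      {in W &, forall a b, a != b -> SIL_pair a b /\ L = lk a :&: lk b},
      forall v w, SIL_pair v w -> (#|lk v :&: lk w| < #|L|)%N ->
        connect (adj_minus (lk v :&: lk w)) v w,
      {in W &, forall a b, b != a -> b \notin shared_component W a} &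
      forall v w, w \in W -> SIL_pair v w ->
        exists2 w', w' \in W & v \in shared_component W w'].

Definition no_additional_components W : Prop :=
  forall C, C \in components (common_link W) -> exists2 w, w \in W & w \in C.

(* The commutators u v u^-1 v^-1 of adjacent vertices. *)
Definition raag_relators : set (word Gamma) :=
  [set r | exists u v, adj u v /\
     r = [:: (u, true); (v, true); (u, false); (v, false)]].

Definition raag : groupType := presented raag_relators.

Definition raag_gen v : raag := pres_gen raag_relators v.

Lemma raag_gen_comm u v : adj u v -> commute (raag_gen u) (raag_gen v).
Proof.
move=> uv; suff : [~ (raag_gen u)^-1, (raag_gen v)^-1] = 1.
  move/eqP/commgP/commuteV/commute_sym/commuteV; rewrite !invgK.
  exact: commute_sym.
have V x : (raag_gen x)^-1 = pres_class (@raag_relators) [:: (x, false)].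
  exact: pres_class_inv.
rewrite commgEl conjgE !invgK !V /raag_gen /pres_gen.
rewrite (pres_class_mul _ [:: (u, false)] [:: (v, false)]).
rewrite (pres_class_mul _ [:: (v, true)]) (pres_class_mul _ [:: (u, true)]).
apply/pres_classP.
have : raag_relators [:: (u, true); (v, true); (u, false); (v, false)].
  by exists u, v.
by move/(pres_relator [::] [::]); rewrite cats0.
Qed.

Lemma component_notin S C u : C \in components S -> u \in C -> u \notin S.
Proof.
case/imsetP=> x; rewrite inE => xS -> {C}; rewrite inE => /connectP[p].
elim/last_ind: p => [_ ->//|p y _].
by rewrite rcons_path last_rcons => /andP[_ /and3P[_ _ yS]] ->.
Qed.

Lemma component_step S C u w : C \in components S -> u \in C -> adj u w ->
  (w \in C) || (w \in S).
Proof.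
move=> CS uC uw; have uS := component_notin CS uC; move: CS uC.
case/imsetP=> x _ -> {C}; rewrite !inE => xu.
case wS: (w \in S); rewrite ?orbT // orbF.
apply: connect_trans xu _; apply: connect1.
by apply/and3P; split; rewrite ?wS.
Qed.

Section PartialConjugation.
Variables (v : Gamma) (C : {set Gamma}).

(* b selects conjugation by v or by v^-1. *)
Definition pconj_letter (b : bool) : raag :=
  if b then raag_gen v else (raag_gen v)^-1.

Definition pconj_gen (b : bool) (u : Gamma) : raag :=
  if (C \in components (st v)) && (u \in C)
  then pconj_letter b * raag_gen u * (pconj_letter b)^-1 else raag_gen u.

Let pconj_genE b u : C \in components (st v) -> (u \in C) || (u \in st v) ->
  pconj_gen b u = raag_gen u ^ (pconj_letter b)^-1.
Proof.
rewrite /pconj_gen => -> /=; rewrite conjgE invgK mulgA; case: ifP => //= _.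
rewrite !inE => uv; suff c : commute (pconj_letter b) (raag_gen u).
  by rewrite c mulgK.
have c : commute (raag_gen v) (raag_gen u).
  by case/orP: uv => [/eqP->//|/raag_gen_comm].
by case: b => //=; apply/commute_sym/commuteV/commute_sym.
Qed.

Let pconj_gen_id b u : ~~ ((C \in components (st v)) && (u \in C)) ->
  pconj_gen b u = raag_gen u.
Proof. by rewrite /pconj_gen => /negbTE->. Qed.

Let pconj_gen_comm b u w :
  adj u w -> commute (pconj_gen b u) (pconj_gen b w).
Proof.
move=> uw; have c := raag_gen_comm uw.
case CS: (C \in components (st v)); last first.
  by rewrite !pconj_gen_id ?CS.
have H : u \in C \/ w \in C ->
    commute (pconj_gen b u) (pconj_gen b w).
  move=> uwC; rewrite !pconj_genE //.
  - by rewrite /commute -!conjMg c.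
  - by case: uwC => [uC|->//]; exact: component_step uC uw.
  - by case: uwC => [->//|wC]; apply: component_step wC _; rewrite // adj_sym.
case uC: (u \in C); first by apply: H; left.
case wC: (w \in C); first by apply: H; right.
by rewrite !pconj_gen_id ?uC ?wC ?andbF.
Qed.

Let pconj_gen_relators b (r : word Gamma) :
  raag_relators r -> word_eval (pconj_gen b) r = 1.
Proof.
case=> u [w [uw ->]]; rewrite /word_eval !big_cons big_nil /= mulg1.
by rewrite mulgA pconj_gen_comm // !mulgA mulgK mulgV.
Qed.

Definition pconj_endo (b : bool) : raag -> raag := pres_lift (pconj_gen b).

Let pconj_endoM b : {morph pconj_endo b : x y / x * y}.
Proof. exact: (pres_liftM (pconj_gen_relators b)). Qed.

Let pconj_endo_gen b u : pconj_endo b (raag_gen u) = pconj_gen b u.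
Proof. exact: (pres_lift_gen (pconj_gen_relators b)). Qed.

Let pconj_endoV b x : pconj_endo b x^-1 = (pconj_endo b x)^-1.
Proof.
apply/esym/mulg1_eq; rewrite -pconj_endoM mulgV.
by apply: (@mulgI _ (pconj_endo b 1)); rewrite -pconj_endoM !mulg1.
Qed.

Let pconj_endo_letter b c : pconj_endo b (pconj_letter c) = pconj_letter c.
Proof.
have gv : pconj_endo b (raag_gen v) = raag_gen v.
  rewrite pconj_endo_gen pconj_gen_id //; apply/negP => /andP[CS].
  by move/(component_notin CS); rewrite !inE eqxx.
by case: c => //=; rewrite pconj_endoV gv.
Qed.

Lemma pconj_endoK b : cancel (pconj_endo b) (pconj_endo (~~ b)).
Proof.
move=> x; apply: (@pres_hom_ext _ _ _ (pconj_endo (~~ b) \o pconj_endo b) id).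
- by move=> y z /=; rewrite !pconj_endoM.
- by [].
move=> u /=; rewrite -/(raag_gen u) pconj_endo_gen.
have [uC|uC] := boolP ((C \in components (st v)) && (u \in C)); last first.
  by rewrite pconj_gen_id // pconj_endo_gen pconj_gen_id.
rewrite {1}/pconj_gen uC !pconj_endoM pconj_endoV !pconj_endo_letter.
rewrite pconj_endo_gen /pconj_gen uC.
by case: b => /=; rewrite ?invgK !mulgA ?mulgV ?mulVg mul1g ?mulgK ?mulgVK.
Qed.

(* P_v^C, conjugating the vertices of C by v; by convention it is the identity
   when C is not a component of Gamma - st(v). *)
Definition partial_conj : aut raag :=
  @Aut raag (pconj_endo true) (pconj_endo false)
    (pconj_endoK true) (pconj_endoK false) (@pconj_endoM true).

Lemma partial_conjE u : C \in components (st v) ->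
  partial_conj (raag_gen u) =
    if u \in C then raag_gen v * raag_gen u * (raag_gen v)^-1 else raag_gen u.
Proof. by move=> CS; rewrite /= pconj_endo_gen /pconj_gen CS. Qed.

Definition out_partial_conj : Out raag := out_class partial_conj.

End PartialConjugation.

Definition partial_conjugations : set (Out raag) :=
  [set x | exists v C, C \in components (st v) /\ x = out_partial_conj v C].

Definition PSO : groupType := generated_group partial_conjugations.

(* W is the system {w_1, ..., w_n}, and C_i is shared_component W w_i.  The
   predicates below describe P_v^C; they hold of pairs (v, C) because v and C
   cannot be recovered from the outer class. *)

Definition subordinate W v C : Prop :=
  exists w, [/\ w \in W, v \in shared_component W w, C \in components (st v),
    common_link W \subset lk v & C \subset shared_component W w /\
      exists2 u, u \in C & common_link W \subset lk u].

Definition type4 W v C : Prop :=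
  exists w, [/\ w \in W, v \in shared_component W w, C \in components (st v),
    common_link W \subset lk v & C \subset shared_component W w /\
      ~ exists2 u, u \in C & common_link W \subset lk u].

Definition type5 W v C : Prop :=
  exists w, [/\ w \in W, v \in shared_component W w, C \in components (st v),
    ~~ (common_link W \subset lk v) & C \subset shared_component W w].

Definition defines_only_subordinate W v : Prop :=
  ~ exists C, (type4 W v C \/ type5 W v C) /\ out_partial_conj v C <> 1.

Definition defines_subordinate W v : Prop := exists C, subordinate W v C.

Definition K_generators W : set (Out raag) :=
  [set x | exists v C, subordinate W v C /\ x = out_partial_conj v C].

Definition H3_generators w1 w2 w3 : set (Out raag) :=
  let W := [set w1; w2; w3]%SET in
  [set x | exists v, common_link W \subset lk v /\
     (v \in shared_component W w1 :|: shared_component W w2 /\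
        x = out_partial_conj v (shared_component W w3) \/
      v \in shared_component W w3 /\
        x = out_partial_conj v (shared_component W w2))].

Definition K W : groupType := generated_group (K_generators W).

Definition H3 w1 w2 w3 : groupType := generated_group (H3_generators w1 w2 w3).

(* phi(k)(h) = k h k^-1, as an element of Out; it lies in H3 when K normalizes
   H3, and injectivity of phi does not depend on this choice of codomain. *)
Definition conj_hom w1 w2 w3
    (k : K [set w1; w2; w3]%SET) (h : H3 w1 w2 w3) : Out raag :=
  \val k * \val h * (\val k)^-1.

End Graph.

(* Main.v *)
Require Import Defs.
From mathcomp Require Import all_boot all_order all_algebra.
From mathcomp Require Import all_classical all_reals all_analysis.
From mathcomp Require Import ring lra zify.
From HB Require Import structures.

Set Implicit Arguments.
Unset Strict Implicit.
Unset Printing Implicit Defensive.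

(** Write [L] for the common link of [w1], [w2], [w3], [C w] for the shared component
    of [w], and [U w] for the set of vertices of [C w] whose link contains [L].  A vertex
    that lies neither in [L] nor in one of the sets [U w] defines only trivial partial
    conjugations ([notU_trivial]): a missing adjacency to [L] would otherwise give a
    nontrivial partial conjugation of type (5).

    If some [l] in [L] defines a nontrivial partial conjugation, then [PSO] is the
    product of two commuting subgroups, generated by the partial conjugations by
    vertices of [L] and by those by vertices of the sets [U w]: they commute already
    in the automorphism group, because [l] and [v] are adjacent
    ([pc_commute_adj], [link_factored]).  A nontrivial partial conjugation has
    infinite order ([opc_infinite_order]), so both subgroups contain elements of
    infinite order.  A group with a non-elementary acylindrical action is not such
    a product ([no_commuting_factors]): the centralizer of a hyperbolic isometry is
    virtually cyclic ([centralizer_virtually_cyclic]), so a power of any hyperbolic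
    element would be central and all hyperbolic elements would share their limit
    points.

    Conversely, suppose that the vertices of [L] define only trivial partial
    conjugations.  Let [P w1], [P w2], [P w3] be the subgroups generated by the
    generators of [H_3] that are defined by vertices of [U w1], [U w2], [U w3].  Since
    the product of all partial conjugations by one vertex is inner, these three
    subgroups and [K] generate [PSO] ([PSO_factored]), and [K] normalizes each of them
    ([K_normalizes]).  Moreover no nonempty reduced product of elements of the
    subgroups [P w] lies in [K] ([reduced_notin_K]); in other words [PSO] is the
    semidirect product with [K] of the free product of the [P w].  This is a ping-pong
    argument on the Bass-Serre tree of a free product of three copies of the
    right-angled Artin group, into whose copies the sets [U w] are mapped while all
    other vertices are killed.  An automorphism moves the three base vertices of the
    tree.  A nontrivial element of [P w] turns one of the two other vertices about
    the one of index [w], which puts the latter strictly between the others; this is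
    the configuration from which the next letter can again be applied, and it is never
    reached by an inner automorphism composed with an element of [K].

    It remains to make a free product extended by [K] act acylindrically.  Its
    Bass-Serre tree does not serve, because [K] and the factors can be infinite and
    have large fixed sets.  Instead one fixes a marker word in the free product that
    contains all generators of [H_3]; as [K] acts faithfully on [H_3] by the last
    hypothesis, only the identity of [K] fixes the marker word.  The norm of an element
    [g] other than 1 is one plus the largest number of separated occurrences of
    translates of the marker word under [K], or of their inverses, in the free product
    part of [g].  This norm is subadditive, integral geodesic ([nu_split]) and
    hyperbolic in the sense of the four point condition ([nu_four]), because normal
    forms of quotients are controlled by common prefixes and cutting a word loses at
    most one occurrence ([packs_split]).  It is acylindrical ([nu_acyl]): an element
    that moves both ends of a long word by little must carry an occurrence in the
    middle of the word to one of a bounded number of places, and an occurrence together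
    with its image determines the [K]-part of the element.  The marker word and one of
    its conjugates are independent hyperbolic elements.  The Cayley graph of [PSO] with
    respect to the elements of norm 1, realized as a geodesic metric space, then carries
    the required action ([norm_acylindrically_hyperbolic]). *)


(** * Reduced words in a free product of copies of a group *)

Section FreeProductWords.
Local Open Scope group_scope.
Variables (I : choiceType) (A : groupType).
Implicit Types (p q : I * A) (u v w : seq (I * A)).

Definition alternates : rel (I * A) := fun p q => p.1 != q.1.

(** Normal forms of the free product of copies of [A] indexed by [I]; the letter
    [(i, a)] stands for the element [a] of the [i]-th copy. *)
Definition reduced w := all (fun p => p.2 != 1) w && sorted alternates w.

Definition push p w : seq (I * A) :=
  if w is q :: w' then
    if p.1 == q.1 then
      if p.2 * q.2 == 1 then w' else (p.1, p.2 * q.2) :: w'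
    else if p.2 == 1 then w else p :: w
  else if p.2 == 1 then [::] else [:: p].

Definition mulw u v := foldr push v u.

Definition invw w := rev [seq (p.1, p.2^-1) | p <- w].

Lemma reduced_cons p w :
  reduced (p :: w) = [&& p.2 != 1, (if w is q :: _ then p.1 != q.1 else true)
                       & reduced w].
Proof.
rewrite /reduced /=; case: w => [|q w] /=; first by rewrite !andbT.
by rewrite /alternates; case: (p.2 != 1); case: (p.1 != q.1);
  rewrite ?andbF ?andbT //= ; case: (_ && _).
Qed.

Lemma reduced_behead p w : reduced (p :: w) -> reduced w.
Proof. by rewrite reduced_cons => /and3P[]. Qed.

Lemma reduced_cat_cons u p v :
  reduced (u ++ p :: v) = reduced (rcons u p) && reduced (p :: v).
Proof.
rewrite /reduced all_cat all_rcons sorted_cat_cons /=.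
by case: (p.2 == 1); rewrite ?andbF //=; case: (all _ u); case: (all _ v);
  case: (sorted _ (rcons u p)); case: (path _ p v).
Qed.

Lemma reduced_catl u v : reduced (u ++ v) -> reduced u.
Proof.
rewrite /reduced all_cat => /andP[/andP[-> _]] /=.
by move=> /(prefix_sorted (prefix_prefix u v)).
Qed.

Lemma reduced_catr u v : reduced (u ++ v) -> reduced v.
Proof. by elim: u => // p u IH /reduced_behead. Qed.

Lemma reduced_cat3 u p v : reduced (rcons u p) -> reduced (p :: v) ->
  reduced (u ++ p :: v).
Proof. by rewrite reduced_cat_cons => -> ->. Qed.

Lemma reduced_glue u v w : v != [::] -> reduced (u ++ v) -> reduced (v ++ w) ->
  reduced (u ++ v ++ w).
Proof.
case: v => // p v _; rewrite reduced_cat_cons => /andP[ru _] rv.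
by rewrite cat_cons reduced_cat_cons ru.
Qed.

Lemma reduced_invw w : reduced (invw w) = reduced w.
Proof.
rewrite /reduced /invw all_rev all_map rev_sorted sorted_map.
congr (_ && _); first by apply: eq_all => p /=; rewrite invg_eq1.
by apply: eq_sorted => p q; rewrite /alternates /= eq_sym.
Qed.

Lemma invwK : involutive invw.
Proof.
move=> w; rewrite /invw map_rev revK -map_comp -[RHS]map_id.
by apply: eq_map => -[i a] /=; rewrite invgK.
Qed.

Lemma invw_cat u v : invw (u ++ v) = invw v ++ invw u.
Proof. by rewrite /invw map_cat rev_cat. Qed.

Lemma invw_cons p w : invw (p :: w) = rcons (invw w) (p.1, p.2^-1).
Proof. by rewrite /invw /= rev_cons. Qed.

Lemma size_invw w : size (invw w) = size w.
Proof. by rewrite /invw size_rev size_map. Qed.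

Lemma push_cons p w : reduced (p :: w) -> push p w = p :: w.
Proof.
rewrite reduced_cons; case: w => [|q w] /and3P[p1 pq _] /=.
  by rewrite (negPf p1).
by rewrite (negPf pq) (negPf p1).
Qed.

Lemma push_reduced p w : reduced w -> reduced (push p w).
Proof.
case: w => [|q w] /=; first by case: eqP => // /eqP p1; rewrite /reduced /= p1.
move=> rw; case: (eqVneq p.1 q.1) => [pq|pq].
  case: eqP => [_|/eqP n1]; first exact: reduced_behead rw.
  by move: rw; rewrite !reduced_cons /= n1 pq => /and3P[_ -> ->].
by case: eqP => // /eqP p1; rewrite reduced_cons p1 pq.
Qed.

Lemma push1 i w : reduced w -> push (i, 1) w = w.
Proof.
case: w => [_|q w]; rewrite /= ?eqxx //.
case: (eqVneq i q.1) => // ->; rewrite mul1g reduced_cons => /and3P[/negPf-> _ _].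
by case: q.
Qed.

Lemma pushM i a b w :
  reduced w -> push (i, a) (push (i, b) w) = push (i, a * b) w.
Proof.
move=> rw; have [->|b1] := eqVneq b 1; first by rewrite push1 // mulg1.
case: w rw => [|[j c] w] rw /=.
  by rewrite (negPf b1) /= eqxx.
case: (eqVneq i j) => [ij|ij] /=; last by rewrite (negPf b1) /= eqxx.
subst j; have [bc|bc] := eqVneq (b * c) 1; last by rewrite /= eqxx mulgA.
have -> : a * b * c = a by rewrite -mulgA bc mulg1.
have [->|a1] := eqVneq a 1; first by rewrite push1 //; exact: reduced_behead rw.
rewrite push_cons // reduced_cons a1 /=.
by move: rw; rewrite reduced_cons => /and3P[_ -> ->].
Qed.

Lemma mulw_reduced u v : reduced v -> reduced (mulw u v).
Proof. by move=> rv; elim: u => //= p u; exact: push_reduced. Qed.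

Lemma mulw_push p u v : reduced u -> reduced v ->
  mulw (push p u) v = push p (mulw u v).
Proof.
move=> ru rv; case: p => i a; case: u ru => [_|[j b] u ru] /=.
  by case: eqP => [->|//]; rewrite push1.
have rm : reduced (mulw u v) by exact: mulw_reduced.
case: (eqVneq i j) => [->|_] /=; last first.
  by case: eqP => [->|//]; rewrite push1 //; exact: push_reduced.
by rewrite pushM //; case: eqP => [->|//]; rewrite push1.
Qed.

Lemma mulwA u v w : reduced v -> reduced w ->
  mulw (mulw u v) w = mulw u (mulw v w).
Proof.
move=> rv rw; elim: u => //= p u IH.
by rewrite mulw_push ?IH //; exact: mulw_reduced.
Qed.

Lemma mulw_cat u v : reduced (u ++ v) -> mulw u v = u ++ v.
Proof.
elim: u => //= p u IH ruv; rewrite IH ?push_cons //; exact: reduced_behead ruv.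
Qed.

Lemma mulw0 u : reduced u -> mulw u [::] = u.
Proof. by move=> ru; rewrite mulw_cat cats0. Qed.

Lemma mulVw w : reduced w -> mulw (invw w) w = [::].
Proof.
elim: w => // p w IH rw; have rw' := reduced_behead rw.
rewrite invw_cons -cats1 /mulw foldr_cat /= eqxx mulVg eqxx.
exact: IH.
Qed.

Lemma mulwV w : reduced w -> mulw w (invw w) = [::].
Proof. by move=> rw; rewrite -{1}[w]invwK mulVw ?reduced_invw. Qed.

Lemma invw_mul u v : reduced u -> reduced v ->
  invw (mulw u v) = mulw (invw v) (invw u).
Proof.
move=> ru rv; set x := mulw u v; set y := mulw (invw v) (invw u).
have rx : reduced x by exact: mulw_reduced.
have ry : reduced y by apply: mulw_reduced; rewrite reduced_invw.
have xy : mulw x y = [::].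
  rewrite /x /y mulwA // -(mulwA v) ?reduced_invw // mulwV //.
  exact: mulwV.
have -> : y = mulw (mulw (invw x) x) y by rewrite mulVw.
by rewrite mulwA // xy mulw0 // reduced_invw.
Qed.

(** Multiplying two reduced words cancels a common block [r] and then merges at
    most one pair of syllables. *)
Lemma mulwP u v : reduced u -> reduced v ->
  exists u0 r v0, [/\ u = u0 ++ r, v = invw r ++ v0 &
    (mulw u v = u0 ++ v0) \/
    exists i a b u1 v1, [/\ u0 = rcons u1 (i, a), v0 = (i, b) :: v1, a * b != 1
      & mulw u v = u1 ++ (i, a * b) :: v1]].
Proof.
elim/last_ind: u v => [|u [i a] IH] v ru rv.
  by exists [::], [::], v; split=> //; left.
have ru' : reduced u by move: ru; rewrite -cats1; exact: reduced_catl.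
have -> : mulw (rcons u (i, a)) v = mulw u (push (i, a) v).
  by rewrite -cats1 /mulw foldr_cat.
have a1 : a != 1 by move: ru; rewrite /reduced all_rcons => /andP[/andP[]].
case: v rv => [|[j b] v] rv.
  exists (rcons u (i, a)), [::], [::]; split; rewrite ?cats0 //; left.
  by rewrite /= (negPf a1) mulw_cat cats1.
rewrite /=; case: (eqVneq i j) => [ij|ij]; last first.
  exists (rcons u (i, a)), [::], ((j, b) :: v); split; rewrite ?cats0 //; left.
  rewrite (negPf a1) mulw_cat ?cat_rcons //; apply: reduced_cat3 => //.
  by rewrite reduced_cons a1 ij.
subst j; have [ab|ab] := eqVneq (a * b) 1.
  have [u0 [r [v0 [-> -> E]]]] := IH v ru' (reduced_behead rv).
  exists u0, (rcons r (i, a)), v0; split=> //; first by rewrite rcons_cat.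
  by rewrite -cats1 invw_cat /= -(mulg1_eq ab).
exists (rcons u (i, a)), [::], ((i, b) :: v); split; rewrite ?cats0 //; right.
exists i, a, b, u, v; split=> //.
rewrite mulw_cat // reduced_cat_cons; apply/andP; split.
  move: ru rv; rewrite /reduced !all_rcons /= ab => /andP[/andP[_ ->]] /= + _.
  case: (lastP u) => // s q; rewrite -!cats1 -!catA !sorted_cat_cons /=.
  by move=> /andP[-> /andP[+ _]]; rewrite /alternates /= => ->.
by move: rv; rewrite !reduced_cons /= ab => /and3P[_ -> ->].
Qed.

Lemma common_prefix u v : exists (c a b : seq (I * A)), [/\ u = c ++ a, v = c ++ b &
  [\/ a = [::], b = [::] |
      exists x a' y b', [/\ a = x :: a', b = y :: b' & x != y]]].
Proof.
elim: u v => [|x u IH] v.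
  by exists [::], [::], v; split=> //; constructor 1.
case: v => [|y v]; first by exists [::], (x :: u), [::]; split=> //; constructor 2.
have [->|xy] := eqVneq x y.
  by have [p [a [b [-> -> H]]]] := IH v; exists (y :: p), a, b.
exists [::], (x :: u), (y :: v); split=> //; constructor 3.
by exists x, u, y, v.
Qed.

(** Evaluation forgets the indices: the factors are here subgroups of one group. *)
Definition evalw w : A := \prod_(p <- w) p.2.

Lemma evalw_cons p w : evalw (p :: w) = p.2 * evalw w.
Proof. exact: big_cons. Qed.

Lemma evalw0 : evalw [::] = 1. Proof. exact: big_nil. Qed.

Lemma evalw_cat u v : evalw (u ++ v) = evalw u * evalw v.
Proof. exact: big_cat. Qed.

Lemma evalw_push p w : evalw (push p w) = p.2 * evalw w.
Proof.
case: w => [|q w] /=.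
  by case: eqP => [->|_]; rewrite ?mul1g // evalw_cons.
case: ifP => _.
  by case: eqP => [E|_]; rewrite !evalw_cons mulgA ?E ?mul1g.
by case: eqP => [->|_]; rewrite ?mul1g // evalw_cons.
Qed.

Lemma evalw_mul u v : evalw (mulw u v) = evalw u * evalw v.
Proof.
elim: u => [|p u IH]; first by rewrite evalw0 mul1g.
by rewrite /= evalw_push IH evalw_cons mulgA.
Qed.

Lemma evalw_inv w : reduced w -> evalw (invw w) = (evalw w)^-1.
Proof.
move=> rw; apply/esym/mulg1_eq.
by rewrite -evalw_mul mulwV // evalw0.
Qed.

Definition conjw (k : A) w := [seq (p.1, k * p.2 * k^-1) | p <- w].

Lemma conjw_cat k u v : conjw k (u ++ v) = conjw k u ++ conjw k v.
Proof. exact: map_cat. Qed.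

Lemma size_conjw k w : size (conjw k w) = size w.
Proof. exact: size_map. Qed.

Lemma conjwM k l w : conjw (k * l) w = conjw k (conjw l w).
Proof.
by rewrite /conjw -map_comp; apply: eq_map => p /=; rewrite invgM !mulgA.
Qed.

Lemma conjw1 w : conjw 1 w = w.
Proof.
rewrite -[RHS]map_id; apply: eq_map => -[i a] /=.
by rewrite invg1 mulg1 mul1g.
Qed.

Lemma conjwVK k w : conjw k^-1 (conjw k w) = w.
Proof. by rewrite -conjwM mulVg conjw1. Qed.

Lemma conj_eq1 (k a : A) : (k * a * k^-1 == 1) = (a == 1).
Proof.
apply/eqP/eqP => [H|->]; last by rewrite mulg1 mulgV.
by apply: (@mulgI _ k); apply: (@mulIg _ k^-1); rewrite H mulg1 mulgV.
Qed.

Lemma conj_mul (k a b : A) :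
  k * (a * b) * k^-1 = (k * a * k^-1) * (k * b * k^-1).
Proof. by rewrite !mulgA mulgVK. Qed.

Lemma conj_inv (k a : A) : (k * a * k^-1)^-1 = k * a^-1 * k^-1.
Proof. by rewrite !invgM invgK !mulgA. Qed.

Lemma reduced_conjw k w : reduced (conjw k w) = reduced w.
Proof.
rewrite /reduced /conjw all_map sorted_map; congr (_ && _).
by apply: eq_all => p /=; rewrite conj_eq1.
Qed.

Lemma invw_conjw k w : invw (conjw k w) = conjw k (invw w).
Proof.
rewrite /invw /conjw map_rev -!map_comp; congr rev.
by apply: eq_map => p /=; rewrite conj_inv.
Qed.

Lemma mulw_conjw k u v : mulw (conjw k u) (conjw k v) = conjw k (mulw u v).
Proof.
elim: u => //= -[i a] u ->; set w := mulw u v.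
case: w => [|[j b] w] /=; first by rewrite conj_eq1; case: ifP.
rewrite conj_eq1 -conj_mul conj_eq1.
by case: ifP => _; case: ifP.
Qed.

Lemma evalw_conjw k w : evalw (conjw k w) = k * evalw w * k^-1.
Proof.
elim: w => [|p w IH]; first by rewrite evalw0 mulg1 mulgV.
by rewrite !evalw_cons IH /= conj_mul.
Qed.

(** The component in the [i]-th factor of the first step of [w].  In the Bass-Serre
    tree of the free product it is the edge by which the path described by [w]
    leaves the vertex fixed by that factor. *)
Definition head_syl (i : I) w : A :=
  if w is (j, a) :: _ then if j == i then a else 1 else 1.

Lemma head_syl_push i a w : reduced w ->
  head_syl i (push (i, a) w) = a * head_syl i w.
Proof.
case: w => [_|[j b] w rw] /=.
  by case: eqP => [->|_] /=; rewrite ?mulg1 ?eqxx.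
case: (eqVneq i j) => [ij|ij] /=.
  subst j; case: eqP => [->|_] /=; last by rewrite eqxx.
  case: w rw => [|[k c] w] //=; rewrite !reduced_cons /=.
  by case/and3P=> _ ik _; rewrite eq_sym (negPf ik).
have [->|a1] := eqVneq a 1; rewrite /= ?eqxx ?mulg1 //.
  by rewrite eq_sym (negPf ij).
Qed.

End FreeProductWords.

(** * Counting disjoint markers in a word *)

Section Markers.
Variables (T : eqType) (mk : seq T -> Prop).
Implicit Types (x y z u v w m : seq T).

(** Some [n] markers fit in [w] with a letter before, between and after them. *)
Fixpoint packs n w : Prop :=
  if n is n'.+1 then
    exists z m w', [/\ w = z ++ m ++ w', z != [::], mk m, w' != [::] & packs n' w']
  else True.

Definition mcount w := \max_(n < (size w).+1 | `[< packs n w >]) n.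

Lemma packs_size n w : packs n w -> (n <= size w)%N.
Proof.
elim: n w => // n IH w [z [m [w' [-> z0 _ _ /IH h]]]].
rewrite !size_cat; case: z z0 => //= t z _; lia.
Qed.

Lemma packs_count n w : packs n w -> (n <= mcount w)%N.
Proof.
move=> h; have hn : (n < (size w).+1)%N by rewrite ltnS; exact: packs_size.
by apply: (leq_trans _ (leq_bigmax_cond (Ordinal hn) _)) => //=; apply/asboolP.
Qed.

Lemma count_packs w : packs (mcount w) w.
Proof.
have h : (0 < #|[pred n : 'I_(size w).+1 | `[< packs n w >]]|)%N.
  by apply/card_gt0P; exists ord0; exact/asboolP.
have [i hi E] := eq_bigmax_cond (fun n : 'I_(size w).+1 => n : nat) h.
by rewrite /mcount E; exact/asboolP.
Qed.

Lemma packs_le n k w : packs n w -> (k <= n)%N -> packs k w.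
Proof.
elim: n k w => [|n IH] [|k] w // [z [m [w' [-> z0 hm w0 h]]]] hk.
by exists z, m, w'; split=> //; exact: IH h hk.
Qed.

Lemma packs_pre n x w : packs n w -> packs n (x ++ w).
Proof.
case: n => // n [z [m [w' [-> z0 hm w0 h]]]].
exists (x ++ z), m, w'; split; rewrite ?catA //.
by case: x => //=; case: z z0.
Qed.

Lemma packs_cat a b u v : packs a u -> packs b v -> packs (a + b) (u ++ v).
Proof.
elim: a u => [|a IH] u; first by move=> _; exact: packs_pre.
case=> z [m [w' [-> z0 hm w0 h]]] hb; rewrite addSn.
exists z, m, (w' ++ v); split; rewrite -?catA //; last exact: IH.
by case: w' w0 {h}.
Qed.

Lemma packs_suf n x w : packs n w -> packs n (w ++ x).
Proof. by move=> h; rewrite -[n]addn0; apply: packs_cat. Qed.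

Lemma packs_rcons n w m z : packs n w -> w != [::] -> mk m -> z != [::] ->
  packs n.+1 (w ++ m ++ z).
Proof.
move=> + + hm z0; elim: n w => [|n IH] w; first by move=> _ w0; exists w, m, z.
case=> y [m1 [w' [-> y0 hm1 w0 h]]] _.
exists y, m1, (w' ++ m ++ z); split; rewrite -?catA //; last exact: IH.
by case: w' w0 {h}.
Qed.

(** The gap required between markers makes the count almost additive: a single
    cut, even one through a letter that is altered on both sides ([z] becoming
    [z'] and [z'']), destroys at most one marker. *)
Lemma packs_split n x z y z' z'' : (size z <= 1)%N ->
  size z' = size z -> size z'' = size z -> packs n (x ++ z ++ y) ->
  exists a b, [/\ (n <= a + b + 1)%N, packs a (x ++ z') & packs b (z'' ++ y)].
Proof.
move=> hz hz' hz''; elim: n x => [|n IH] x.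
  by move=> _; exists 0%N, 0%N.
case=> p [m [w' [E p0 hm w0 h]]].
have [hs|hs] := leqP (size (p ++ m)) (size x).
  have [x' Ex] : exists x', x = (p ++ m) ++ x'.
    exists (drop (size (p ++ m)) x); rewrite -{1}[x](cat_take_drop (size (p ++ m))).
    congr (_ ++ _); have := congr1 (take (size (p ++ m))) E.
    by rewrite takel_cat // catA take_size_cat.
  subst x; move: E; rewrite -!catA => /(congr1 (drop (size p))).
  rewrite !drop_size_cat // => /(congr1 (drop (size m))).
  rewrite !drop_size_cat // => Ew; subst w'.
  have [a [b [hab ha hb]]] := IH _ h.
  have [xz|xz] := eqVneq (x' ++ z') [::].
    exists 0%N, n; split=> //; first lia.
    move: xz h; case: x' {hs IH w0 ha} => //= z'0; move: hz'; rewrite z'0 /=.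
    by move/esym/size0nil=> zz; move: hz''; rewrite zz => /size0nil ->.
  exists a.+1, b; split=> //.
  by exists p, m, (x' ++ z').
exists 0%N, n; split=> //; first lia.
have hle : (size (x ++ z) <= size (p ++ m))%N.
  by move: hs; rewrite (size_cat x); lia.
have Ew : w' = drop (size (p ++ m) - size (x ++ z)) y.
  have /esym := congr1 (drop (size (p ++ m))) E.
  rewrite !catA drop_size_cat // => ->.
  by rewrite drop_cat ltnNge hle.
apply: packs_pre; rewrite -(cat_take_drop (size (p ++ m) - size (x ++ z)) y).
by apply: packs_pre; rewrite -Ew.
Qed.

End Markers.

(** * Integer powers *)

Section IntPower.
Import Order.TTheory GRing.Theory Num.Theory.
Local Open Scope ring_scope.
Variable G : groupType.
Implicit Types (g : G) (m n : int).

Lemma int_powerS g m : int_power g (1 + m) = (g * int_power g m)%g.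
Proof.
case: m => [k|[|k]].
- have -> : 1 + Posz k = k.+1 by rewrite -add1n.
  exact: expgS.
- by rewrite /= expg1 mulgV.
have -> : 1 + Negz k.+1 = Negz k by rewrite !NegzE -(addn1 k.+1) PoszD opprD addrCA subrr addr0.
by rewrite /= [in RHS]expgSr invgM mulVKg.
Qed.

Lemma int_powerD g m n : int_power g (m + n) = (int_power g m * int_power g n)%g.
Proof.
elim: m => [|k IH|k IH].
- by rewrite add0r mul1g.
- by rewrite -add1n PoszD -addrA !int_powerS IH mulgA.
apply: (@mulgI _ g); rewrite mulgA -!int_powerS.
have -> : 1 + (- k.+1%:Z + n) = - k%:Z + n by lia.
by have -> : 1 + - k.+1%:Z = - k%:Z by lia.
Qed.

Lemma int_powerN g m : int_power g (- m) = (int_power g m)^-1%g.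
Proof. by apply/esym/mulg1_eq; rewrite -int_powerD subrr. Qed.

Lemma int_power_quot g m n :
  ((int_power g m)^-1 * int_power g n)%g = int_power g (n - m).
Proof. by rewrite -int_powerN -int_powerD addrC. Qed.

Lemma int_powerM g m (k : nat) : int_power g (m * k%:Z) = (int_power g m ^+ k)%g.
Proof.
elim: k => [|k IH]; first by rewrite mulr0.
by rewrite -[in LHS]addn1 PoszD mulrDr mulr1 int_powerD IH expgSr.
Qed.

End IntPower.

(** * Geodesics and thin triangles *)

Section Metric.
Import Order.TTheory GRing.Theory Num.Theory.
Local Open Scope classical_set_scope.
Local Open Scope ring_scope.
Variables (R : realType) (X : metricType R).
Implicit Types (x y z a b : X) (p q : R -> X).

(** A condition on distances alone: unlike thinness of triangles it can be checked
    on the vertices of a graph. *)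
Definition four_point (delta : R) := forall x y z w : X,
  mdist x y + mdist z w <=
  Num.max (mdist x z + mdist y w) (mdist x w + mdist y z) + delta.

Lemma four_pointE delta : four_point delta -> forall x y z w : X,
  mdist x y + mdist z w <= mdist x z + mdist y w + delta \/
  mdist x y + mdist z w <= mdist x w + mdist y z + delta.
Proof.
by move=> h x y z w; have := h x y z w; rewrite maxEle; case: ifP; [right|left].
Qed.

Lemma geodesic_rev x y p : geodesic_segment x y p ->
  geodesic_segment y x (fun t => p (mdist x y - t)).
Proof.
case=> p0 p1 hp; rewrite /geodesic_segment (metric_sym y x).
split; rewrite ?subr0 ?subrr //.
move=> s t /andP[s0 s1] /andP[t0 t1]; rewrite hp; [|lra|lra].
by rewrite opprB addrC addrA subrK distrC.
Qed.

Lemma distr_le (s t : R) : s <= t -> `|s - t| = t - s.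
Proof. by move=> st; rewrite distrC ger0_norm // subr_ge0. Qed.

Lemma geodesic_le x y p s t : geodesic_segment x y p -> 0 <= s -> s <= t ->
  t <= mdist x y -> mdist (p s) (p t) = t - s.
Proof.
move=> [_ _ hp] s0 st t1; rewrite hp ?distr_le //.
  by rewrite s0 (le_trans st t1).
by rewrite t1 (le_trans s0 st).
Qed.

Lemma geodesic_point x y p t : geodesic_segment x y p -> 0 <= t -> t <= mdist x y ->
  mdist x (p t) = t /\ mdist (p t) y = mdist x y - t.
Proof.
move=> g t0 t1; have [p0 p1 _] := g; split.
  by rewrite -{1}p0 (geodesic_le g) // subr0.
by rewrite -{1}p1 (geodesic_le g).
Qed.

(** Equality in the triangle inequality at [z] propagates to all pairs of points on
    the two halves. *)
Lemma geodesic_cat x z y p q : geodesic_segment x z p -> geodesic_segment z y q ->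
  mdist x y = mdist x z + mdist z y ->
  geodesic_segment x y
    (fun t => if t <= mdist x z then p t else q (t - mdist x z)).
Proof.
move=> gp gq E; have [p0 p1 _] := gp; have [q0 q1 _] := gq.
have l0 : 0 <= mdist x z by exact: mdist_ge0.
have k0 : 0 <= mdist z y by exact: mdist_ge0.
set f := fun t => _.
suff main s t : 0 <= s -> s <= t -> t <= mdist x y -> mdist (f s) (f t) = t - s.
  split; first by rewrite /f l0.
    rewrite /f E; case: ifP => h; last by rewrite addrC addKr.
    have e : mdist z y = 0 by apply/eqP; rewrite eq_le k0 andbT -(gerDl (mdist x z)).
    by rewrite e addr0 p1; apply: mdist_positivity.
  move=> s t /andP[s0 s1] /andP[t0 t1]; have [st|st] := leP s t.
    by rewrite main // distr_le.
  by rewrite metric_sym main ?(ltW st) // distrC distr_le // ltW.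
move=> s0 st t1; rewrite /f; case: ifP => hs; case: ifP => ht.
- exact: geodesic_le gp s0 st ht.
- have lt' : mdist x z <= t by rewrite leNgt; apply/negP => /ltW; rewrite ht.
  have u0 : 0 <= t - mdist x z by rewrite subr_ge0.
  have u1 : t - mdist x z <= mdist z y by rewrite lerBlDl -E.
  have [h1 h2] := geodesic_point gp s0 hs.
  have [h3 h4] := geodesic_point gq u0 u1.
  have := metric_triangle (p s) z (q (t - mdist x z)).
  have := metric_triangle x (p s) y.
  have := metric_triangle (p s) (q (t - mdist x z)) y.
  rewrite h1 h2 h3 h4 E; move: (mdist x z) (mdist z y) (mdist (p s) y) (mdist _ _).
  by move=> a b c d *; lra.
- by exfalso; move: hs; rewrite (le_trans st ht).
- have ls : mdist x z <= s by rewrite leNgt; apply/negP => /ltW; rewrite hs.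
  rewrite (geodesic_le gq) ?subr_ge0 ?lerD2r //; last by rewrite lerBlDl -E.
  by rewrite opprB addrA subrK.
Qed.

(** The fellow traveller of a point of a side is taken on the side with which
    its end of the triangle shares the longer initial segment. *)
Lemma four_point_thin delta : four_point delta -> thin_triangles X (2 * delta).
Proof.
move=> fp; have fpE := four_pointE fp.
have main x y z p r (t : R) : geodesic_segment x y p -> geodesic_segment x z r ->
    0 <= t -> t <= mdist x y -> 2 * t <= mdist x y + mdist x z - mdist y z ->
    exists2 s, 0 <= s <= mdist x z & mdist (p t) (r s) <= 2 * delta.
  move=> hp hr t0 t1 h.
  have d0 : 0 <= delta by case: (fpE x x x x); rewrite lerDl.
  have tri := metric_triangle x z y.
  rewrite (metric_sym z y) in tri.
  have htz : t <= mdist x z.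
    by move: h tri; move: (mdist x y) (mdist x z) (mdist y z) => a b c *; lra.
  exists t; first by rewrite t0.
  have [a1 a2] := geodesic_point hp t0 t1; have [b1 b2] := geodesic_point hr t0 htz.
  have := fpE (p t) z x y; have := fpE (p t) (r t) x z.
  rewrite !(metric_sym (p t) x) (metric_sym (r t) x) (metric_sym z y) (metric_sym z x).
  rewrite a1 a2 b1 b2; move: h d0; clear.
  move: (mdist x y) (mdist x z) (mdist y z) (mdist (p t) (r t)) (mdist (p t) z).
  by move=> a b c d e h d0 [h1|h1] [h2|h2]; lra.
move=> x y z p q r hp hq hr a [t /= /andP[t0 t1] <-].
have [h|h] := leP (2 * t) (mdist x y + mdist x z - mdist y z).
  have [s hs d] := main _ _ _ _ _ _ hp hr t0 t1 h.
  by exists (r s) => //; right; exists s.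
have [|||s hs d] := main y x z _ q (mdist x y - t) (geodesic_rev hp) hq.
- by rewrite subr_ge0.
- by rewrite (metric_sym y x) gerBl.
- rewrite (metric_sym y x); move: h; clear.
  by move: (mdist x y) (mdist x z) (mdist y z) => a b c *; lra.
exists (q s); first by left; exists s.
by move: d; rewrite opprB addrC subrK.
Qed.

End Metric.

(** * The geometric realization of a Cayley graph *)

Lemma card_le_ordinals (T : Type) (A : set T) (f : T -> nat) (n : nat) :
  (forall x, A x -> (f x < n)%N) ->
  (forall x y, A x -> A y -> f x = f y -> x = y) -> (A #<= `I_n)%card.
Proof.
move=> fn finj; have [F] : $|{injfun A >-> `I_n}|; last exact: inj_card_le F.
apply/injfunPex; exists f => // x y; rewrite !inE; exact: finj.
Qed.

Section CayleyGraph.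
Import Order.TTheory GRing.Theory Num.Theory.
Local Open Scope classical_set_scope.
Local Open Scope ring_scope.
Variables (R : realType) (G : groupType) (nu : G -> nat).
Hypotheses (nu1 : nu 1%g = 0%N) (nu_eq0 : forall g, nu g = 0%N -> g = 1%g)
  (nuV : forall g, nu g^-1%g = nu g)
  (nuM : forall g h, (nu (g * h)%g <= nu g + nu h)%N)
  (nu_split : forall g n, nu g = n.+2 ->
     exists a b, [/\ g = (a * b)%g, nu a = 1%N & nu b = n.+1]).

Definition vdist (x y : G) : R := (nu (x^-1 * y)%g)%:R.

Lemma vdist_ge0 x y : 0 <= vdist x y. Proof. exact: ler0n. Qed.

Lemma vdistxx x : vdist x x = 0.
Proof. by rewrite /vdist mulVg nu1. Qed.

Lemma vdist_sym x y : vdist x y = vdist y x.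
Proof. by rewrite /vdist -nuV invgM invgK. Qed.

Lemma vdist_triangle y x z : vdist x z <= vdist x y + vdist y z.
Proof.
rewrite /vdist -natrD ler_nat; have := nuM (x^-1 * y)%g (y^-1 * z)%g.
by rewrite !mulgA mulgK.
Qed.

Lemma vdist_eq0 x y : vdist x y <= 0 -> x = y.
Proof.
rewrite /vdist lern0 => /eqP/nu_eq0/(congr1 (fun z => x * z)%g).
by rewrite mulVKg mulg1.
Qed.

Lemma vdist_act g x y : vdist (g * x)%g (g * y)%g = vdist x y.
Proof. by rewrite /vdist invgM -mulgA mulKg. Qed.

Lemma vdist_edge x s : vdist x (x * s)%g = (nu s)%:R.
Proof. by rewrite /vdist mulKg. Qed.

(** [(x, s, t)] is the point at distance [t] from [x] on the edge from [x] to
    [x * s]; the vertices are the points with [s = 1] and [t = 0].  The edge from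
    [x * s] to [x] with label [s^-1] is a second edge between the same ends, so no
    orientation has to be chosen. *)
Definition is_point : pred (G * G * R) := fun p =>
  [&& (nu p.1.2 <= 1)%N, 0 <= p.2, p.2 < 1 & (p.2 == 0) == (p.1.2 == 1%g)].

Definition cayley : Type := {p : G * G * R | is_point p}.

HB.instance Definition _ := Choice.on cayley.

Definition edge_src (p : cayley) : G := (val p).1.1.
Definition edge_label (p : cayley) : G := (val p).1.2.
Definition edge_offset (p : cayley) : R := (val p).2.

Implicit Types (p q r : cayley) (x y z g : G).

Definition edge_tgt p : G := (edge_src p * edge_label p)%g.

Lemma point_spec p : [/\ (nu (edge_label p) <= 1)%N, 0 <= edge_offset p, edge_offset p < 1 &
  (edge_offset p == 0) = (edge_label p == 1%g)].
Proof. by have := valP p; rewrite /is_point => /and4P[h1 h2 h3 /eqP h4]. Qed.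

Lemma offset_ge0 p : 0 <= edge_offset p. Proof. by case: (point_spec p). Qed.
Lemma offset_lt1 p : edge_offset p < 1. Proof. by case: (point_spec p). Qed.

Lemma edge_vdist p : vdist (edge_src p) (edge_tgt p) <= 1.
Proof.
by rewrite vdist_edge lern1; case: (point_spec p).
Qed.

Lemma point_cases p : (edge_label p = 1%g /\ edge_offset p = 0) \/
  [/\ edge_label p <> 1%g, 0 < edge_offset p & vdist (edge_src p) (edge_tgt p) = 1].
Proof.
have := edge_vdist p; rewrite vdist_edge.
have [h1 h2 h3 h4] := point_spec p => h5.
have [s1|s1] := eqVneq (edge_label p) 1%g; [left|right].
  by move: h4; rewrite s1 eqxx => /eqP.
split; [exact/eqP| |].
  by rewrite lt_neqAle h2 andbT eq_sym h4 (negPf s1).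
suff -> : nu (edge_label p) = 1%N by [].
by case: (nu (edge_label p)) (@nu_eq0 (edge_label p)) h1 s1 => [/(_ erefl) ->|[]] //; rewrite eqxx.
Qed.

Lemma cayley_eq p q : edge_src p = edge_src q -> edge_label p = edge_label q ->
  edge_offset p = edge_offset q -> p = q.
Proof.
move=> h1 h2 h3; apply: val_inj; move: h1 h2 h3; rewrite /edge_src /edge_label /edge_offset.
by case: (val p) => -[? ?] ?; case: (val q) => -[? ?] ? /= -> -> ->.
Qed.

(** A path from [p] to a vertex leaves the edge of [p] by one of its ends. *)
Definition pdist p z :=
  Num.min (edge_offset p + vdist (edge_src p) z) (1 - edge_offset p + vdist (edge_tgt p) z).

Lemma pdist_le1 p z : pdist p z <= edge_offset p + vdist (edge_src p) z.
Proof. by rewrite /pdist ge_min lexx. Qed.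

Lemma pdist_le2 p z : pdist p z <= 1 - edge_offset p + vdist (edge_tgt p) z.
Proof. by rewrite /pdist ge_min lexx orbT. Qed.

Lemma pdistP p z : pdist p z = edge_offset p + vdist (edge_src p) z \/
  pdist p z = 1 - edge_offset p + vdist (edge_tgt p) z.
Proof. by rewrite /pdist minEle; case: ifP; [left|right]. Qed.

Lemma pdist_lip p z w : pdist p z <= pdist p w + vdist w z.
Proof.
have := pdist_le1 p z; have := pdist_le2 p z.
have := vdist_triangle w (edge_src p) z; have := vdist_triangle w (edge_tgt p) z.
by case: (pdistP p w) => ->; lra.
Qed.

Lemma pdist_ge0 p z : 0 <= pdist p z.
Proof.
have := (offset_ge0 p, offset_lt1 p) => -[h1 h2].
have := vdist_ge0 (edge_src p) z; have := vdist_ge0 (edge_tgt p) z.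
by case: (pdistP p z) => ->; lra.
Qed.

Lemma pdist_sum p w z : vdist w z <= pdist p w + pdist p z.
Proof.
have := (offset_ge0 p, offset_lt1 p) => -[h1 h2].
have h := edge_vdist p.
have := vdist_triangle (edge_src p) w z; have := vdist_triangle (edge_tgt p) w z.
have := vdist_triangle (edge_src p) (edge_tgt p) z.
have := vdist_triangle (edge_tgt p) (edge_src p) z.
rewrite !(vdist_sym w) (vdist_sym (edge_tgt p) (edge_src p)).
by case: (pdistP p w) => ->; case: (pdistP p z) => ->; lra.
Qed.

Definition same_edge p q := (edge_src p == edge_src q) && (edge_label p == edge_label q).

Lemma same_edgeC p q : same_edge p q = same_edge q p.
Proof. by rewrite /same_edge eq_sym [edge_label p == _]eq_sym. Qed.

Lemma same_edge_trans p q r : same_edge p q -> same_edge q r -> same_edge p r.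
Proof. by rewrite /same_edge => /andP[/eqP-> /eqP->]. Qed.

Lemma same_edgeE p q : same_edge p q -> edge_src p = edge_src q /\ edge_tgt p = edge_tgt q.
Proof. by rewrite /edge_tgt => /andP[/eqP-> /eqP->]. Qed.

(** The length of a shortest path from [p] to [q] among those that meet a vertex. *)
Definition through p q :=
  Num.min (edge_offset q + pdist p (edge_src q)) (1 - edge_offset q + pdist p (edge_tgt q)).

Lemma through_le p q z : through p q <= pdist p z + pdist q z.
Proof.
rewrite /through ge_min; have h1 := pdist_lip p (edge_src q) z.
have h2 := pdist_lip p (edge_tgt q) z.
rewrite !(vdist_sym z) in h1 h2.
by case: (pdistP q z) => ->; apply/orP; [left|right]; lra.
Qed.

Lemma through_ge p q : exists z, pdist p z + pdist q z <= through p q.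
Proof.
rewrite /through minEle; have h1 := pdist_le1 q (edge_src q); have h2 := pdist_le2 q (edge_tgt q).
rewrite !vdistxx in h1 h2.
by case: ifP => _; [exists (edge_src q)|exists (edge_tgt q)]; lra.
Qed.

Lemma throughC p q : through p q = through q p.
Proof.
suff H p' q' : through p' q' <= through q' p' by apply/eqP; rewrite eq_le !H.
by have [z hz] := through_ge q' p'; have := through_le p' q' z; lra.
Qed.

Definition cdist p q : R := if same_edge p q then `|edge_offset p - edge_offset q| else through p q.

Lemma cdistxx p : cdist p p = 0.
Proof. by rewrite /cdist /same_edge !eqxx subrr normr0. Qed.

Lemma cdist_sym p q : cdist p q = cdist q p.
Proof. by rewrite /cdist same_edgeC distrC throughC. Qed.

Lemma pdist_eq0 p z : pdist p z <= 0 -> [/\ edge_src p = z, edge_label p = 1%g & edge_offset p = 0].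
Proof.
have := (offset_ge0 p, offset_lt1 p) => -[h1 h2].
have h3 := vdist_ge0 (edge_src p) z; have h4 := vdist_ge0 (edge_tgt p) z.
case: (pdistP p z) => -> h; last by exfalso; lra.
have o0 : edge_offset p = 0 by lra.
split=> //; first by apply: vdist_eq0; lra.
by case: (point_cases p) => [[]//|[_ ]]; rewrite o0 ltxx.
Qed.

Lemma cdist_eq0 p q : cdist p q = 0 -> p = q.
Proof.
rewrite /cdist; case: ifP => [/andP[/eqP h1 /eqP h2]|].
  by move/normr0_eq0/subr0_eq; exact: cayley_eq.
have [z hz] := through_ge p q => h e.
have := pdist_ge0 p z; have := pdist_ge0 q z => h1 h2.
have [|a1 a2 a3] := @pdist_eq0 p z; first by lra.
have [|b1 b2 b3] := @pdist_eq0 q z; first by lra.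
by move: h; rewrite /same_edge a1 a2 b1 b2 !eqxx.
Qed.

Lemma pdist_cdist p q z : pdist p z <= cdist p q + pdist q z.
Proof.
rewrite /cdist; case: ifP => [/same_edgeE[h1 h2]|_].
  have := pdist_le1 p z; have := pdist_le2 p z; rewrite h1 h2.
  have := ler_norm (edge_offset p - edge_offset q).
  have := ler_norm (edge_offset q - edge_offset p).
  by rewrite distrC; case: (pdistP q z) => ->; lra.
have [w hw] := through_ge p q.
by have := pdist_lip p z w; have := pdist_sum q w z; lra.
Qed.

(** A detour through a vertex does not shorten the way along an edge. *)
Lemma offset_pdist p q z : same_edge p q ->
  `|edge_offset p - edge_offset q| <= pdist p z + pdist q z.
Proof.
move=> pq; have [h1 h2] := same_edgeE pq.
have [[a1 a2] [b1 b2]] := ((offset_ge0 p, offset_lt1 p), (offset_ge0 q, offset_lt1 q)).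
have p0 := pdist_ge0 p z; have q0 := pdist_ge0 q z.
rewrite ler_norml.
case: (point_cases p) => [[c1 c2]|[c1 c2 c3]]; case: (point_cases q) => [[d1 d2]|[d1 d2 d3]].
- by rewrite c2 d2; lra.
- by move: pq; rewrite /same_edge => /andP[_ /eqP E]; case: d1; rewrite -E.
- by move: pq; rewrite /same_edge => /andP[_ /eqP E]; case: c1; rewrite E.
have := vdist_ge0 (edge_src q) z; have := vdist_ge0 (edge_tgt q) z.
have := vdist_triangle z (edge_src q) (edge_tgt q); rewrite (vdist_sym z) d3.
by case: (pdistP p z) => ->; case: (pdistP q z) => ->; rewrite ?h1 ?h2; lra.
Qed.

Lemma cdist_triangle q p r : cdist p r <= cdist p q + cdist q r.
Proof.
have hpq z := pdist_cdist p q z.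
rewrite {1}/cdist; case: ifP => [pr|pr].
  rewrite {1}/cdist; case: ifP => [pq|pq].
    have qr : same_edge q r by apply: same_edge_trans pr; rewrite same_edgeC.
    by rewrite /cdist qr ler_distD.
  have [w hw] := through_ge p q.
  have := pdist_cdist r q w; rewrite (cdist_sym r).
  by have := offset_pdist w pr; lra.
case qr: (same_edge q r).
  have pq : same_edge p q = false.
    by apply/negP => /same_edge_trans/(_ qr); rewrite pr.
  rewrite {1}/cdist pq; have [w hw] := through_ge p q.
  have := pdist_cdist r q w; rewrite (cdist_sym r).
  by have := through_le p r w; lra.
rewrite {2}/cdist qr; have [w hw] := through_ge q r.
by have := hpq w; have := through_le p r w; lra.
Qed.

HB.instance Definition _ := isMetric.Build R cayley cdistxx cdist_eq0 cdist_sym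
  cdist_triangle.

Fact vertex_subproof x : is_point (x, 1%g, 0).
Proof. by rewrite /is_point /= nu1 lexx ltr01 !eqxx. Qed.

Definition vertex x : cayley := exist _ (x, 1%g, 0) (vertex_subproof x).

Lemma src_vertex x : edge_src (vertex x) = x. Proof. by []. Qed.
Lemma label_vertex x : edge_label (vertex x) = 1%g. Proof. by []. Qed.
Lemma offset_vertex x : edge_offset (vertex x) = 0. Proof. by []. Qed.
Lemma tgt_vertex x : edge_tgt (vertex x) = x. Proof. exact: mulg1. Qed.

Lemma vertexE p : edge_label p = 1%g -> edge_offset p = 0 -> p = vertex (edge_src p).
Proof. by move=> h1 h2; exact: cayley_eq. Qed.

Lemma pdist_vertex x z : pdist (vertex x) z = vdist x z.
Proof.
have h := vdist_ge0 x z; rewrite /pdist offset_vertex src_vertex tgt_vertex.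
by rewrite add0r subr0 minEle; case: ifP => // /negbT; rewrite -ltNge; lra.
Qed.

Lemma mdist_vertexr p z : mdist p (vertex z) = pdist p z.
Proof.
rewrite [mdist _ _]/(cdist p (vertex z)) /cdist; case: ifP => [|_].
  rewrite /same_edge src_vertex label_vertex => /andP[/eqP h1 /eqP h2].
  have [[_ h3]|[//]] := point_cases p.
  by rewrite (vertexE h2 h3) h1 pdist_vertex vdistxx subrr normr0.
have h := pdist_ge0 p z; rewrite /through offset_vertex src_vertex tgt_vertex.
by rewrite add0r subr0 minEle; case: ifP => // /negbT; rewrite -ltNge; lra.
Qed.

Lemma mdist_vertexl z p : mdist (vertex z) p = pdist p z.
Proof. by rewrite metric_sym mdist_vertexr. Qed.

Lemma mdist_same_edge p q : same_edge p q -> mdist p q = `|edge_offset p - edge_offset q|.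
Proof. by move=> h; rewrite [mdist _ _]/(cdist p q) /cdist h. Qed.

Lemma mdist_src p : mdist p (vertex (edge_src p)) <= 1.
Proof.
rewrite mdist_vertexr; have := pdist_le1 p (edge_src p); rewrite vdistxx addr0.
by have := offset_lt1 p; lra.
Qed.

(** The edge from [x] to [x * s], parametrized by [0, 1]. *)
Definition arc x s (u : R) : cayley :=
  if u <= 0 then vertex x else if 1 <= u then vertex (x * s)%g
  else insubd (vertex x) (x, s, u).

Lemma arc_inside x s u : nu s = 1%N -> 0 < u -> u < 1 ->
  [/\ edge_src (arc x s u) = x, edge_label (arc x s u) = s & edge_offset (arc x s u) = u].
Proof.
move=> s1 u0 u1; have s_neq1 : s != 1%g by apply/eqP => E; rewrite E nu1 in s1.
have hp : is_point (x, s, u).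
  by rewrite /is_point /= s1 (ltW u0) u1 (negPf s_neq1) (gt_eqF u0).
rewrite /arc leNgt u0 leNgt u1 /=.
by rewrite /edge_src /edge_label /edge_offset insubdK.
Qed.

Lemma arc0 x s : arc x s 0 = vertex x.
Proof. by rewrite /arc lexx. Qed.

Lemma arc1 x s : arc x s 1 = vertex (x * s)%g.
Proof. by rewrite /arc lexx leNgt ltr01. Qed.

Lemma arc_dist x s (u v : R) : nu s = 1%N -> 0 <= u -> u <= v -> v <= 1 ->
  mdist (arc x s u) (arc x s v) = v - u.
Proof.
move=> s1 u0 uv v1; have e1 : vdist x (x * s)%g = 1 by rewrite vdist_edge s1.
have inside w : 0 < w -> w < 1 -> pdist (arc x s w) x = w /\
    pdist (arc x s w) (x * s)%g = 1 - w.
  move=> w0 w1; have [a1 a2 a3] := arc_inside x s1 w0 w1.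
  rewrite /pdist /edge_tgt a1 a2 a3 !vdistxx (vdist_sym _ x) e1 !addr0.
  by split; rewrite minEle; case: leP => ?; lra.
have [v0|v0] := eqVneq v 0.
  have -> : u = v by lra.
  by rewrite mdistxx subrr.
have [u1|u1] := eqVneq u 1.
  have -> : v = u by lra.
  by rewrite mdistxx subrr.
have {u1} u1 : u < 1 by rewrite lt_neqAle u1 (le_trans uv v1).
have {v0} v0 : 0 < v by rewrite lt_neqAle eq_sym v0 (le_trans u0 uv).
have [E|u0'] := eqVneq u 0; last have {u0'} u0' : 0 < u by rewrite lt_neqAle eq_sym u0'.
  rewrite E arc0 mdist_vertexl subr0.
  have [->|v1'] := eqVneq v 1; first by rewrite arc1 pdist_vertex vdist_sym.
  by have [|->] := inside v v0; rewrite // lt_neqAle v1'.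
have [E|v1'] := eqVneq v 1.
  by rewrite E arc1 mdist_vertexr; have [_ ->] := inside u u0' u1.
have {v1'} v1' : v < 1 by rewrite lt_neqAle v1'.
have [a1 a2 a3] := arc_inside x s1 u0' u1.
have [b1 b2 b3] := arc_inside x s1 v0 v1'.
rewrite mdist_same_edge ?a3 ?b3 ?distr_le //.
by rewrite /same_edge a1 a2 b1 b2 !eqxx.
Qed.

Definition geodesically_joined p q := exists f, geodesic_segment p q f.

Lemma joined_sym p q : geodesically_joined p q -> geodesically_joined q p.
Proof. by case=> f /geodesic_rev h; eexists; exact: h. Qed.

Lemma joined_refl p : geodesically_joined p p.
Proof.
exists (fun=> p); split=> // s t; rewrite mdistxx => h1 h2.
have -> : s - t = 0 by lra.
by rewrite normr0.
Qed.

Lemma joined_trans q p r : geodesically_joined p q -> geodesically_joined q r ->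
  mdist p q + mdist q r <= mdist p r -> geodesically_joined p r.
Proof.
case=> f hf [g hg] h; eexists; apply: (geodesic_cat hf hg).
by apply/eqP; rewrite eq_le h andbT; exact: metric_triangle.
Qed.

Lemma joined_arc x s (a b : R) : nu s = 1%N -> 0 <= a -> a <= b -> b <= 1 ->
  geodesically_joined (arc x s a) (arc x s b).
Proof.
move=> s1 a0 ab b1; exists (fun u => arc x s (a + u)).
rewrite /geodesic_segment arc_dist //; split; rewrite ?addr0 //.
  by rewrite addrC subrK.
suff main (u v : R) : 0 <= u -> u <= v -> v <= b - a ->
    mdist (arc x s (a + u)) (arc x s (a + v)) = v - u.
  move=> u v /andP[u0 u1] /andP[v0 v1]; have [uv|uv] := leP u v.
    by rewrite main // distr_le.
  by rewrite metric_sym main ?(ltW uv) // distrC distr_le // ltW.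
by move=> u0 uv v1; rewrite arc_dist //; lra.
Qed.

Lemma label_arc p : edge_label p <> 1%g -> nu (edge_label p) = 1%N /\
  p = arc (edge_src p) (edge_label p) (edge_offset p).
Proof.
move=> l1; case: (point_cases p) => [[]//|[_ o0 /eqP]].
rewrite vdist_edge -[1]/(1%:R) eqr_nat => /eqP s1; split=> //.
by have [a1 a2 a3] := arc_inside (edge_src p) s1 o0 (offset_lt1 p); apply: cayley_eq.
Qed.

Lemma joined_same_edge p q : same_edge p q -> geodesically_joined p q.
Proof.
wlog le : p q / edge_offset p <= edge_offset q.
  move=> H pq; have [le|/ltW le] := leP (edge_offset p) (edge_offset q); first exact: H.
  by apply: joined_sym; apply: H => //; rewrite same_edgeC.
move=> /[dup] pq /andP[/eqP h1 /eqP h2].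
case: (point_cases p) => [[l1 o0]|[l1 _ _]].
  case: (point_cases q) => [[k1 o0']|[k1]]; last by rewrite -h2 in k1.
  by rewrite (vertexE l1 o0) (vertexE k1 o0') h1; exact: joined_refl.
have [s1 Ep] := label_arc l1; have l1' : edge_label q <> 1%g by rewrite -h2.
have [_ Eq] := label_arc l1'; rewrite Ep Eq -h1 -h2.
by apply: joined_arc => //; [exact: offset_ge0|exact/ltW/offset_lt1].
Qed.

Lemma joined_src p : geodesically_joined p (vertex (edge_src p)).
Proof.
case: (point_cases p) => [[l1 o0]|[l1 _ _]].
  by rewrite {1}(vertexE l1 o0); exact: joined_refl.
have [s1 Ep] := label_arc l1; apply: joined_sym; rewrite {2}Ep -(arc0 _ (edge_label p)).
by apply: joined_arc => //; [exact: offset_ge0|exact/ltW/offset_lt1].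
Qed.

Lemma joined_tgt p : geodesically_joined p (vertex (edge_tgt p)).
Proof.
case: (point_cases p) => [[l1 o0]|[l1 _ _]].
  by rewrite /edge_tgt l1 mulg1; exact: joined_src.
have [s1 Ep] := label_arc l1; rewrite {1}Ep /edge_tgt -arc1.
by apply: joined_arc => //; [exact: offset_ge0|exact/ltW/offset_lt1].
Qed.

(** The splitting property of the norm supplies the next vertex of a geodesic. *)
Lemma joined_vertices x y : geodesically_joined (vertex x) (vertex y).
Proof.
move E : (nu (x^-1 * y)%g) => n; elim: n x E => [|n IH] x E.
  have -> : x = y by apply: vdist_eq0; rewrite /vdist E.
  exact: joined_refl.
case: n IH E => [|n] IH E.
  have -> : vertex y = arc x (x^-1 * y)%g 1 by rewrite arc1 mulVKg.
  by rewrite -(arc0 x (x^-1 * y)%g); exact: joined_arc.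
have [a [b [Eab na nb]]] := nu_split E.
have Eb : ((x * a)^-1 * y)%g = b by rewrite invgM -mulgA Eab mulKg.
apply: (@joined_trans (vertex (x * a)%g)); last 1 first.
- by rewrite !mdist_vertexr !pdist_vertex /vdist E Eb nb mulKg na -natrD add1n.
- have := IH x; clear IH => _; rewrite -(arc0 x a) -arc1; exact: joined_arc.
- by apply: IH; rewrite Eb.
Qed.

Lemma joined_vertex p z : geodesically_joined p (vertex z).
Proof.
case: (pdistP p z) => h.
  apply: joined_trans (joined_src p) (joined_vertices _ _) _.
  rewrite !mdist_vertexr pdist_vertex h.
  by have := pdist_le1 p (edge_src p); rewrite vdistxx addr0; lra.
apply: joined_trans (joined_tgt p) (joined_vertices _ _) _.
rewrite !mdist_vertexr pdist_vertex h.
by have := pdist_le2 p (edge_tgt p); rewrite vdistxx addr0; lra.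
Qed.

(** Between different edges the distance is attained through some vertex [w], and
    the two halves of such a path are geodesics. *)
Lemma cayley_geodesic : geodesic_space cayley.
Proof.
move=> p q; change (geodesically_joined p q).
have [pq|pq] := boolP (same_edge p q); first exact: joined_same_edge.
have [w hw] := through_ge p q.
apply: joined_trans (joined_vertex p w) (joined_sym (joined_vertex q w)) _.
rewrite mdist_vertexr mdist_vertexl [leRHS]/(cdist p q).
by rewrite /cdist (negPf pq).
Qed.

Lemma mdist_near p q : mdist p q <= vdist (edge_src p) (edge_src q) + 2 /\
  vdist (edge_src p) (edge_src q) <= mdist p q + 2.
Proof.
have := mdist_src p; have := mdist_src q.
have := metric_triangle p (vertex (edge_src p)) q.
have := metric_triangle (vertex (edge_src p)) (vertex (edge_src q)) q.
have := metric_triangle (vertex (edge_src p)) p (vertex (edge_src q)).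
have := metric_triangle p q (vertex (edge_src q)).
rewrite (metric_sym (vertex (edge_src q)) q) (metric_sym (vertex (edge_src p)) p).
rewrite (mdist_vertexr (vertex (edge_src p)) (edge_src q)) pdist_vertex.
move: (mdist p q) (mdist q _) (mdist p (vertex (edge_src p))) (mdist (vertex (edge_src p)) q).
move: (mdist p _) (vdist _ _) => a b c d e f *; split; lra.
Qed.

Fact cayley_act_subproof g p : is_point ((g * edge_src p)%g, edge_label p, edge_offset p).
Proof. by case: p => -[[x s] t]. Qed.

Definition cayley_act g p : cayley := exist is_point _ (cayley_act_subproof g p).

Lemma cayley_act_vertex g x : cayley_act g (vertex x) = vertex (g * x)%g.
Proof. exact: cayley_eq. Qed.

Lemma cayley_act_isometric : isometric_action cayley_act.
Proof.
split=> [p|g h p|g p q].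
- by apply: cayley_eq => //; exact: mul1g.
- by apply: cayley_eq => //; exact/esym/mulgA.
rewrite [LHS]/(cdist _ _) [RHS]/(cdist _ _) /cdist /same_edge /through /pdist /edge_tgt.
rewrite ![edge_src (cayley_act _ _)]/= ![edge_label (cayley_act _ _)]/=.
rewrite ![edge_offset (cayley_act _ _)]/=.
rewrite -!mulgA !vdist_act; congr (if _ && _ then _ else _).
by apply/eqP/eqP => [/mulgI //|E]; exact: congr1 E.
Qed.

(** ** Acylindrical hyperbolicity from a norm *)

Variable delta : nat.
Hypothesis nu_four : forall x y z, (nu (x^-1 * z)%g + nu y <=
   maxn (nu (x^-1 * y)%g + nu z) (nu (y^-1 * z)%g + nu x) + delta)%N.
Hypothesis nu_acyl : forall e, exists r0 M : nat, forall y : G, (r0 <= nu y)%N ->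
  exists f : G -> nat,
  (forall g : G, (nu g <= e)%N /\ (nu (y^-1 * g * y)%g <= e)%N -> (f g < M)%N) /\
  (forall g h : G, (nu g <= e)%N /\ (nu (y^-1 * g * y)%g <= e)%N ->
     (nu h <= e)%N /\ (nu (y^-1 * h * y)%g <= e)%N -> f g = f h -> g = h).
Variables (g1 g2 : G) (c : nat).
Hypotheses (g1_grows : forall n, (n <= c * nu (g1 ^+ n)%g + c)%N)
  (g2_grows : forall n, (n <= c * nu (g2 ^+ n)%g + c)%N)
  (g1_g2 : forall m n, (nu (int_power g1 m) + nu (int_power g2 n) <=
     nu ((int_power g1 m)^-1 * int_power g2 n)%g + c)%N).

Local Notation act := cayley_act.

Lemma vdist_nat x y : vdist x y = (nu (x^-1 * y)%g)%:R. Proof. by []. Qed.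

Lemma cayley_hyperbolic : hyperbolic_space cayley.
Proof.
split; first exact: cayley_geodesic.
exists (2 * (delta%:R + 8)); apply: four_point_thin => p q r s.
have h : vdist (edge_src p) (edge_src q) + vdist (edge_src r) (edge_src s) <=
  Num.max (vdist (edge_src p) (edge_src r) + vdist (edge_src q) (edge_src s))
          (vdist (edge_src p) (edge_src s) + vdist (edge_src q) (edge_src r)) + delta%:R.
  have := nu_four ((edge_src s)^-1 * edge_src p)%g ((edge_src s)^-1 * edge_src r)%g
    ((edge_src s)^-1 * edge_src q)%g.
  have quot u v : (((edge_src s)^-1 * u)^-1 * ((edge_src s)^-1 * v) = u^-1 * v)%g.
    by rewrite invgM invgK !mulgA mulgK.
  rewrite !quot -(ler_nat R) !natrD natr_max !natrD -!vdist_nat.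
  rewrite !(vdist_sym (edge_src s)) (vdist_sym (edge_src r) (edge_src q)).
  by rewrite (addrC (vdist (edge_src q) (edge_src r))).
have near1 u v := (mdist_near u v).1; have near2 u v := (mdist_near u v).2.
rewrite maxEle in h; move: h; case: ifP => _ h.
  apply: (@le_trans _ _ (mdist p s + mdist q r + (delta%:R + 8))); last first.
    by rewrite lerD2r le_max lexx orbT.
  have := (near1 p q, near1 r s, near2 p s, near2 q r) => -[[[]]].
  move: h; move: (vdist _ _) (vdist _ _) (vdist _ _) (vdist _ _) => a b c1 d.
  by move: (mdist p q) (mdist r s) (mdist p s) (mdist q r) => *; lra.
apply: (@le_trans _ _ (mdist p r + mdist q s + (delta%:R + 8))); last first.
  by rewrite lerD2r le_max lexx.
have := (near1 p q, near1 r s, near2 p r, near2 q s) => -[[[]]].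
move: h; move: (vdist _ _) (vdist _ _) (vdist _ _) (vdist _ _) => a b c1 d.
by move: (mdist p q) (mdist r s) (mdist p r) (mdist q s) => *; lra.
Qed.

(** Up to the distance 2 to the vertices, moving [p] and [q] by at most [e] means
    that two conjugates of [g] have bounded norm. *)
Lemma cayley_acylindrical : acylindrical_action act.
Proof.
move=> e e0; have [e1 he1] : exists e1 : nat, e + 2 <= e1%:R.
  by exists (Num.bound (e + 2)); apply/ltW/archi_boundP; lra.
have [r0 [M H]] := nu_acyl e1.
exists (r0%:R + 2), M => p q hpq.
have hr : (r0 <= nu ((edge_src p)^-1 * edge_src q)%g)%N.
  by have := (mdist_near p q).1; rewrite -(ler_nat R) -vdist_nat; lra.
have [f [fM f_inj]] := H _ hr.
pose conj g := ((edge_src p)^-1 * g * edge_src p)%g.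
have small g : mdist p (act g p) <= e -> mdist q (act g q) <= e ->
    (nu (conj g) <= e1)%N /\
    (nu (((edge_src p)^-1 * edge_src q)^-1 * conj g * ((edge_src p)^-1 * edge_src q))%g <= e1)%N.
  have move_src r : mdist r (act g r) <= e ->
      (nu ((edge_src r)^-1 * (g * edge_src r))%g <= e1)%N.
    by move=> h; have := (mdist_near r (act g r)).2; rewrite vdist_nat -(ler_nat R); lra.
  move=> h1 h2; split; first by rewrite /conj -mulgA; exact: move_src.
  rewrite /conj invgM invgK !mulgA !mulgK -mulgA; exact: move_src.
apply: (@card_le_ordinals _ _ (f \o conj)) => [g [h1 h2]|g h [k1 k2] [l1 l2] E] /=.
  exact/fM/small.
have /(congr1 (fun x => edge_src p * x * (edge_src p)^-1)%g) : conj g = conj h.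
  by apply: f_inj => //; exact: small.
by rewrite /conj !mulgA mulgV !mul1g !mulgK.
Qed.

Lemma vertex_orbit_mdist g m n :
  mdist (act (int_power g m) (vertex 1%g)) (act (int_power g n) (vertex 1%g)) =
  (nu (g ^+ `|m - n|%N)%g)%:R.
Proof.
rewrite !cayley_act_vertex !mulg1 mdist_vertexr pdist_vertex /vdist int_power_quot.
congr (_%:R); case: (n - m) (opprB n m) => k <-.
  by rewrite abszN.
by rewrite abszN /= nuV.
Qed.

Lemma growing_hyperbolic g : (forall n, (n <= c * nu (g ^+ n)%g + c)%N) ->
  hyperbolic_isometry act g.
Proof.
move=> grow; exists (vertex 1%g), (c + nu g).+1%:R, 1.
have le_mul n : (nu (g ^+ n)%g <= nu g * n)%N.
  elim: n => [|n IH]; first by rewrite nu1.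
  by rewrite expgS mulnS; apply: leq_trans (nuM _ _) _; rewrite leq_add2l.
split; [by rewrite ler1n|exact: ler01|move=> m n /=].
rewrite vertex_orbit_mdist; set k := `|m - n|%N.
have -> : `|m - n|%:~R = k%:R :> R by rewrite -abszE.
set a := (c + nu g).+1; have a0 : (0 : R) < a%:R by rewrite ltr0n.
apply/andP; split.
  rewrite lerBlDr ler_pdivrMr // -[1]/(1%:R) -natrD -natrM ler_nat.
  apply: leq_trans (grow k) _; rewrite mulnDl mul1n.
  by rewrite mulnC leq_add ?leq_mul2l /a; lia.
rewrite -natrM -[1]/(1%:R) -natrD ler_nat; apply: leq_trans (le_mul k) _.
by apply: leq_trans (leq_addr _ _); rewrite leq_mul2r /a; lia.
Qed.

(** The powers of [g1] and [g2] have bounded Gromov product at the vertex [1], hence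
    at every base point [o]. *)
Lemma cayley_non_elementary : non_elementary_action act.
Proof.
exists g1, g2; split; [exact: growing_hyperbolic|exact: growing_hyperbolic|].
move=> o u v [hu _] [hv _] same; pose e := vertex 1%g.
have [i0 hi0] := same (c%:R + 3 * mdist o e + 1).
have := hi0 i0 i0 (leqnn _) (leqnn _); rewrite /gromov_product.
have [m ->] := hu i0; have [n ->] := hv i0.
have [_ _ iso] := cayley_act_isometric.
have : mdist (act (int_power g1 m) e) e + mdist (act (int_power g2 n) e) e <=
    mdist (act (int_power g1 m) e) (act (int_power g2 n) e) + c%:R.
  rewrite !cayley_act_vertex !mulg1 !mdist_vertexr !pdist_vertex.
  by rewrite /vdist !mulg1 !nuV -!natrD ler_nat.
have := iso (int_power g1 m) o e; have := iso (int_power g2 n) o e.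
move: (act (int_power g1 m) o) (act (int_power g1 m) e) => x ge.
move: (act (int_power g2 n) o) (act (int_power g2 n) e) => y he hy hx.
have := metric_triangle x ge o; have := metric_triangle ge e o.
have := metric_triangle y he o; have := metric_triangle he e o.
have := metric_triangle ge x he; have := metric_triangle x y he.
rewrite (metric_sym ge x) hx hy (metric_sym e o).
have := mdist_ge0 o e; have : 0 <= c%:R :> R by exact: ler0n.
move: (mdist o e) (mdist x o) (mdist y o) (mdist x y) (mdist x he).
by move: (mdist ge e) (mdist he e) (mdist ge he) (mdist ge o) (mdist he o) => *; lra.
Qed.

Lemma norm_acylindrically_hyperbolic : acylindrically_hyperbolic R G.
Proof.
exists cayley, act; split.
- exact: cayley_hyperbolic.
- exact: cayley_act_isometric.
- exact: cayley_acylindrical.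
- exact: cayley_non_elementary.
Qed.

End CayleyGraph.

(** * Centralizers of hyperbolic isometries *)

Section Centralizers.
Import Order.TTheory GRing.Theory Num.Theory.
Local Open Scope classical_set_scope.
Local Open Scope ring_scope.
Variables (R : realType) (X : metricType R).
Implicit Types (x y z w a b : X) (p q r : R -> X).

(** The Gromov product of [x] and [y] at [w] bounds, up to a constant, the distance
    from [w] to the side from [x] to [y]; the point is the one where the inscribed
    circle of a comparison triangle would touch that side. *)
Lemma near_gromov delta x y w p q r : thin_triangles X delta ->
  geodesic_segment x y p -> geodesic_segment y w q -> geodesic_segment x w r ->
  exists2 a : X, on_segment x y p a &
    mdist w a <= (mdist x w + mdist y w - mdist x y) / 2 + 2 * delta.
Proof.
move=> thin gp gq gr; pose t := (mdist x w + mdist x y - mdist y w) / 2.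
have t0 : 0 <= t.
  by have := metric_triangle y x w; rewrite /t (metric_sym y x); lra.
have t1 : t <= mdist x y.
  by have := metric_triangle x y w; rewrite /t; lra.
have [pa pb] := geodesic_point gp t0 t1.
have ha : on_segment x y p (p t) by exists t => //=; rewrite t0.
exists (p t) => //; have [b hb hab] := thin x y w p q r gp gq gr _ ha.
have := metric_triangle w b (p t); rewrite (metric_sym b (p t)) (metric_sym w b).
case: hb => -[s /= /andP[s0 s1] Eb]; rewrite -{}Eb in hab *.
  have [h1 h2] := geodesic_point gq s0 s1.
  have := metric_triangle y (q s) (p t); rewrite (metric_sym y (p t)) pb h1 h2.
  rewrite (metric_sym (q s) (p t)); move: hab; rewrite /t; clear.
  move: (mdist x y) (mdist y w) (mdist x w) (mdist (p _) (q s)) (mdist w (p _)).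
  by move=> *; lra.
have [h1 h2] := geodesic_point gr s0 s1.
have := metric_triangle x (r s) (p t); rewrite pa h1 h2.
rewrite (metric_sym (r s) (p t)); move: hab; rewrite /t; clear.
move: (mdist x y) (mdist y w) (mdist x w) (mdist (p _) (r s)) (mdist w (p _)).
by move=> *; lra.
Qed.

Lemma gromov_le_segment x z w r b : geodesic_segment x z r -> on_segment x z r b ->
  mdist x w + mdist z w - mdist x z <= 2 * mdist w b :> R.
Proof.
move=> gr [s /= /andP[s0 s1] <-]; have [h1 h2] := geodesic_point gr s0 s1.
have := metric_triangle x (r s) w; have := metric_triangle z (r s) w.
rewrite (metric_sym z (r s)) (metric_sym (r s) w) h1 h2; clear.
by move: (mdist x z) (mdist x w) (mdist z w) (mdist w (r s)) => *; lra.
Qed.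

(** The point of the side from [x] to [y] that is close to [w] is also close to one
    of the other sides of the triangle [x], [y], [z], and the distance from [w] to
    that side bounds the corresponding Gromov product from above. *)
Lemma thin_four_point delta : geodesic_space X -> thin_triangles X delta ->
  four_point X (6 * delta).
Proof.
move=> geo thin x y z w.
have [p gp] := geo x y; have [q gq] := geo y w; have [r gr] := geo x w.
have [a ha hwa] := near_gromov thin gp gq gr.
have [q' gq'] := geo y z; have [r' gr'] := geo x z.
have [b hb hab] := thin x y z p q' r' gp gq' gr' a ha.
have tri := metric_triangle w a b.
case: hb => hb.
  apply: (@le_trans _ _ (mdist x w + mdist y z + 6 * delta)); last first.
    by rewrite lerD2r le_max lexx orbT.
  have := gromov_le_segment w gq' hb; move: hwa hab tri; rewrite (metric_sym y z); clear.
  move: (mdist x y) (mdist x w) (mdist y w) (mdist z w) (mdist z y).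
  by move: (mdist w a) (mdist a b) (mdist w b) => *; lra.
apply: (@le_trans _ _ (mdist x z + mdist y w + 6 * delta)); last first.
  by rewrite lerD2r le_max lexx.
have := gromov_le_segment w gr' hb; move: hwa hab tri; clear.
move: (mdist x y) (mdist x w) (mdist y w) (mdist z w) (mdist x z).
by move: (mdist w a) (mdist a b) (mdist w b) => *; lra.
Qed.

Variables (G : groupType) (act : G -> X -> X).
Hypothesis iso : isometric_action act.

Let act1 x : act 1%g x = x. Proof. by case: iso. Qed.
Let actM g h x : act (g * h)%g x = act g (act h x). Proof. by case: iso. Qed.
Let act_iso g x y : mdist (act g x) (act g y) = mdist x y.
Proof. by case: iso. Qed.

Section Axis.
Variables (delta : R) (x : X) (h : G).
Hypotheses (fp : four_point X delta) (delta0 : 0 <= delta).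

Definition transl n : R := mdist x (act (h ^+ n)%g x).
Local Notation F := transl.

Lemma transl_orbit i j : (i <= j)%N ->
  mdist (act (h ^+ i)%g x) (act (h ^+ j)%g x) = F (j - i)%N.
Proof. by move=> ij; rewrite -{1}(subnKC ij) expgnDr actM act_iso. Qed.

Lemma transl0 : F 0%N = 0. Proof. by rewrite /transl expg0 act1 mdistxx. Qed.

Lemma transl_ge0 n : 0 <= F n. Proof. exact: mdist_ge0. Qed.

Lemma transl_four i j k :
  F (i + j)%N + F (j + k)%N <= F i + F k + delta \/
  F (i + j)%N + F (j + k)%N <= F (i + j + k)%N + F j + delta.
Proof.
have le1 : (i <= i + j)%N by lia.
have le2 : (i + j <= i + j + k)%N by lia.
have := four_pointE fp x (act (h ^+ (i + j)%N)%g x) (act (h ^+ i)%g x)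
  (act (h ^+ (i + j + k)%N)%g x).
rewrite (transl_orbit (leq_trans le1 le2)) (transl_orbit le2).
rewrite (metric_sym (act (h ^+ (i + j)%N)%g x)) (transl_orbit le1).
have -> : (i + j + k - i = j + k)%N by lia.
have -> : (i + j + k - (i + j) = k)%N by lia.
by have -> : (i + j - i = j)%N by lia.
Qed.

Hypothesis jump : F 1%N + 3 * delta + 1 <= F 2%N.

(** By the four point condition a positive increment makes the next one at least
    [F 2 - F 1 - delta]. *)
Lemma transl_step k : (0 < k)%N -> F k + 2 * delta + 1 <= F k.+1.
Proof.
elim: k => // -[_ _|k IH _]; first by move: jump delta0; move: (F 1%N) (F 2%N) => a b *; lra.
have := IH isT; have := transl_four k.+1 1 1; rewrite !addn1.
move: jump delta0; move: (F 1%N) (F 2%N) (F k.+1) (F k.+2) (F k.+3).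
by move=> a b c d e j d0 [h1|h1] h2; lra.
Qed.

Lemma transl_mono k : F k <= F k.+1.
Proof.
case: k => [|k]; first by rewrite transl0 transl_ge0.
have := transl_step (ltn0Sn k); move: delta0 (F k.+1) (F k.+2) => *; lra.
Qed.

Lemma transl_linear k : k%:R <= F k + 1.
Proof.
elim: k => [|[|k] IH]; first by rewrite transl0; lra.
  by rewrite lerDr transl_ge0.
move: IH; have := transl_step (ltn0Sn k); rewrite -[k.+2%:R]natr1.
move: delta0 (k.+1%:R : R) (F k.+1) (F k.+2) => *; lra.
Qed.

Lemma transl_succ k : F k.+1 <= F k + F 1%N.
Proof.
have := metric_triangle x (act (h ^+ k)%g x) (act (h ^+ k.+1)%g x).
by rewrite transl_orbit // subSnn.
Qed.

(** Consecutive segments of the orbit of [x] are almost aligned. *)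
Lemma transl_superadd (p q : nat) : F p + F q <= F (p + q)%N + F 1%N + delta.
Proof.
have f1 := transl_ge0 1%N.
case: p => [|p].
  by rewrite transl0 add0n; move: f1 delta0; move: (F _) (F _) => *; lra.
case: q => [|[|q]].
- by rewrite transl0 addn0; move: f1 delta0; move: (F _) (F _) => *; lra.
- rewrite addn1; have := transl_mono p.+1; move: f1 delta0.
  by move: (F p.+1) (F p.+2) (F 1%N) => *; lra.
have := transl_four p.+1 1 q.+1; rewrite addn1 add1n addSnnS.
have := transl_step (ltn0Sn p); have := transl_step (ltn0Sn q).
move: f1 delta0.
move: (F 1%N) (F p.+1) (F p.+2) (F q.+1) (F q.+2) (F (p.+1 + q.+2)%N).
by move=> a b c d e f f1 d0 h1 h2 [h3|h3]; lra.
Qed.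

Lemma transl_between (s : R) n : 0 <= s -> s <= F n ->
  exists k, [/\ (k <= n)%N, F k <= s & s <= F k + F 1%N].
Proof.
move=> s0; elim: n => [|n IH] hs.
  exists 0%N; split=> //; rewrite ?transl0 //.
  by rewrite add0r; apply: le_trans hs _; rewrite transl0 transl_ge0.
have [h'|h'] := leP s (F n).
  by have [k [k1 k2 k3]] := IH h'; exists k; split=> //; exact: leqW.
by exists n; split=> //; [exact: ltW|apply: le_trans hs (transl_succ n)].
Qed.

(** Both the orbit of [x] and its image under [c] are almost geodesic, and they
    are at bounded distance; far from their ends they are therefore at distance
    bounded independently of [c]. *)
Lemma commuting_returns c : commute c h -> exists N k,
  mdist (act (h ^+ k)%g x) (act (c * h ^+ N)%g x) <= 2 * F 1%N + 4 * delta.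
Proof.
move=> ch; pose D := mdist x (act c x).
have D0 : 0 <= D := mdist_ge0 _ _.
have f1 := transl_ge0 1%N; have d0 := delta0.
have [N hN] : exists N : nat, 2 * D + F 1%N + 2 * delta + 2 <= N%:R.
  exists (Num.bound (2 * D + F 1%N + 2 * delta + 2)).
  by apply/ltW/archi_boundP; lra.
have FN := transl_linear N.
have add := transl_superadd N N.
have hc j : mdist (act (h ^+ j)%g x) (act c (act (h ^+ j)%g x)) = D.
  by rewrite -actM (commuteX j ch) actM act_iso.
pose A := x; pose B := act (h ^+ (N + N)%N)%g x; pose P := act c (act (h ^+ N)%g x).
pose A' := act c A; pose B' := act c B.
have AB : mdist A B = F (N + N)%N by [].
have AB' : mdist A' B' = F (N + N)%N by rewrite /A' /B' act_iso.
have AA : mdist A' A = D by rewrite metric_sym.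
have BB : mdist B' B = D by rewrite metric_sym hc.
have AP : mdist A' P = F N by rewrite /A' /P act_iso.
have BP : mdist B' P = F N.
  by rewrite /B' /P act_iso metric_sym transl_orbit ?leq_addr // addKn.
have AP_le : mdist A P <= D + F N.
  by have := metric_triangle A A' P; rewrite (metric_sym A A') AA AP.
have AP_ge : F N - D <= mdist A P.
  by have := metric_triangle A' A P; rewrite AA AP; lra.
have BP_ge : F N - D <= mdist B P.
  by have := metric_triangle B' B P; rewrite BB BP; lra.
have step1 : F (N + N)%N + mdist A P <= F N + mdist A B' + delta.
  have := four_pointE fp A' B' A P; rewrite AB' AA BP AP (metric_sym B' A).
  by case=> // *; lra.
have step2 : mdist A B' + mdist B P <= F (N + N)%N + F N + delta.
  have := four_pointE fp A B' B P; rewrite AB BP BB.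
  by case=> // *; lra.
have [k [k1 k2 k3]] : exists k, [/\ (k <= N + N)%N, F k <= mdist A P & mdist A P <= F k + F 1%N].
  by apply: transl_between; [exact: mdist_ge0|lra].
exists N, k; rewrite actM -/P.
have QB := transl_superadd k (N + N - k)%N; rewrite subnKC // in QB.
have := four_pointE fp (act (h ^+ k)%g x) P A B.
rewrite AB (metric_sym _ A) (metric_sym P B) (metric_sym P A).
rewrite transl_orbit // -[mdist x (act (h ^+ k)%g x)]/(F k); case=> *; lra.
Qed.

End Axis.

(** The lower bound of a quasi-isometric orbit map, along the positive powers. *)
Definition escapes x h := exists a b : R, [/\ 1 <= a, 0 <= b &
  forall n : nat, n%:R / a - b <= mdist x (act (h ^+ n)%g x)].

(** Otherwise the displacement would only grow by a constant each time the
    exponent is doubled, hence logarithmically. *)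
Lemma escapes_jump x h (C : R) : 0 <= C -> escapes x h ->
  exists2 n, (0 < n)%N &
    transl x (h ^+ n)%g 1%N + C <= transl x (h ^+ n)%g 2%N.
Proof.
move=> C0 [a [b [a1 b0 hab]]]; apply/not_exists2P => H.
pose f n := mdist x (act (h ^+ n)%g x).
have f0 : 0 <= f 1%N := mdist_ge0 _ _.
have dbl n : (0 < n)%N -> f (n * 2)%N <= f n + C.
  move=> n0; case: (H n) => // /negP; rewrite /transl -!expgnA muln1 -ltNge.
  exact: ltW.
have bound k : f (2 ^ k)%N <= f 1%N + k%:R * C.
  elim: k => [|k IH]; first by rewrite mul0r addr0.
  have := dbl _ (expn_gt0 2 k); rewrite expnSr -natr1 mulrDl mul1r.
  by move: IH; move: (f _) (f _) (k%:R * C) => *; lra.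
pose v := 2 * C + f 1%N + b + 1.
have v0 : 1 <= v by rewrite /v; lra.
pose k := Num.bound (a * v).
have hk : a * v <= k%:R by apply/ltW/archi_boundP; apply: mulr_ge0; lra.
have a0 : 0 < a by lra.
have k1 : 1 <= k%:R :> R.
  by apply: le_trans hk; rewrite -[1]mulr1; apply: ler_pM; rewrite ?ler01.
have sq : k%:R * k%:R <= (2 ^ (k + k))%:R :> R.
  by rewrite -natrM ler_nat expnD leq_mul // ltnW // ltn_expl.
have h1 := le_trans (hab (2 ^ (k + k))%N) (bound (k + k)%N).
have h2 : k%:R * v <= (2 ^ (k + k))%:R / a.
  rewrite ler_pdivlMr //; apply: le_trans sq.
  by rewrite -mulrA (mulrC v) ler_wpM2l // ler0n.
have h3 : f 1%N + b + 1 <= k%:R * (f 1%N + b + 1).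
  by apply: ler_peMl => //; lra.
have h4 : k%:R * v = (k + k)%:R * C + k%:R * (f 1%N + b + 1).
  by rewrite natrD /v; ring.
lra.
Qed.

Lemma int_power_expg (g : G) n (s : int) :
  int_power (g ^+ n)%g s = int_power g (n%:Z * s).
Proof. by rewrite (mulrC n%:Z) int_powerM; case: s => k /=; rewrite ?expVgn expgnAC. Qed.

Lemma escapes_expg x h n : (0 < n)%N -> escapes x h -> escapes x (h ^+ n)%g.
Proof.
move=> n0 [a [b [a1 b0 hab]]]; exists a, b; split=> // k.
rewrite -expgnA; apply: le_trans (hab _); rewrite lerD2r ler_pM2r; last first.
  by rewrite invr_gt0; lra.
by rewrite ler_nat leq_pmull.
Qed.

Lemma hyperbolic_escapes h : hyperbolic_isometry act h -> exists x, escapes x h.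
Proof.
case=> x [a [b [a1 b0 hab]]]; exists x, a, b; split=> // n.
have /andP[+ _] := hab 0 n%:Z; rewrite /= act1 sub0r normrN => h1.
by apply: le_trans h1; rewrite pmulrn.
Qed.

Lemma escapes_order x h n : (0 < n)%N -> escapes x h -> (h ^+ n)%g <> 1%g.
Proof.
move=> n0 [a [b [a1 b0 hab]]] E.
pose k := Num.bound (a * (b + 1)).
have hk : a * (b + 1) <= k%:R by apply/ltW/archi_boundP; apply: mulr_ge0; lra.
have := hab (n * k)%N; rewrite expgnA E expg1n act1 mdistxx.
apply/negP; rewrite -ltNge subr_gt0 ltr_pdivlMr ?(lt_le_trans ltr01 a1) //.
apply: (@lt_le_trans _ _ k%:R); last by rewrite ler_nat leq_pmull.
by apply: lt_le_trans hk; rewrite mulrC ltr_pM2l ?ltrDl //; lra.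
Qed.

Hypotheses (hyp : hyperbolic_space X) (acyl : acylindrical_action act).

Let four : exists2 delta : R, 0 <= delta & four_point X delta.
Proof.
case: hyp => geo [d thin]; have fp := thin_four_point geo thin.
case: (pselect (exists x : X, True)) => [[x _]|no]; last first.
  by exists 0 => // x; case: no; exists x.
by exists (6 * d) => //; have := four_pointE fp x x x x; rewrite !mdistxx; case=> *; lra.
Qed.

(** Products of [c ^+ i] with powers of [H = h ^+ n] that move [x] by a bounded amount
    also move a far point of the orbit of [H] by that amount, since they commute with
    [H].  By acylindricity there are finitely many, so two exponents give the same
    element. *)
Lemma centralizer_virtually_cyclic x h c : escapes x h -> commute c h ->
  exists2 m, (0 < m)%N & exists s : int, (c ^+ m)%g = int_power h s.
Proof.
move=> esc ch; have [delta d0 fp] := four.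
have [n n0 jump] := @escapes_jump x h (3 * delta + 1) (ltac:(lra)) esc.
rewrite addrA in jump; set H := (h ^+ n)%g in jump.
have cH : commute c H by exact: commuteX.
have [f hf] : exists f : nat -> nat * nat, forall i,
    mdist (act (H ^+ (f i).2)%g x) (act (c ^+ i * H ^+ (f i).1)%g x) <=
    2 * transl x H 1%N + 4 * delta.
  suff ex i : exists ij : nat * nat, mdist (act (H ^+ ij.2)%g x)
      (act (c ^+ i * H ^+ ij.1)%g x) <= 2 * transl x H 1%N + 4 * delta.
    by have [f hf] := boolp.choice ex; exists f.
  have ciH : commute (c ^+ i)%g H by apply/commute_sym/commuteX/commute_sym.
  by have [N [k hk]] := commuting_returns fp d0 jump ciH; exists (N, k).
have f1 : 0 <= transl x H 1%N := transl_ge0 _ _ _.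
have [r0 [M hM]] := acyl (ltac:(lra) : 0 < 2 * transl x H 1%N + 4 * delta + 1).
pose J := Num.bound (`|r0| + 1).
have hJ : r0 <= mdist x (act (H ^+ J)%g x).
  have := transl_linear fp d0 jump J; rewrite -/(transl x H J).
  have : `|r0| + 1 < J%:R by apply: archi_boundP; have := normr_ge0 r0; lra.
  by have := ler_norm r0; lra.
pose gm i := ((H ^+ (f i).2)^-1 * (c ^+ i * H ^+ (f i).1))%g.
have gmH i : commute (gm i) H.
  apply/commute_sym; rewrite /gm; apply: commuteM; last first.
    by apply: commuteM; [exact/commuteX/commute_sym|exact/commuteX/commute_refl].
  exact/commuteV/commuteX/commute_refl.
have disp i : mdist x (act (gm i) x) <= 2 * transl x H 1%N + 4 * delta + 1.
  have := hf i; rewrite -(act_iso (H ^+ (f i).2)%g x) -actM /gm mulVKg; lra.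
have [i [j [ij jM E]]] : exists i j, [/\ (i < j)%N, (j <= M)%N & gm i = gm j].
  apply: contrapT => no.
  have inj : set_inj `I_M.+1 gm.
    move=> i j; rewrite !inE /= => iM jM E; apply/eqP; apply: contrapT => /eqP ij.
    by apply: no; case: (ltngtP i j) ij => // k _; [exists i, j|exists j, i].
  suff [F] : $|{injfun `I_M.+1 >-> [set g |
      mdist x (act g x) <= 2 * transl x H 1%N + 4 * delta + 1 /\
      mdist (act (H ^+ J)%g x) (act g (act (H ^+ J)%g x)) <= 2 * transl x H 1%N + 4 * delta + 1]}|.
    have := card_le_trans (inj_card_le F) (hM _ _ hJ).
    by rewrite card_le_II ltnn.
  apply/injfunPex; exists gm => // i _ /=; split; first exact: disp.
  by rewrite -actM (commuteX J (gmH i)) actM act_iso; exact: disp.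
exists (j - i)%N; first by rewrite subn_gt0.
exists (n%:Z * ((f j).2%:Z - (f j).1%:Z - ((f i).2%:Z - (f i).1%:Z))).
rewrite -int_power_expg -/H.
have pw k : (c ^+ k)%g = (int_power H ((f k).2%:Z - (f k).1%:Z) * gm k)%g.
  have -> : int_power H ((f k).2%:Z - (f k).1%:Z) = (H ^+ (f k).2 * (H ^+ (f k).1)^-1)%g.
    by rewrite int_powerD int_powerN.
  have gH : commute (gm k) ((H ^+ (f k).1)^-1)%g by apply/commuteV/commuteX.
  by rewrite -mulgA -gH /gm !mulgA mulgV mul1g mulgK.
rewrite expgnFr ?(ltnW ij) // !pw E invgM -[LHS]mulgA mulVKg.
by rewrite [RHS]int_powerD int_powerN.
Qed.

Lemma escapes_inv x h : escapes x h -> escapes x h^-1%g.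
Proof.
case=> a [b [a1 b0 hab]]; exists a, b; split=> // n.
by rewrite expVgn -(act_iso (h ^+ n)%g) -actM mulgV act1 metric_sym.
Qed.

Lemma orbit_same_end delta x h : four_point X delta -> 0 <= delta ->
  transl x h 1%N + 3 * delta + 1 <= transl x h 2%N ->
  same_end x (fun i => act (h ^+ i)%g x) (fun i => act (h ^+ i)%g x).
Proof.
move=> fp d0 jump M; set B := transl x h 1%N + delta.
have B0 : 0 <= B by rewrite addr_ge0 ?transl_ge0.
pose N := Num.bound (`|M| + 1 + B); exists N.
have hN : `|M| + 1 + B < N%:R.
  by apply: archi_boundP; have := normr_ge0 M; lra.
suff main i j : (N <= i)%N -> (i <= j)%N ->
    M <= gromov_product x (act (h ^+ i)%g x) (act (h ^+ j)%g x).
  move=> i j Ni Nj; have [ij|/ltnW ij] := leqP i j; first exact: main.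
  have := main j i Nj ij; rewrite /gromov_product.
  by rewrite (metric_sym (act (h ^+ j)%g x) (act (h ^+ i)%g x)) [X in X - _]addrC.
move=> Ni ij; rewrite /gromov_product transl_orbit // !(metric_sym _ x).
rewrite -[mdist x (act (h ^+ i)%g x)]/(transl x h i) -[mdist x _]/(transl x h j).
have := transl_superadd fp d0 jump i (j - i)%N; rewrite subnKC //.
have := transl_linear fp d0 jump i; have := ler_norm M.
have : N%:R <= i%:R :> R by rewrite ler_nat.
move: hN B0; rewrite /B.
move: (transl x h 1%N) (transl x h i) (transl x h j) (transl x h (j - i)%N).
by move=> *; lra.
Qed.

(** A power of [h] is a power of [g], so the powers of that element give one sequence
    that represents a limit point of both. *)
Lemma central_power_elementary x g h n : (0 < n)%N -> escapes x g ->
  hyperbolic_isometry act h -> commute h (g ^+ n)%g ->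
  ~ independent_isometries act g h.
Proof.
move=> n0 esc /hyperbolic_escapes[y esch] hg ind.
have escn := escapes_expg n0 esc.
have [m m0 [s Es]] := centralizer_virtually_cyclic escn hg.
pose w := (h ^+ m)%g; have escw : escapes x w.
  rewrite /w Es; case: s Es => [[|k]|k] Es.
  - by case: (escapes_order m0 esch Es).
  - exact: escapes_expg.
  - by apply: escapes_inv; exact: escapes_expg.
have [delta d0 fp] := four.
have C0 : 0 <= 3 * delta + 1 by lra.
have [k k0 jump] := escapes_jump C0 escw; rewrite addrA in jump.
have same := orbit_same_end fp d0 jump.
apply: (ind x _ _ _ _ same); split=> // i.
- exists (n%:Z * s * k%:Z * i%:Z); congr act.
  by rewrite !int_powerM -int_power_expg -Es.
- exists (m%:Z * k%:Z * i%:Z); congr act.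
  by rewrite !int_powerM.
Qed.

(** If [g] is hyperbolic, some power of it lies in [A] or in [B], because the first
    component of [g] commutes with [g] and is therefore commensurable with it or of
    finite order.  An element of infinite order of the other subgroup commutes with
    that power, so it has a power in common with [g]; this power lies in both
    subgroups and is central, which leaves no room for a second hyperbolic element. *)
Lemma no_commuting_factors (A B : G -> Prop) :
  (forall a b : G, A a -> A b -> A (a * b)%g) -> (forall a : G, A a -> A a^-1%g) ->
  (forall a b : G, B a -> B b -> B (a * b)%g) -> (forall b : G, B b -> B b^-1%g) ->
  (forall a b : G, A a -> B b -> commute a b) ->
  (forall g : G, exists a b : G, [/\ A a, B b & g = (a * b)%g]) ->
  (exists2 a : G, A a & forall n, (0 < n)%N -> (a ^+ n)%g <> 1%g) ->
  (exists2 b : G, B b & forall n, (0 < n)%N -> (b ^+ n)%g <> 1%g) ->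
  ~ non_elementary_action act.
Proof.
move=> AM AV BM BV AB split infA infB [g [h [/hyperbolic_escapes[x esc] lh ind]]].
have expP (S : G -> Prop) : (forall a b : G, S a -> S b -> S (a * b)%g) ->
    forall n (a : G), (0 < n)%N -> S a -> S (a ^+ n)%g.
  move=> SM [//|n] a _ Sa; elim: n => [|n IH]; first by rewrite expg1.
  by rewrite expgS; exact: SM.
have intP (S : G -> Prop) : (forall a b : G, S a -> S b -> S (a * b)%g) ->
    (forall a : G, S a -> S a^-1%g) ->
    forall s (a : G), S a -> int_power a s <> 1%g -> S (int_power a s).
  move=> SM SV [[|k]|k] a Sa //= _; first exact: expP.
  by apply: SV; exact: expP.
have main (S T : G -> Prop) n : (forall a b : G, S a -> S b -> S (a * b)%g) ->
    (forall a : G, S a -> S a^-1%g) -> (forall a b : G, T a -> T b -> T (a * b)%g) ->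
    (forall a b : G, S a -> T b -> commute a b) ->
    (forall g : G, exists a b : G, [/\ S a, T b & g = (a * b)%g]) ->
    (exists2 b : G, T b & forall n, (0 < n)%N -> (b ^+ n)%g <> 1%g) ->
    (0 < n)%N -> S (g ^+ n)%g -> False.
  move=> SM SV TM ST gen [q Tq qinf] n0 Sgn.
  have [m m0 [s Es]] := centralizer_virtually_cyclic (escapes_expg n0 esc)
    (commute_sym (ST _ _ Sgn Tq)).
  have Tz : T (q ^+ m)%g by exact: expP.
  have Sz : S (q ^+ m)%g.
    by rewrite Es; apply: intP => //; rewrite -Es; exact: qinf.
  have central (y : G) : commute y (q ^+ m)%g.
    have [a [b [Sa Tb ->]]] := gen y; apply/commute_sym/commuteM.
      exact/commute_sym/ST.
    exact: ST.
  have [k k0 hk] : exists2 k, (0 < k)%N & commute h (g ^+ k)%g.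
    have := central h; rewrite Es; case: s Es => [[|k]|k] Es hc.
    - by case: (qinf m m0); rewrite Es.
    - by exists (n * k.+1)%N; rewrite ?muln_gt0 ?n0 // expgnA.
    - exists (n * k.+1)%N; rewrite ?muln_gt0 ?n0 // expgnA.
      by move: hc => /= /commuteV; rewrite invgK.
  exact: central_power_elementary k0 esc lh hk ind.
have [a [b [Aa Bb Eg]]] := split g.
have ab : commute a b by exact: AB.
have ag : commute a g by rewrite Eg; apply: commuteM => //; exact: commute_refl.
have [m m0 [r Er]] := centralizer_virtually_cyclic esc ag.
have [r0|r0] := eqVneq r 0.
  have Bg : B (g ^+ m)%g.
    by rewrite Eg expgMn // Er r0 mul1g; exact: expP.
  apply: (main B A m BM BV AM _ _ infA m0 Bg); first by move=> *; exact/commute_sym/AB.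
  move=> y; have [a' [b' [Aa' Bb' ->]]] := split y.
  by exists b', a'; split=> //; exact: AB.
have Am : A (a ^+ m)%g by exact: expP.
have [k k0 Ak] : exists2 k, (0 < k)%N & A (g ^+ k)%g.
  case: r Er r0 => [[|k]|k] Er // _; first by exists k.+1; rewrite // -[(_ ^+ _)%g]Er.
  exists k.+1 => //; have := AV _ Am; rewrite Er /= invgK; exact.
exact: main A B k AM AV BM AB split infB k0 Ak.
Qed.

End Centralizers.

(** * The marker norm on an internal semidirect product *)

Section MarkerNorm.
Local Open Scope group_scope.
Variables (I : choiceType) (Q : groupType) (P : I -> Q -> Prop) (K : Q -> Prop).
Hypotheses (PM : forall i a b, P i a -> P i b -> P i (a * b))
  (PV : forall i a, P i a -> P i a^-1).
Hypotheses (K1 : K 1) (KM : forall a b, K a -> K b -> K (a * b))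
  (KV : forall a, K a -> K a^-1).
Hypothesis KP : forall i k a, K k -> P i a -> P i (k * a * k^-1).
Implicit Types (w u v m : seq (I * Q)).

Definition inP w := forall p, p \in w -> P p.1 p.2.

Lemma inP_push p w : P p.1 p.2 -> inP w -> inP (push p w).
Proof.
case: w => [|q w] Pp iw /=.
  by case: ifP => _ // q; rewrite inE => /eqP ->.
have Pq : P q.1 q.2 by apply: iw; rewrite inE eqxx.
have iw' : inP w by move=> x xw; apply: iw; rewrite inE xw orbT.
case: eqP => [E|_]; case: ifP => _ //.
  move=> x; rewrite inE => /orP[/eqP ->|/iw' //] /=.
  by apply: PM => //; rewrite E.
by move=> x; rewrite inE => /orP[/eqP ->|/iw].
Qed.

Lemma inP_mul u v : inP u -> inP v -> inP (mulw u v).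
Proof.
move=> + iv; elim: u => //= p u IH iu; apply: inP_push.
  by apply: iu; rewrite inE eqxx.
by apply: IH => x xu; apply: iu; rewrite inE xu orbT.
Qed.

Lemma inP_inv w : inP w -> inP (invw w).
Proof.
by move=> iw p; rewrite mem_rev => /mapP[q /iw qw ->] /=; exact: PV.
Qed.

Lemma inP_conj k w : K k -> inP w -> inP (conjw k w).
Proof. by move=> Kk iw p /mapP[q /iw qw ->] /=; exact: KP. Qed.

Lemma inP_cat u v : inP u -> inP v -> inP (u ++ v).
Proof. by move=> iu iv p; rewrite mem_cat => /orP[/iu|/iv]. Qed.

Definition factored g := exists w k,
  [/\ reduced w, inP w, K k & g = evalw w * k].

Lemma factored_K k : K k -> factored k.
Proof. by move=> Kk; exists [::], k; rewrite evalw0 mul1g. Qed.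

Lemma factored_P i p : P i p -> factored p.
Proof.
move=> Pp; have [->|p1] := eqVneq p 1; first exact: factored_K.
exists [:: (i, p)], 1; split; rewrite ?evalw_cons ?evalw0 ?mulg1 //.
  by rewrite reduced_cons p1.
by move=> q; rewrite inE => /eqP ->.
Qed.

Lemma factoredM g h : factored g -> factored h -> factored (g * h).
Proof.
move=> [u [k [ru iu Kk ->]]] [v [l [rv iv Kl ->]]].
exists (mulw u (conjw k v)), (k * l); split.
- by apply: mulw_reduced; rewrite reduced_conjw.
- by apply: inP_mul => //; exact: inP_conj.
- exact: KM.
by rewrite evalw_mul evalw_conjw !mulgA mulgVK.
Qed.

Lemma factoredV g : factored g -> factored g^-1.
Proof.
move=> [w [k [rw iw Kk ->]]]; exists (conjw k^-1 (invw w)), k^-1; split.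
- by rewrite reduced_conjw reduced_invw.
- by apply: inP_conj; [exact: KV|exact: inP_inv].
- exact: KV.
by rewrite evalw_conjw evalw_inv // invgM invgK mulgK.
Qed.

Hypothesis gen : forall g, factored g.
Hypothesis free : forall w, reduced w -> inP w -> K (evalw w) -> w = [::].

Variables (m0 : seq (I * Q)) (t0 : I * Q).
Hypotheses (m0_cyc : reduced (m0 ++ m0)) (m0_P : inP m0) (m0_neq0 : m0 != [::]).
Hypothesis m0_stab : forall k, K k -> conjw k m0 = m0 -> k = 1.
Hypotheses (t0_P : P t0.1 t0.2) (t0_m0 : reduced (t0 :: m0))
  (t0_Vm0 : reduced (t0 :: invw m0)).

(** [K] acts freely on the markers: this is what will make the action on the Cayley
    graph acylindrical although [K] may be infinite. *)
Definition marker m : Prop :=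
  exists2 k, K k & m = conjw k m0 \/ m = conjw k (invw m0).

Local Notation N := (mcount marker).
Local Notation packs := (packs marker).
Local Notation l := (size m0).

Lemma nf_exists g : exists wk : seq (I * Q) * Q,
  [/\ reduced wk.1, inP wk.1, K wk.2 & g = evalw wk.1 * wk.2].
Proof. by have [w [k H]] := gen g; exists (w, k). Qed.

(** The two parts of the normal form of [g], which [nf_unique] makes independent of
    the choice. *)
Definition nf g := (projT1 (cid (nf_exists g))).1.
Definition kf g := (projT1 (cid (nf_exists g))).2.

Lemma nfP g : [/\ reduced (nf g), inP (nf g), K (kf g) & g = evalw (nf g) * kf g].
Proof. by rewrite /nf /kf; case: cid => -[w k]. Qed.

Lemma nf_red g : reduced (nf g). Proof. by have [] := nfP g. Qed.
Lemma kf_K g : K (kf g). Proof. by have [] := nfP g. Qed.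

Lemma nf_unique w w' k k' : reduced w -> inP w -> K k ->
  reduced w' -> inP w' -> K k' -> evalw w * k = evalw w' * k' -> w = w' /\ k = k'.
Proof.
move=> rw iw Kk rw' iw' Kk' E.
have rm : reduced (mulw (invw w) w') by exact: mulw_reduced.
have e : mulw (invw w) w' = [::].
  apply: free => //; first by apply: inP_mul => //; exact: inP_inv.
  rewrite evalw_mul evalw_inv //.
  have -> : evalw w' = evalw w * k * k'^-1 by rewrite E mulgK.
  by rewrite -!mulgA mulKg; apply: KM => //; exact: KV.
have ww : w = w'.
  have := congr1 (mulw w) e; rewrite -mulwA ?reduced_invw // mulwV // mulw0 //.
split=> //; move: E; rewrite ww; exact: mulgI.
Qed.

Lemma nfE w k : reduced w -> inP w -> K k ->
  nf (evalw w * k) = w /\ kf (evalw w * k) = k.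
Proof.
move=> rw iw Kk; have [r1 i1 k1 E] := nfP (evalw w * k).
by have [] := nf_unique r1 i1 k1 rw iw Kk (esym E).
Qed.

Lemma nfM g h : nf (g * h) = mulw (nf g) (conjw (kf g) (nf h)) /\
  kf (g * h) = kf g * kf h.
Proof.
have [rg ig kg Eg] := nfP g; have [rh ih kh Eh] := nfP h.
have -> : g * h = evalw (mulw (nf g) (conjw (kf g) (nf h))) * (kf g * kf h).
  rewrite evalw_mul evalw_conjw {1}Eg {1}Eh.
  by rewrite !mulgA mulgVK.
apply: nfE; last exact: KM.
- by apply: mulw_reduced; rewrite reduced_conjw.
- by apply: inP_mul => //; exact: inP_conj.
Qed.

Lemma nf1 : nf 1 = [::] /\ kf 1 = 1.
Proof.
by have := @nfE [::] 1 isT _ K1; rewrite evalw0 mulg1; apply.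
Qed.

Lemma nfV g : nf g^-1 = conjw (kf g)^-1 (invw (nf g)) /\ kf g^-1 = (kf g)^-1.
Proof.
have [rg ig kg Eg] := nfP g.
have -> : g^-1 = evalw (conjw (kf g)^-1 (invw (nf g))) * (kf g)^-1.
  by rewrite evalw_conjw evalw_inv // {1}Eg invgM invgK mulgK.
apply: nfE; last exact: KV.
- by rewrite reduced_conjw reduced_invw.
- by apply: inP_conj; [exact: KV|exact: inP_inv].
Qed.

(** ** Markers *)

Lemma marker_conj k m : K k -> marker m -> marker (conjw k m).
Proof.
by move=> Kk [k' Kk' [->|->]]; exists (k * k'); rewrite ?conjwM;
  [exact: KM|left|exact: KM|right].
Qed.

Lemma marker_inv m : marker m -> marker (invw m).
Proof.
move=> [k Kk H]; exists k => //.
by case: H => ->; rewrite invw_conjw ?invwK; [right|left].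
Qed.

Lemma marker_size m : marker m -> size m = l.
Proof. by case=> k _ [->|->]; rewrite size_conjw ?size_invw. Qed.

Lemma marker_stab m k : marker m -> K k -> conjw k m = m -> k = 1.
Proof.
move=> [k' Kk' Hm] Kk E.
have E0 : conjw k (conjw k' m0) = conjw k' m0.
  case: Hm E => -> // E; have := congr1 (@invw _ _) E.
  by rewrite !invw_conjw invwK.
have : k'^-1 * k * k' = 1.
  apply: m0_stab; first by apply: KM => //; apply: KM => //; exact: KV.
  by rewrite !conjwM E0 conjwVK.
by move=> H; apply: (@mulgI _ k'^-1); apply: (@mulIg _ k'); rewrite H mulg1 mulVg.
Qed.

Lemma packs_conj n k w : K k -> packs n w -> packs n (conjw k w).
Proof.
move=> Kk; elim: n w => // n IH w [z [m [w' [-> z0 hm w0 h]]]].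
exists (conjw k z), (conjw k m), (conjw k w'); split.
- by rewrite -!conjw_cat.
- by rewrite -size_eq0 size_conjw size_eq0.
- exact: marker_conj.
- by rewrite -size_eq0 size_conjw size_eq0.
- exact: IH.
Qed.

Lemma packs_inv n w : packs n w -> packs n (invw w).
Proof.
elim: n w => // n IH w [z [m [w' [-> z0 hm w0 h]]]].
rewrite !invw_cat -catA; apply: packs_rcons => //.
- exact: IH.
- by rewrite -size_eq0 size_invw size_eq0.
- exact: marker_inv.
- by rewrite -size_eq0 size_invw size_eq0.
Qed.

Lemma N_conj k w : K k -> N (conjw k w) = N w.
Proof.
move=> Kk; apply/eqP; rewrite eqn_leq; apply/andP; split; apply: packs_count.
  by have := packs_conj (KV Kk) (count_packs marker (conjw k w)); rewrite conjwVK.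
by apply: packs_conj => //; exact: count_packs.
Qed.

Lemma N_inv w : N (invw w) = N w.
Proof.
apply/eqP; rewrite eqn_leq; apply/andP; split; apply: packs_count.
  by have := packs_inv (count_packs marker (invw w)); rewrite invwK.
by apply: packs_inv; exact: count_packs.
Qed.

Lemma N_catl u v : (N u <= N (u ++ v))%N.
Proof. by apply: packs_count; apply: packs_suf; exact: count_packs. Qed.

Lemma N_catr u v : (N v <= N (u ++ v))%N.
Proof. by apply: packs_count; apply: packs_pre; exact: count_packs. Qed.

Lemma N_cat_ge u v : (N u + N v <= N (u ++ v))%N.
Proof. by apply: packs_count; apply: packs_cat; exact: count_packs. Qed.

Lemma N_split u p v p' p'' :
  (N (u ++ p :: v) <= N (rcons u p') + N (p'' :: v) + 1)%N.
Proof.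
have [a [b [hab ha hb]]] := @packs_split _ marker (N (u ++ p :: v)) u [:: p] v
  [:: p'] [:: p''] isT erefl erefl (count_packs _ _).
apply: (leq_trans hab); rewrite leq_add2r; apply: leq_add; apply: packs_count => //.
by rewrite -cats1.
Qed.

Lemma N_cat_le u v : (N (u ++ v) <= N u + N v + 1)%N.
Proof.
have [a [b [hab ha hb]]] := @packs_split _ marker (N (u ++ v)) u [::] v
  [::] [::] isT erefl erefl (count_packs _ _).
apply: (leq_trans hab); rewrite leq_add2r; apply: leq_add; apply: packs_count => //.
by move: ha; rewrite cats0.
Qed.

Lemma N_small w : (size w <= 1)%N -> N w = 0%N.
Proof.
move=> hw; case E: (N w) => [//|n]; have := count_packs marker w; rewrite E.
case=> z [m [w' [Ew z0 _ w0 _]]]; move: hw; rewrite Ew !size_cat.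
by case: z z0 {Ew} => //= a z _; case: w' w0 => //= b w' _; rewrite !addnS.
Qed.

Lemma N_mul u v : reduced u -> reduced v -> (N (mulw u v) <= N u + N v + 1)%N.
Proof.
move=> ru rv; have [u0 [r [v0 [Eu Ev H]]]] := mulwP ru rv.
have hu : (N u0 <= N u)%N by rewrite Eu N_catl.
have hv : (N v0 <= N v)%N by rewrite Ev N_catr.
case: H => [->|[i [a [b [u1 [v1 [E1 E2 _ ->]]]]]]].
  by apply: (leq_trans (N_cat_le _ _)); rewrite leq_add2r leq_add.
apply: (leq_trans (N_split _ _ _ (i, a) (i, b))).
by rewrite leq_add2r leq_add -?E1 -?E2.
Qed.

(** ** The norm *)

(** Concatenation can create one marker more than the two words contain, so adding
    1 outside the identity makes the count subadditive. *)
Definition nu g : nat := if g == 1 then 0%N else (N (nf g)).+1.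

Lemma nu_eq0 g : nu g = 0%N -> g = 1.
Proof. by rewrite /nu; case: eqP. Qed.

Lemma nu1 : nu 1 = 0%N. Proof. by rewrite /nu eqxx. Qed.

Lemma nuV g : nu g^-1 = nu g.
Proof.
rewrite /nu invg_eq1; case: ifP => // _.
by rewrite (nfV g).1 N_conj ?N_inv //; apply/KV/kf_K.
Qed.

Lemma nu_le g : (nu g <= (N (nf g)).+1)%N.
Proof. by rewrite /nu; case: ifP. Qed.

Lemma N_nu g : (N (nf g) <= nu g)%N.
Proof. by rewrite /nu; case: eqP => [->|_] //; rewrite nf1.1 N_small. Qed.

Lemma nuM g h : (nu (g * h)%g <= nu g + nu h)%N.
Proof.
have [->|g1] := eqVneq g 1; first by rewrite mul1g nu1.
have [->|h1] := eqVneq h 1; first by rewrite mulg1 nu1 addn0.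
apply: (leq_trans (nu_le _)); rewrite (nfM g h).1 /nu (negPf g1) (negPf h1).
have := @N_mul (nf g) (conjw (kf g) (nf h)) (nf_red g).
rewrite reduced_conjw nf_red N_conj; last exact: kf_K.
by move=> /(_ isT); lia.
Qed.

(** The cut is placed right after the first marker: the gap condition makes that
    prefix marker-free, and the rest loses exactly one marker. *)
Lemma first_cut w n : N w = n.+1 -> exists h1 h2,
  [/\ w = h1 ++ h2, h1 != [::], h2 != [::], N h1 = 0%N & N h2 = n].
Proof.
move=> E; have h : exists e, `[< packs 1 (take e w) >].
  exists (size w); rewrite take_size; apply/asboolP.
  have := count_packs marker w; rewrite E => -[z [m [w' [-> z0 hm w0 _]]]].
  by exists z, m, w'.
case: (ex_minnP h) => e /asboolP[z [m [w' [Et z0 hm w0 _]]]] emin.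
have he : (e <= size w)%N.
  rewrite leqNgt; apply/negP => hs; suff : (e <= size w)%N by rewrite leqNgt hs.
  apply: emin; rewrite take_size; apply/asboolP; exists z, m, w'; split=> //.
  by rewrite -Et take_oversize // ltnW.
have [x Ew'] : exists x, w' = [:: x].
  case/lastP: w' w0 Et => // w' x _ Et; have [->|w0] := eqVneq w' [::].
    by exists x.
  have es : e = (size (z ++ m ++ w')).+1.
    by rewrite -(size_takel he) Et !size_cat size_rcons !addnS.
  have : packs 1 (take e.-1 w).
    exists z, m, w'; split=> //; have := congr1 (take (size (z ++ m ++ w'))) Et.
    by rewrite -cats1 !catA take_size_cat // take_takel ?es // -!catA.
  by move/asboolT/emin; rewrite es ltnn.
have es : e = (size (z ++ m)).+1.
  by rewrite -(size_takel he) Et Ew' !size_cat /= addn1 addnS.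
have Ew : w = (z ++ m) ++ drop (size (z ++ m)) w.
  rewrite -{1}(cat_take_drop (size (z ++ m)) w); congr (_ ++ _).
  have := congr1 (take (size (z ++ m))) Et.
  by rewrite take_takel ?es // Ew' catA take_size_cat.
set h2 := drop _ w in Ew.
have h20 : h2 != [::] by rewrite -size_eq0 size_drop subn_eq0 -ltnNge -es.
have N1 : N (z ++ m) = 0%N.
  case N1 : (N (z ++ m)) => [//|k]; have := count_packs marker (z ++ m).
  rewrite N1 => -[z' [m' [w'' [E' z'0 hm' w''0 _]]]].
  have : packs 1 (take (size (z ++ m)) w).
    by rewrite Ew take_size_cat // E'; exists z', m', w''.
  by move/asboolT/emin; rewrite es ltnn.
exists (z ++ m), h2; split=> //; first by case: (z) z0.
apply/eqP; rewrite eqn_leq; apply/andP; split.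
  rewrite -ltnS -E; apply: packs_count; rewrite Ew -catA.
  by exists z, m, h2; split=> //; exact: count_packs.
by have := N_cat_le (z ++ m) h2; rewrite -Ew E N1; lia.
Qed.

Lemma nu_split g n : nu g = n.+2 -> exists a b, [/\ g = a * b, nu a = 1%N & nu b = n.+1].
Proof.
rewrite /nu; case: eqP => // /eqP g1 [/first_cut[h1 [h2 [E h10 h20 N1 N2]]]].
have [rg ig kg Eg] := nfP g.
have [r1 i1] : reduced h1 /\ inP h1.
  split; first by move: rg; rewrite E; exact: reduced_catl.
  by move=> p ph; apply: ig; rewrite E mem_cat ph.
have [r2 i2] : reduced h2 /\ inP h2.
  split; first by move: rg; rewrite E; exact: reduced_catr.
  by move=> p ph; apply: ig; rewrite E mem_cat ph orbT.
have ne w k : reduced w -> inP w -> K k -> w != [::] -> (evalw w * k == 1) = false.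
  move=> rw iw Kk w0; apply/eqP => e1; have := (nfE rw iw Kk).1.
  by rewrite e1 nf1.1 => w1; rewrite -w1 eqxx in w0.
exists (evalw h1 * 1), (evalw h2 * kf g); split.
- by rewrite mulg1 mulgA -evalw_cat -E.
- by rewrite ne // (nfE r1 i1 K1).1 N1.
- by rewrite ne // (nfE r2 i2 kg).1 N2.
Qed.

(** ** Hyperbolicity *)

Definition gap u v := N (mulw (invw u) v).

Lemma gapC u v : reduced u -> reduced v -> gap u v = gap v u.
Proof.
by move=> ru rv; rewrite /gap -N_inv invw_mul ?reduced_invw // invwK.
Qed.

Lemma gap_pre p a b : reduced (p ++ a) -> reduced (p ++ b) ->
  gap (p ++ a) (p ++ b) = gap a b.
Proof.
move=> ra rb; rewrite /gap; congr N.
have [rp ra'] := (reduced_catl ra, reduced_catr ra).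
have rb' := reduced_catr rb.
rewrite invw_cat -(mulw_cat rb) -mulw_cat; last by rewrite -invw_cat reduced_invw.
rewrite mulwA ?reduced_invw ?mulw_reduced //; congr mulw.
by rewrite -mulwA // mulVw.
Qed.

Lemma gap_le a b : reduced a -> reduced b -> (gap a b <= N a + N b + 1)%N.
Proof.
by move=> ra rb; have := N_mul (_ : reduced (invw a)) rb;
  rewrite reduced_invw N_inv; apply.
Qed.

Definition diverge a b := [\/ a = [::], b = [::] |
  exists x a' y b', [/\ a = x :: a', b = y :: b' & x != y :> I * Q]].

Let gap_arith (x y a b c d : nat) : (x <= 0 + a + 1)%N -> (y <= 0 + b + 1)%N ->
  (b <= c)%N -> (a + c <= d)%N -> (x + y <= d + 2)%N.
Proof. lia. Qed.

(** No cancellation occurs between words that differ in their first syllable; at most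
    these two syllables merge. *)
Lemma gap_ge a b : reduced a -> reduced b -> diverge a b ->
  (N a + N b <= gap a b + 2)%N.
Proof.
move=> ra rb; rewrite /gap; case=> [->|->|].
- by rewrite /= N_small //; lia.
- by rewrite mulw0 ?reduced_invw // N_inv (@N_small [::]) //; lia.
case=> -[i s] [a' [[j t] [b' [Ea Eb st]]]].
have [ra' rb'] : reduced a' /\ reduced b'.
  by move: ra rb; rewrite Ea Eb => /reduced_behead ? /reduced_behead.
rewrite Ea Eb invw_cons /= -cats1 /mulw foldr_cat -/(mulw _ _) -Eb.
have [ij|ij] := eqVneq i j.
  subst j; have st1 : s^-1 * t != 1.
    by apply/eqP => /(congr1 (fun x => s * x)); rewrite mulVKg mulg1 => E; rewrite E eqxx in st.
  rewrite Eb /= eqxx (negPf st1) mulw_cat; last first.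
    rewrite reduced_cat_cons; apply/andP; split; last first.
      by move: rb; rewrite Eb !reduced_cons /= st1 => /and3P[_ -> ->].
    rewrite -reduced_invw -cats1 invw_cat invwK /= reduced_cons /= invg_eq1 st1 /=.
    by move: ra; rewrite Ea !reduced_cons => /and3P[_ -> ->].
  have := N_cat_ge (invw a') ((i, s^-1 * t) :: b').
  have h3 := N_catr [:: (i, s^-1 * t)] b'.
  have h1 := N_cat_le [:: (i, s)] a'; have h2 := N_cat_le [:: (i, t)] b'.
  rewrite (@N_small [:: _]) // in h1; rewrite (@N_small [:: _]) // in h2.
  rewrite N_inv; exact: gap_arith h1 h2 h3.
have s1 : s != 1 by move: ra; rewrite Ea reduced_cons => /and3P[].
have r0 : reduced (push (i, s^-1) b) by exact: push_reduced.
have Ep : push (i, s^-1) b = (i, s^-1) :: b.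
  by rewrite push_cons // Eb reduced_cons /= invg_eq1 s1 ij -Eb.
rewrite -[foldr _ _ _]/(push (i, s^-1) b) Ep mulw_cat; last first.
  rewrite reduced_cat_cons -Ep r0 andbT -reduced_invw -cats1 invw_cat invwK /=.
  by rewrite invgK -Ea.
have := N_cat_ge (invw a') ((i, s^-1) :: b).
have h3 := N_catr [:: (i, s^-1)] b.
have h1 := N_cat_le [:: (i, s)] a'; have h2 : (N b <= 0 + N b + 1)%N by lia.
rewrite (@N_small [:: _]) // in h1; rewrite N_inv.
exact: gap_arith h1 h2 h3.
Qed.

Lemma gap_prefix p a b c : reduced (p ++ a) -> reduced (p ++ b) ->
  reduced (p ++ c) -> diverge a b ->
  (gap (p ++ a) (p ++ c) + N (p ++ b) <= gap (p ++ a) (p ++ b) + N (p ++ c) + 5)%N.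
Proof.
move=> ra rb rc ab; rewrite !gap_pre //.
have := gap_ge (reduced_catr ra) (reduced_catr rb) ab.
have := gap_le (reduced_catr ra) (reduced_catr rc).
have := N_cat_le p b; have := N_cat_ge p c; lia.
Qed.

(** The four point condition: of the two prefixes that [v] shares with [u] and
    with [w], the shorter one is shared by all three words. *)
Lemma gap_four u v w : reduced u -> reduced v -> reduced w ->
  (gap u w + N v <= maxn (gap u v + N w) (gap v w + N u) + 5)%N.
Proof.
move=> ru rv rw.
have [p [a [b [Eu Ev ab]]]] := common_prefix u v.
have [q [b' [c [Ev' Ew bc]]]] := common_prefix v w.
have E : p ++ b = q ++ b' by rewrite -Ev -Ev'.
have [hpq|hpq] := leqP (size p) (size q).
  have [q' Eq] : exists q', q = p ++ q'.
    exists (drop (size p) q); rewrite -{1}(cat_take_drop (size p) q).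
    congr (_ ++ _); have := congr1 (take (size p)) E.
    by rewrite (take_size_cat _ (erefl (size p))) takel_cat.
  have Ew' : w = p ++ (q' ++ c) by rewrite catA -Eq.
  have := @gap_prefix p a b (q' ++ c); rewrite -Eu -Ev -Ew' => /(_ ru rv rw ab).
  lia.
have [p' Ep] : exists p', p = q ++ p'.
  exists (drop (size q) p); rewrite -{1}(cat_take_drop (size q) p).
  congr (_ ++ _); have := congr1 (take (size q)) E.
  by rewrite (take_size_cat _ (erefl (size q))) takel_cat // ltnW.
have Eu' : u = q ++ (p' ++ a) by rewrite catA -Ep.
have cb : diverge c b'.
  case: bc => [->|->|[x [a' [y [b'' [-> -> xy]]]]]]; [by constructor 2|by constructor 1|].
  by constructor 3; exists y, b'', x, a'; rewrite eq_sym.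
have := @gap_prefix q c b' (p' ++ a); rewrite -Eu' -Ev' -Ew => /(_ rw rv ru cb).
rewrite (gapC rw ru) (gapC rw rv); lia.
Qed.

Lemma nf_quot x y : nf (x^-1 * y) = conjw (kf x)^-1 (mulw (invw (nf x)) (nf y)).
Proof. by rewrite (nfM _ _).1 (nfV x).1 (nfV x).2 mulw_conjw. Qed.

Lemma N_quot x y : N (nf (x^-1 * y)) = gap (nf x) (nf y).
Proof. by rewrite nf_quot N_conj //; exact/KV/kf_K. Qed.

Lemma nu_four x y z :
  (nu (x^-1 * z)%g + nu y <=
   maxn (nu (x^-1 * y)%g + nu z) (nu (y^-1 * z)%g + nu x) + 7)%N.
Proof.
have := gap_four (nf_red x) (nf_red y) (nf_red z).
have := (nu_le (x^-1 * z), N_nu (x^-1 * y), N_nu (y^-1 * z)); rewrite !N_quot.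
have := (nu_le y, N_nu x, N_nu z) => -[[h1 h2] h3] [[h4 h5] h6]; lia.
Qed.

(** ** Acylindricity *)

Lemma packs_middle a b w : packs (a + b.+1) w -> exists u m v,
  [/\ w = u ++ m ++ v, u != [::], marker m, v != [::] & packs a u /\ packs b v].
Proof.
elim: a w => [|a IH] w; first by case=> z [m [w' [-> z0 hm w0 h]]]; exists z, m, w'.
case=> z [m [w' [-> z0 hm w0 /IH]]] [u [m1 [v [-> u0 hm1 v0 [hu hv]]]]].
exists (z ++ m ++ u), m1, v; split; rewrite -?catA //; first by case: (z) z0.
by split=> //; exists z, m, u.
Qed.

(** Left multiplication by [c] does not see what comes after a prefix [u] that
    carries more markers than [c] can cancel. *)
Lemma mulw_stable c u v : reduced c -> reduced (u ++ v) -> (N c + 3 <= N u)%N ->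
  mulw c (u ++ v) = mulw c u ++ v.
Proof.
move=> rc ruv hN; have [ru rv] := (reduced_catl ruv, reduced_catr ruv).
have [u0 [r [v0 [Ec Eu H]]]] := mulwP rc ru.
have hv0 : (2 <= N v0)%N.
  have := N_cat_le (invw r) v0; rewrite -Eu N_inv.
  by have := N_catr u0 r; rewrite -Ec; lia.
have rm := mulw_reduced c ru.
rewrite -{1}(mulw_cat ruv) -mulwA // mulw_cat //.
case: H => [E|[i [a [b [u1 [v1 [E1 E2 _ E]]]]]]].
  case/lastP: v0 Eu hv0 E => [_|v0 x Eu _ E]; first by rewrite N_small.
  have rx : reduced (x :: v).
    by move: ruv; rewrite Eu -cats1 -!catA => /reduced_catr/reduced_catr.
  rewrite E -cats1 -!catA /= catA reduced_cat_cons rx andbT.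
  by move: rm; rewrite E -!cats1 catA.
case/lastP: v1 E2 E => [E2|v1 x E2] E; first by move: hv0; rewrite E2 N_small.
have rx : reduced (x :: v).
  move: ruv; rewrite Eu E2 -cats1 -!catA => /reduced_catr.
  by rewrite cat_cons => /reduced_behead; rewrite -catA => /reduced_catr.
have -> : mulw c u ++ v = (u1 ++ (i, a * b) :: v1) ++ x :: v.
  by rewrite E -cats1 -!catA /= -catA.
by rewrite reduced_cat_cons rx andbT -cats1 -catA /= cats1 -E.
Qed.

Lemma mulw_stable_r u v c : reduced c -> reduced (u ++ v) -> (N c + 3 <= N v)%N ->
  mulw (u ++ v) c = u ++ mulw v c.
Proof.
move=> rc ruv hN; apply: (can_inj (@invwK _ _)).
have rv := reduced_catr ruv.
rewrite invw_mul // [RHS]invw_cat (invw_mul rv rc) invw_cat.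
apply: mulw_stable; rewrite ?reduced_invw ?N_inv //.
by rewrite -invw_cat reduced_invw.
Qed.

(** Elements [g] that move both [1] and a long [y] by at most [e].  The normal form
    of [y] is [u ++ m ++ v1 ++ v2] with a marker [m] in the middle.  The normal form of
    [g * y] still contains the conjugate of [m] by the [K]-part of [g], because [g] only
    alters the beginning of [u], and it starts with [w1], because [g * y] is [y]
    multiplied on the right by a small element, which only alters [v2].  So the
    conjugate of [m] occurs in the fixed word [w1] after a prefix [trace g] that
    contains nearly as many markers as [u]. *)
Section Displacement.
Variables (e : nat) (y : Q) (u m v1 v2 : seq (I * Q)).
Hypotheses (Ey : nf y = u ++ m ++ v1 ++ v2) (u0 : u != [::]) (hm : marker m).
Hypotheses (hu : (e + 3 <= N u)%N) (hv1 : (e + 3 + N m <= N v1)%N)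
  (hv2 : (e + 3 <= N v2)%N).

Let small (g : Q) := (nu g <= e)%N /\ (nu (y^-1 * g * y)%g <= e)%N.
Let w1 := u ++ m ++ v1.
Let trace (g : Q) := mulw (nf g) (conjw (kf g) u).
Let pos g := size (trace g).

Let trace_prefix g : small g -> [/\ trace g = take (pos g) w1,
  conjw (kf g) m = take l (drop (pos g) w1), (N (trace g) <= N u + e + 1)%N
  & (N u <= N (trace g) + e + 1)%N].
Proof.
case=> hg hz; have Ng := leq_trans (N_nu g) hg.
have Kg := kf_K g; have ry := nf_red y.
have E1 : nf (g * y) = trace g ++ conjw (kf g) m ++ conjw (kf g) (v1 ++ v2).
  rewrite (nfM _ _).1 Ey !(conjw_cat _ u) mulw_stable ?nf_red ?N_conj //.
  - by rewrite -conjw_cat.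
  - by rewrite -conjw_cat reduced_conjw -Ey.
  - by lia.
have E2 : exists Z, nf (g * y) = w1 ++ Z.
  have -> : g * y = y * (y^-1 * g * y) by rewrite !mulgA mulgV mul1g.
  exists (mulw v2 (conjw (kf y) (nf (y^-1 * g * y)))).
  rewrite (nfM _ _).1 Ey !catA -(catA u) -/w1 mulw_stable_r //.
  - by rewrite reduced_conjw nf_red.
  - by rewrite /w1 -!catA -Ey.
  - rewrite N_conj; last exact: kf_K.
    by rewrite (leq_trans _ hv2) // leq_add2r (leq_trans (N_nu _) hz).
case: E2 => Z; rewrite E1 => E.
have ru : reduced u by move: ry; rewrite Ey; exact: reduced_catl.
have h1 : (N (trace g) <= N u + e + 1)%N.
  have := @N_mul (nf g) (conjw (kf g) u) (nf_red g).
  by rewrite reduced_conjw N_conj // => /(_ ru); rewrite /trace; lia.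
have h2 : (N u <= N (trace g) + e + 1)%N.
  have Eu : mulw (invw (nf g)) (trace g) = conjw (kf g) u.
    by rewrite /trace -mulwA ?nf_red ?reduced_conjw // mulVw ?nf_red.
  rewrite -(N_conj u Kg) -Eu; have := @N_mul (invw (nf g)) (trace g).
  rewrite reduced_invw nf_red N_inv mulw_reduced ?reduced_conjw //.
  by move=> /(_ isT isT); lia.
have hs : (pos g + l <= size w1)%N.
  rewrite leqNgt; apply/negP => hs.
  have Ew : w1 = take (size w1) (trace g ++ conjw (kf g) m).
    have := congr1 (take (size w1)) E.
    rewrite catA (take_size_cat _ (erefl (size w1))) takel_cat //.
    by rewrite (size_cat (trace g)) size_conjw (marker_size hm); exact: ltnW.
  have a1 : (N w1 <= N (trace g ++ conjw (kf g) m))%N.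
    rewrite {1}Ew -{2}(cat_take_drop (size w1) (trace g ++ _)); exact: N_catl.
  have := N_cat_le (trace g) (conjw (kf g) m); rewrite (N_conj m Kg).
  have := N_cat_ge u (m ++ v1); have := N_catr m v1; rewrite -/w1; lia.
have Et : trace g = take (pos g) w1.
  have := congr1 (take (pos g)) E; rewrite (take_size_cat _ (erefl (pos g))) takel_cat //.
  by apply: leq_trans hs; exact: leq_addr.
split=> //; have := congr1 (drop (pos g)) E; rewrite (drop_size_cat _ (erefl (pos g))) drop_cat.
case: ltnP => [hp|hp]; last first.
  by move: hs hp m0_neq0; case: (m0) => //= *; lia.
have sm : size (conjw (kf g) m) = l by rewrite size_conjw marker_size.
move=> /(congr1 (take l)); rewrite (take_size_cat _ sm) => ->.
by rewrite takel_cat // size_drop; lia.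
Qed.

(** The number of markers in [trace g] leaves few choices, and elements with equal
    number whose prefixes differ in length by more than a marker cannot exist, as the
    longer prefix would contain one marker more.  Hence that number and the length
    modulo [l.+1] determine the length, so the prefix and the conjugate of [m], hence
    the [K]-part of [g] because [m] has trivial stabilizer, and then [g]. *)
Let code g := ((N (trace g) + e + 1 - N u) * l.+1 + pos g %% l.+1)%N.

Lemma small_displacement : exists f : Q -> nat,
  (forall g, small g -> (f g < (2 * e + 3) * l.+1)%N) /\
  (forall g h, small g -> small h -> f g = f h -> g = h).
Proof.
exists code; split=> [g sg|].
  have [_ _ h1 h2] := trace_prefix sg; rewrite /code.
  have : (N (trace g) + e + 1 - N u <= 2 * e + 2)%N by lia.
  have := ltn_pmod (pos g) (ltn0Sn l).
  set a := (N _ + e + 1 - N u)%N; set b := (_ %% _)%N => hb ha.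
  apply: (@leq_trans ((2 * e + 2) * l.+1 + l.+1)); last by rewrite -mulSnr; lia.
  by rewrite -addnS leq_add // leq_mul2r ha orbT.
have main g h : small g -> small h -> code g = code h -> (pos g <= pos h)%N -> g = h.
  move=> sg sh E hp.
  have [Eg Eg' g1 g2] := trace_prefix sg; have [Eh Eh' h1 h2] := trace_prefix sh.
  have EN : N (trace g) = N (trace h).
    have /(congr1 (fun x => x %/ l.+1)%N) := E.
    by rewrite /code !divnMDl // !divn_small ?ltn_mod // !addn0; lia.
  have Em : pos g = pos h %[mod l.+1].
    have /(congr1 (fun x => x %% l.+1)%N) := E.
    by rewrite /code !modnMDl !modn_mod.
  have Ep : pos g = pos h.
    apply/eqP; move: hp; rewrite leq_eqVlt => /orP[//|hlt]; exfalso.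
    have hle : (pos g + l < pos h)%N.
      have : (l.+1 %| pos h - pos g)%N by rewrite -eqn_mod_dvd ?Em // ltnW.
      by move/dvdn_leq; rewrite subn_gt0 => /(_ hlt); lia.
    have : packs (N (trace g)).+1 (take (pos h) w1).
      have -> : take (pos h) w1 = trace g ++ conjw (kf g) m
           ++ take (pos h - pos g - l) (drop l (drop (pos g) w1)).
        rewrite Eg' {1}Eg; have Ed : pos h = (pos g + (l + (pos h - pos g - l)))%N by lia.
        by rewrite {1}Ed takeD takeD.
      apply: packs_rcons; first exact: count_packs.
      - apply/eqP => t0'; have := leq_trans hu g2.
        by rewrite t0' (@N_small [::]) //; lia.
      - exact/marker_conj/hm/kf_K.
      - have hp' : (pos h <= size w1)%N.
          by have := congr1 size Eh; rewrite size_take -/(pos h); case: ltnP => //; lia.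
        rewrite -size_eq0 size_take !size_drop; move: hle hp'.
        by move: (pos g) (pos h) (size w1) l => a b c d *; case: ltnP; lia.
    by move/packs_count; rewrite -Eh EN ltnn.
  have ET : trace g = trace h by rewrite Eg Eh Ep.
  have Ek : kf g = kf h.
    have Ec : conjw (kf g) m = conjw (kf h) m by rewrite Eg' Eh' Ep.
    have : (kf h)^-1 * kf g = 1.
      apply: (@marker_stab m) => //.
        by apply: KM; [exact/KV/kf_K|exact: kf_K].
      by rewrite conjwM Ec conjwVK.
    by move/(congr1 (fun x => kf h * x)); rewrite mulVKg mulg1.
  have back x : x = evalw (trace x) * kf x * (evalw u)^-1.
    have [_ _ _ Ex] := nfP x.
    by rewrite /trace evalw_mul evalw_conjw !mulgA mulgVK mulgK -Ex.
  by rewrite (back g) (back h) ET Ek.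
move=> g h sg sh E; have [hp|hp] := leqP (pos g) (pos h); first exact: main.
by apply/esym; apply: main => //; exact: ltnW.
Qed.

End Displacement.

Lemma nu_acyl e : exists r M, forall y : Q, (r <= nu y)%N -> exists f : Q -> nat,
  (forall g : Q, (nu g <= e)%N /\ (nu (y^-1 * g * y)%g <= e)%N -> (f g < M)%N) /\
  (forall g h : Q, (nu g <= e)%N /\ (nu (y^-1 * g * y)%g <= e)%N ->
     (nu h <= e)%N /\ (nu (y^-1 * h * y)%g <= e)%N -> f g = f h -> g = h).
Proof.
pose n := ((e + 3) + ((e + 3 + N m0) + (e + 3).+1).+1)%N.
exists n.+1, ((2 * e + 3) * l.+1)%N => y hy.
have hn : packs n (nf y).
  have := count_packs marker (nf y); have : (n <= N (nf y))%N.
    by rewrite -ltnS; apply: leq_trans hy (nu_le y).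
  by move=> hn /packs_le; apply.
have [u [m [v [Ey u0 hm v0 [hu /packs_middle[v1 [m' [v2 [Ev _ _ _ [h1 h2]]]]]]]]]] :=
  packs_middle hn.
apply: (@small_displacement e y u m (v1 ++ m') v2) => //.
- by rewrite Ey Ev !catA.
- exact: packs_count.
- have -> : N m = N m0.
    by case: hm => k Kk [->|->]; rewrite N_conj ?N_inv.
  exact: leq_trans (packs_count h1) (N_catl _ _).
- exact: packs_count.
Qed.

(** ** Two independent axes *)

Definition axis1 : Q := evalw m0.
Definition axis2 : Q := t0.2 * axis1 * t0.2^-1.

Lemma axis2X n : axis2 ^+ n = t0.2 * axis1 ^+ n * t0.2^-1.
Proof.
elim: n => [|n IH]; first by rewrite mulg1 mulgV.
by rewrite !expgS IH conj_mul.
Qed.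

Definition spow (b : bool) (g : Q) n := if b then g ^+ n else g ^- n.

Let rep n := flatten (nseq n m0).
Let srep (b : bool) n := if b then rep n else invw (rep n).

Let rep_comm n : m0 ++ rep n = rep n ++ m0.
Proof.
by elim: n => [|n IH]; rewrite /rep /= ?cats0 // -/(rep n) -catA -IH.
Qed.

Let rep_red n : reduced (rep n).
Proof.
elim: n => [//|[|n] IH]; first by rewrite /rep /= cats0; exact: reduced_catl m0_cyc.
exact: (@reduced_glue _ _ m0 m0 (rep n)).
Qed.

Let rep_P n : inP (rep n).
Proof. by elim: n => // n IH; apply: inP_cat. Qed.

Let rep_eval n : evalw (rep n) = axis1 ^+ n.
Proof. by elim: n => [|n IH]; rewrite ?evalw0 // /rep /= evalw_cat expgS -IH. Qed.

Let srep_red b n : reduced (srep b n).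
Proof. by case: b; rewrite /srep ?reduced_invw. Qed.

Let srep_P b n : inP (srep b n).
Proof. by case: b => //; exact: inP_inv. Qed.

Let srep_eval b n : evalw (srep b n) = spow b axis1 n.
Proof. by case: b; rewrite /srep ?evalw_inv // rep_eval. Qed.

Let srep_head b n : (0 < n)%N -> exists x z, srep b n = x :: z /\ reduced (t0 :: x :: z).
Proof.
have m0V : invw m0 != [::] by rewrite -size_eq0 size_invw size_eq0.
case: n => // n _; suff [y [z [E y0 ry]]] : exists y z,
    [/\ srep b n.+1 = y ++ z, y != [::] & reduced (t0 :: y)].
  have r : reduced (t0 :: y ++ z).
    by apply: (@reduced_glue _ _ [:: t0] y z) => //; rewrite -E.
  by case: y y0 {ry} E r => // x y _ E r; exists x, (y ++ z).
case: b; first by exists m0, (rep n).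
exists (invw m0), (invw (rep n)); split=> //.
by rewrite -invw_cat -rep_comm.
Qed.

(** Every second copy of [m0] in its power is a marker with gaps on both sides. *)
Lemma axis1_translation n : (n <= 2 * nu (axis1 ^+ n) + 2)%N.
Proof.
have h k : packs k (rep (2 * k + 1)).
  elim: k => // k IH; have -> : (2 * k.+1 + 1 = (2 * k + 1).+2)%N by lia.
  exists m0, m0, (rep (2 * k + 1)); split=> //.
    by exists 1 => //; left; rewrite conjw1.
  by rewrite addn1 /rep /=; case: (m0) m0_neq0.
have -> : axis1 ^+ n = evalw (rep n) * 1 by rewrite mulg1 rep_eval.
apply: (@leq_trans (2 * N (rep n) + 2)); last first.
  rewrite leq_add2r leq_mul2l; apply/orP; right.
  by rewrite -{1}(nfE (rep_red n) (@rep_P n) K1).1 N_nu.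
have [hn|hn] := posnP n; first lia.
have : packs (n.-1)./2 (rep n).
  have -> : n = ((2 * (n.-1)./2 + 1) + ~~ odd n)%N by lia.
  rewrite /rep nseqD flatten_cat; apply: packs_suf.
  by have := h (n.-1)./2; congr (packs _ (rep _)); lia.
by move/packs_count; lia.
Qed.

(** The normal forms of the powers of the second axis start with [t0], those of the
    first one do not, so [gap_ge] applies. *)
Lemma axes_independent b b' n n' :
  (nu (spow b axis1 n) + nu (spow b' axis2 n') <=
   nu ((spow b axis1 n)^-1 * spow b' axis2 n')%g + 4)%N.
Proof.
have E2 : spow b' axis2 n' = t0.2 * spow b' axis1 n' * t0.2^-1.
  by case: b'; rewrite /spow axis2X // conj_inv.
have [->|n'0] := posnP n'.
  have -> : spow b' axis2 0 = 1 by case: (b') => //=; rewrite invg1.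
  by rewrite mulg1 nuV nu1; lia.
have [x [z [Ez rz]]] := srep_head b' n'0.
pose v := t0 :: srep b' n' ++ [:: (t0.1, t0.2^-1)].
have rv : reduced v.
  apply: (@reduced_glue _ _ [:: t0]); rewrite ?Ez //.
  have [y [z' [Ez' rz']]] := srep_head (~~ b') n'0.
  have Ei : srep b' n' = invw (srep (~~ b') n') by case: (b'); rewrite /srep ?invwK.
  by rewrite -Ez Ei cats1 -invw_cons reduced_invw Ez'.
have iv : inP v.
  move=> p; rewrite inE mem_cat inE => /or3P[/eqP->//|/srep_P//|/eqP->] /=.
  exact: PV.
have Ev : spow b' axis2 n' = evalw v * 1.
  by rewrite E2 mulg1 /v evalw_cons evalw_cat srep_eval evalw_cons evalw0 mulg1 mulgA.
have Eu : spow b axis1 n = evalw (srep b n) * 1 by rewrite mulg1 srep_eval.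
have [nu1 ku1] := nfE (srep_red b n) (@srep_P b n) K1.
have [nv1 kv1] := nfE rv iv K1.
have := N_nu ((spow b axis1 n)^-1 * spow b' axis2 n'); rewrite N_quot.
have := (nu_le (spow b axis1 n), nu_le (spow b' axis2 n')).
rewrite Eu Ev nu1 nv1 => -[h1 h2] h3.
suff h4 : (N (srep b n) + N v <= gap (srep b n) v + 2)%N by lia.
apply: gap_ge => //; have [->|n0] := posnP n.
  by constructor 1; case: (b).
have [x' [y' [E' rx]]] := srep_head b n0.
constructor 3; exists x', y', t0, (srep b' n' ++ [:: (t0.1, t0.2^-1)]); split=> //.
by apply/eqP => H; move: rx; rewrite reduced_cons H eqxx andbF.
Qed.

Theorem marker_acylindrically_hyperbolic (R : realType) :
  acylindrically_hyperbolic R Q.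
Proof.
have spowE g (n : int) : exists b k, int_power g n = spow b g k.
  by case: n => k; [exists true, k|exists false, k.+1].
have nu_t0 n : (nu (axis1 ^+ n) <= nu (axis2 ^+ n) + 2 * nu t0.2)%N.
  have -> : axis1 ^+ n = t0.2^-1 * axis2 ^+ n * t0.2.
    by rewrite axis2X !mulgA mulVg mul1g mulgVK.
  apply: leq_trans (nuM _ _) _; rewrite mul2n -addnn addnA leq_add2r.
  by apply: leq_trans (nuM _ _) _; rewrite nuV addnC.
pose c := (4 * nu t0.2 + 4)%N.
apply: (@norm_acylindrically_hyperbolic R Q nu nu1 nu_eq0 nuV nuM nu_split 7 nu_four
  nu_acyl axis1 axis2 c) => [n|n|m n].
- apply: leq_trans (axis1_translation n) _; apply: leq_add; last by rewrite /c; lia.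
  by rewrite leq_mul2r /c; apply/orP; right; lia.
- apply: leq_trans (axis1_translation n) _.
  apply: (@leq_trans (2 * (nu (axis2 ^+ n) + 2 * nu t0.2) + 2)).
    by rewrite leq_add2r leq_mul2l nu_t0 orbT.
  rewrite mulnDr -addnA; apply: leq_add; last by rewrite /c; lia.
  by rewrite leq_mul2r /c; apply/orP; right; lia.
have [b [k ->]] := spowE axis1 m; have [b' [k' ->]] := spowE axis2 n.
by apply: leq_trans (axes_independent b b' k k') _; rewrite leq_add2l /c; lia.
Qed.

End MarkerNorm.

(** * The free product as a group *)

Section FreeProduct.
Local Open Scope group_scope.
Variables (I : choiceType) (A : groupType).
Implicit Types (i j : I) (a b c : A) (u v w : seq (I * A)).

Definition freeprod : Type := {w : seq (I * A) | reduced w}.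

HB.instance Definition _ := Choice.on freeprod.

Implicit Types (x y z : freeprod).

Lemma fp_red x : reduced (val x).
Proof. exact: valP x. Qed.

Fact fp_mul_subproof x y : reduced (mulw (val x) (val y)).
Proof. exact/mulw_reduced/fp_red. Qed.

Definition fp_mul x y : freeprod := exist (fun w => reduced w) _ (fp_mul_subproof x y).
Definition fp_one : freeprod := exist (fun w => reduced w) [::] isT.

Fact fp_inv_subproof x : reduced (invw (val x)).
Proof. by rewrite reduced_invw; exact: fp_red. Qed.

Definition fp_inv x : freeprod := exist (fun w => reduced w) _ (fp_inv_subproof x).

Fact fp_mulA : associative fp_mul.
Proof. by move=> x y z; apply: val_inj; rewrite /= mulwA //; exact: fp_red. Qed.
Fact fp_mul1 : left_id fp_one fp_mul.
Proof. by move=> x; apply: val_inj. Qed.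
Fact fp_mulr1 : right_id fp_one fp_mul.
Proof. by move=> x; apply: val_inj; rewrite /= mulw0 //; exact: fp_red. Qed.
Fact fp_mulVg : left_inverse fp_one fp_inv fp_mul.
Proof. by move=> x; apply: val_inj; rewrite /= mulVw //; exact: fp_red. Qed.
Fact fp_mulgV : right_inverse fp_one fp_inv fp_mul.
Proof. by move=> x; apply: val_inj; rewrite /= mulwV //; exact: fp_red. Qed.

HB.instance Definition _ := isGroup.Build freeprod
  fp_mulA fp_mul1 fp_mulr1 fp_mulVg fp_mulgV.

Lemma val_fpM x y : val (x * y) = mulw (val x) (val y). Proof. by []. Qed.
Lemma val_fpV x : val x^-1 = invw (val x). Proof. by []. Qed.

Fact iota_subproof i a : reduced (push (i, a) [::]).
Proof. exact: push_reduced. Qed.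

(** The [i]-th copy of [A] in the free product. *)
Definition fpin i a : freeprod := exist (fun w => reduced w) _ (iota_subproof i a).

Lemma val_fpin i a : val (fpin i a) = if a == 1 then [::] else [:: (i, a)].
Proof. by []. Qed.

Lemma val_fpinM i a x : val (fpin i a * x) = push (i, a) (val x).
Proof.
rewrite val_fpM val_fpin; have [->|//] := eqVneq a 1.
by rewrite push1 //; exact: fp_red.
Qed.

Lemma fpinM i a b : fpin i (a * b) = fpin i a * fpin i b.
Proof. by apply: val_inj; rewrite val_fpinM; exact/esym/pushM. Qed.

Lemma fpin1 i : fpin i 1 = 1.
Proof. by apply: val_inj; rewrite val_fpin eqxx. Qed.

Lemma fpinV i a : fpin i a^-1 = (fpin i a)^-1.
Proof. by apply/esym/mulg1_eq; rewrite -fpinM mulgV fpin1. Qed.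

Lemma fpin_disjoint i j a b : i != j -> fpin i a = fpin j b -> a = 1.
Proof.
move=> ij /(congr1 val); rewrite !val_fpin; case: eqP => // _.
by case: eqP => // _ [E]; rewrite E eqxx in ij.
Qed.

Definition first i x := head_syl i (val x).

Lemma first_fpinM i a x : first i (fpin i a * x) = a * first i x.
Proof. by rewrite /first val_fpinM head_syl_push //; exact: fp_red. Qed.

Lemma first_fpin i j a : i != j -> first i (fpin j a) = 1.
Proof. by move=> ij; rewrite /first /=; case: eqP => //= _; rewrite eq_sym (negPf ij). Qed.

Let behead_syl i u : reduced u -> exists u', [/\ u = push (i, head_syl i u) u',
  reduced u' & forall c, c != 1 -> reduced ((i, c) :: u')].
Proof.
case: u => [_|[j a] u ru].
  exists [::]; split=> //=; first by rewrite eqxx.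
  by move=> c c1; rewrite reduced_cons /= c1.
rewrite [head_syl _ _]/=; have [ji|ji] := eqVneq j i.
  subst j; exists u; split; [by rewrite push_cons|exact: reduced_behead ru|].
  by move=> c c1; move: ru; rewrite !reduced_cons /= c1 => /and3P[_ -> ->].
exists ((j, a) :: u); split=> //; first by rewrite push1.
by move=> c c1; rewrite reduced_cons c1 eq_sym ji.
Qed.

(** In the Bass-Serre tree: two paths that leave the vertex [i] by different
    edges concatenate to a geodesic, which therefore leaves its initial vertex
    as its first half does. *)
Lemma first_div i j x y : i != j -> first i x <> first i y ->
  first j (x^-1 * y) = first j x^-1.
Proof.
move=> ij; rewrite /first val_fpM val_fpV => st.
have [u [Eu ru hu]] := behead_syl i (fp_red x).
have [v [Ev rv hv]] := behead_syl i (fp_red y).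
set s := head_syl i (val x) in st Eu; set t := head_syl i (val y) in st Ev.
have st1 : s^-1 * t != 1.
  by apply/eqP => /(congr1 (fun r : A => s * r)); rewrite mulVKg mulg1 => E; apply: st.
pose zu : freeprod := exist (fun w => reduced w) _ ru.
pose zv : freeprod := exist (fun w => reduced w) _ rv.
have xy : x^-1 * y = zu^-1 * (fpin i (s^-1 * t) * zv).
  have -> : x = fpin i s * zu by apply: val_inj; rewrite val_fpinM.
  have -> : y = fpin i t * zv by apply: val_inj; rewrite val_fpinM.
  by rewrite invgM fpinM fpinV !mulgA.
have rm : reduced (invw u ++ (i, s^-1 * t) :: v).
  rewrite reduced_cat_cons hv // andbT -reduced_invw -cats1 invw_cat invwK /=.
  by apply: hu; rewrite invg_eq1.
have Exy : val (x^-1 * y) = invw u ++ (i, s^-1 * t) :: v.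
  by rewrite xy val_fpM val_fpinM val_fpV [val zu]/= [val zv]/= push_cons ?hv // mulw_cat.
have Ex : val x^-1 = invw u ++ (if s == 1 then [::] else [:: (i, s^-1)]).
  have [s1|s1] := eqVneq s 1.
    by rewrite val_fpV Eu s1 push1 // cats0.
  by rewrite val_fpV Eu push_cons ?hu // invw_cons cats1.
rewrite -val_fpV -val_fpM Exy Ex; case: (invw u) => [|[k b] w] //=.
by rewrite (negPf ij); case: ifP; rewrite //= (negPf ij).
Qed.

(** The part of [y] outside the factor [i] survives in the normal form of the
    conjugate, on both sides of the conjugated syllable. *)
Lemma fpin_malnormal i a c y : a != 1 -> y * fpin i a * y^-1 = fpin i c ->
  exists d, y = fpin i d.
Proof.
move=> a1 E.
have [u [Eu ru hu]] := behead_syl i (fp_red y^-1).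
set s := head_syl i (val y^-1) in Eu; pose z : freeprod := exist (fun w => reduced w) _ ru.
have Ey : y = z^-1 * fpin i s^-1.
  apply: invg_inj; rewrite invgM invgK fpinV invgK.
  by apply: val_inj; rewrite val_fpinM.
have a1' : s^-1 * a * s != 1.
  by rewrite -{2}[s]invgK conj_eq1.
have E' : z^-1 * (fpin i (s^-1 * a * s) * z) = fpin i c.
  by rewrite -E Ey invgM invgK !fpinM !fpinV invgK !mulgA.
have r1 : reduced ((i, s^-1 * a * s) :: u) by exact: hu.
have := congr1 (fun x => size (val x)) E'.
rewrite val_fpM val_fpinM val_fpV [val z]/= push_cons // mulw_cat; last first.
  rewrite reduced_cat_cons r1 andbT -reduced_invw -cats1 invw_cat invwK /=.
  by apply: hu; rewrite invg_eq1.
rewrite size_cat size_invw val_fpin /= addnS => sz.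
exists s^-1; rewrite Ey; suff -> : z = 1 by rewrite invg1 mul1g.
apply: val_inj; rewrite /=; apply: size0nil.
by move: sz; case: ifP => _ /=; lia.
Qed.

End FreeProduct.

(** * Generated subgroups and automorphisms *)

Section GeneratedSubgroup.
Local Open Scope group_scope.
Variables (G : groupType) (S : set G).
Local Notation sg := (subgroup_generated S).

Lemma sg_gen x : S x -> sg x.
Proof. by move=> Sx H [_ SH]; exact: SH. Qed.

Lemma sg1 : sg 1.
Proof. by have [h _] := subgroup_generated_closed S; exact: set_mem h. Qed.

Lemma sgF x y : sg x -> sg y -> sg (x / y).
Proof.
move=> Sx Sy; have [_ h] := subgroup_generated_closed S.
by apply: set_mem; apply: (h x y); apply: mem_set.
Qed.

Lemma sgV x : sg x -> sg x^-1.
Proof. by move=> Sx; rewrite -div1g; apply: sgF => //; exact: sg1. Qed.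

Lemma sgM x y : sg x -> sg y -> sg (x * y).
Proof. by move=> Sx Sy; rewrite -[y]invgK; apply: sgF => //; exact: sgV. Qed.

Lemma sg_ind (H : G -> Prop) : H 1 -> (forall x y, H x -> H y -> H (x * y)) ->
  (forall x, H x -> H x^-1) -> (forall x, S x -> H x) -> forall x, sg x -> H x.
Proof.
move=> H1 HM HV HS x Sx; apply: (Sx (fun y => H y)); split; last exact: HS.
split; first exact/mem_set.
by move=> y z /set_mem Hy /set_mem Hz; apply/mem_set/HM => //; exact: HV.
Qed.

Lemma sg_lift x : sg x -> exists g : generated_group S, val g = x.
Proof. by move=> Sx; exists (exist _ x (mem_set Sx)). Qed.

Lemma sg_val (g : generated_group S) : sg (val g).
Proof. by apply: set_mem; exact: (valP g). Qed.

Lemma sg_valM (g h : generated_group S) : val (g * h) = val g * val h.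
Proof. exact: valM. Qed.

Lemma sg_val1 : val (1 : generated_group S) = 1.
Proof. exact: val1. Qed.

Lemma sg_valV (g : generated_group S) : val g^-1 = (val g)^-1.
Proof. by apply/esym/mulg1_eq; rewrite -sg_valM mulgV sg_val1. Qed.

End GeneratedSubgroup.

Lemma sg_commute (G : groupType) (S T : set G) :
  (forall x y, S x -> T y -> commute x y) ->
  forall x y, subgroup_generated S x -> subgroup_generated T y -> commute x y.
Proof.
move=> ST x y Sx; move: y; apply: sg_ind.
- exact: commute1.
- by move=> y z; exact: commuteM.
- by move=> y; exact: commuteV.
move=> y Ty; apply: commute_sym; move: x Sx; apply: sg_ind.
- exact: commute1.
- by move=> x z; exact: commuteM.
- by move=> x; exact: commuteV.
by move=> x Sx; apply: commute_sym; exact: ST.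
Qed.

Section Morphisms.
Local Open Scope group_scope.
Variables (G H : groupType) (f : G -> H).
Hypothesis fM : {morph f : x y / x * y}.

Lemma morph1 : f 1 = 1.
Proof. by apply: (@mulgI _ (f 1)); rewrite -fM !mulg1. Qed.

Lemma morphV x : f x^-1 = (f x)^-1.
Proof. by apply/esym/mulg1_eq; rewrite -fM mulgV morph1. Qed.

Lemma morphX n x : f (x ^+ n) = f x ^+ n.
Proof. by elim: n => [|n IH]; rewrite ?expg0 ?morph1 // !expgS fM IH. Qed.

End Morphisms.

Section Outer.
Local Open Scope group_scope.
Variable G : groupType.
Implicit Types f g : aut G.

Lemma autV f x : f x^-1 = (f x)^-1. Proof. exact: morphV (@autM _ f) x. Qed.
Lemma aut_unit f : f 1 = 1. Proof. exact: morph1 (@autM _ f). Qed.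

Lemma outM : {morph @out_class G : f g / f * g}.
Proof. by move=> f g; rewrite [RHS]out_classM. Qed.

Lemma out1 : out_class (1 : aut G) = 1. Proof. by []. Qed.

Lemma outV f : out_class f^-1 = (out_class f)^-1.
Proof. exact: morphV outM f. Qed.

Lemma out_eq1 f : out_class f = 1 -> exists a, forall x, f x = a * x * a^-1.
Proof.
rewrite -out1 => /out_classP[a ->]; exists a => x.
by rewrite mulg1 /= conjgE invgK mulgA.
Qed.

End Outer.

(** * Homomorphisms from a right-angled Artin group *)

Section RaagHom.
Local Open Scope group_scope.
Variable Gamma : sgraph.
Local Notation A := (raag Gamma).
Local Notation gen := (@raag_gen Gamma).

Section Lift.
Variables (H : groupType) (f : Gamma -> H).
Hypothesis f_comm : forall u v, adj u v -> commute (f u) (f v).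

Let f_rel r : @raag_relators Gamma r -> word_eval f r = 1.
Proof.
case=> u [v [uv ->]]; rewrite /word_eval !big_cons big_nil /= mulg1.
by rewrite mulgA f_comm // !mulgA mulgK mulgV.
Qed.

Definition raag_hom : A -> H := pres_lift f.

Lemma raag_homM : {morph raag_hom : x y / x * y}.
Proof. exact: pres_liftM f_rel. Qed.

Lemma raag_hom_gen u : raag_hom (gen u) = f u.
Proof. exact: pres_lift_gen f_rel u. Qed.

End Lift.

Lemma raag_aut_ext (f g : aut A) : (forall u, f (gen u) = g (gen u)) -> f = g.
Proof. by move=> E; apply: aut_ext; apply: pres_hom_ext E; exact: autM. Qed.

End RaagHom.

(** The additive group of the integers written multiplicatively: a target in which
    vertices have infinite order. *)
Definition zgroup : Type := int.

Section ZGroup.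
Import GRing.Theory.
Local Open Scope ring_scope.
HB.instance Definition _ := Choice.on zgroup.
HB.instance Definition _ := isGroup.Build zgroup
  (@addrA int) (@add0r int) (@addr0 int) (@addNr int) (@addrN int).

Lemma zgroup_exp n : (((1 : int) : zgroup) ^+ n)%g = n%:Z :> int.
Proof.
by elim: n => // n IH; rewrite expgS; rewrite -add1n PoszD -IH.
Qed.
End ZGroup.

(** * Components of a graph *)

Section Components.
Variable Gamma : sgraph.
Implicit Types (u v x y : Gamma) (S T C D : {set Gamma}).

Lemma adj_minus_sym S : symmetric (@adj_minus Gamma S).
Proof. by move=> u v; rewrite /adj_minus /= adj_sym [(u \notin S) && _]andbC. Qed.

Lemma connect_minus_sym S u v :
  connect (adj_minus S) u v = connect (adj_minus S) v u.
Proof. by apply: sym_connect_sym; exact: adj_minus_sym. Qed.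

Lemma component_refl S v : v \in component S v.
Proof. by rewrite inE connect0. Qed.

Lemma component_components S v : v \notin S -> component S v \in components S.
Proof. by move=> vS; apply/imsetP; exists v; rewrite ?inE. Qed.

Lemma componentE S C u : C \in components S -> u \in C -> C = component S u.
Proof.
case/imsetP=> x _ -> {C}; rewrite inE => xu; apply/setP => y; rewrite !inE.
by apply/idP/idP; apply: connect_trans => //; rewrite connect_minus_sym.
Qed.

Lemma components_meet S C D u : C \in components S -> D \in components S ->
  u \in C -> u \in D -> C = D.
Proof. by move=> hC hD uC uD; rewrite (componentE hC uC) (componentE hD uD). Qed.

Lemma components_neq0 S C : C \in components S -> exists u, u \in C.
Proof. by case/imsetP=> x _ ->; exists x; exact: component_refl. Qed.

Lemma connect_in (e e' : rel Gamma) x y : connect e x y ->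
  (forall a b, connect e x a -> e a b -> e' a b) -> connect e' x y.
Proof.
move=> /connectP[p + ->] h; elim/last_ind: p => [//|p z IH].
rewrite rcons_path last_rcons => /andP[xp pz].
apply: connect_trans (IH xp) (connect1 _); apply: h => //.
by apply/connectP; exists p.
Qed.

Lemma component_sub S T C D u : S \subset T -> C \in components S ->
  D \in components T -> u \in C -> u \in D -> D \subset C.
Proof.
move=> ST hC hD uC uD; rewrite (componentE hC uC) (componentE hD uD).
apply/fintype.subsetP => y; rewrite !inE => /connect_in; apply=> a b _.
rewrite /adj_minus /= => /and3P[-> aT bT].
by rewrite (contra (fintype.subsetP ST a)) ?(contra (fintype.subsetP ST b)).
Qed.

Lemma component_avoid S T C x y : C \in components S -> [disjoint C & T] ->
  x \in C -> y \in C -> connect (adj_minus T) x y.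
Proof.
move=> hC CT xC; rewrite {1}(componentE hC xC) inE => /connect_in; apply=> a b xa ab.
have aC : a \in C by rewrite (componentE hC xC) inE.
have bC : b \in C.
  by rewrite (componentE hC xC) inE; apply: connect_trans xa (connect1 ab).
by move: ab; rewrite /adj_minus /= => /and3P[-> _ _]; rewrite !(disjointFr CT).
Qed.

End Components.

(** * Partial conjugations *)

Section PartialConjugations.
Local Open Scope group_scope.
Variable Gamma : sgraph.
Local Notation A := (raag Gamma).
Local Notation gen := (@raag_gen Gamma).
Local Notation pc := (@partial_conj Gamma).
Local Notation opc := (@out_partial_conj Gamma).
Implicit Types (u v x y : Gamma) (C D E : {set Gamma}) (f g : aut A) (a b : A).

Definition conj_on f b C := forall x,
  f (gen x) = if x \in C then b * gen x * b^-1 else gen x.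

Lemma pc_conj_on v C : C \in components (st v) -> conj_on (pc v C) (gen v) C.
Proof. by move=> hC x; exact: partial_conjE. Qed.

Lemma aut_mulE f g a : (f * g : aut A) a = f (g a). Proof. by []. Qed.

Lemma st_notin v C x : C \in components (st v) -> x \in st v -> x \notin C.
Proof. by move=> hC xv; apply/negP => /(component_notin hC); rewrite xv. Qed.

Lemma pc_center v C : C \in components (st v) -> v \notin C.
Proof. by move=> hC; apply: st_notin hC _; rewrite !inE eqxx. Qed.

Lemma pc_link v C x : C \in components (st v) -> adj v x -> x \notin C.
Proof. by move=> hC vx; apply: st_notin hC _; rewrite !inE vx orbT. Qed.

Lemma conj_on_notin f b C x : conj_on f b C -> x \notin C -> f (gen x) = gen x.
Proof. by move=> h /negPf xC; rewrite h xC. Qed.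

(** On the intersection of the two supports the images are conjugates by products of
    [v] and [w] in either order. *)
Lemma conj_on_commute f g v w C D : conj_on f (gen v) C -> conj_on g (gen w) D ->
  f (gen w) = gen w -> g (gen v) = gen v ->
  (forall x, x \in C -> x \in D -> commute (gen v) (gen w)) ->
  commute f g.
Proof.
move=> hf hg fw gv vw; apply: raag_aut_ext => x.
change (f (g (gen x)) = g (f (gen x))); rewrite hf hg.
have [xC|xC] := boolP (x \in C); have [xD|xD] := boolP (x \in D).
- rewrite !autM !autV fw gv hf hg xC xD; have c := vw x xC xD.
  by rewrite !mulgA -c -!mulgA -!invgM c.
- by rewrite !autM !autV gv hf hg xC (negPf xD).
- by rewrite !autM !autV fw hf hg xD (negPf xC).
- by rewrite hf hg (negPf xC) (negPf xD).
Qed.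

Lemma pc_commute_adj u v C D : adj u v -> C \in components (st u) ->
  D \in components (st v) -> commute (pc u C) (pc v D).
Proof.
move=> uv hC hD; apply: conj_on_commute (pc_conj_on hC) (pc_conj_on hD) _ _ _.
- by apply: conj_on_notin (pc_conj_on hC) _; exact: pc_link uv.
- by apply: conj_on_notin (pc_conj_on hD) _; apply: pc_link hD _; rewrite adj_sym.
- by move=> *; exact: raag_gen_comm.
Qed.

Lemma opcE v C : opc v C = out_class (pc v C). Proof. by []. Qed.

Lemma conj_onX f b C n : conj_on f b C -> f b = b -> conj_on (f ^+ n) (b ^+ n) C.
Proof.
move=> hf fb x; elim: n => [|n IH].
  by rewrite !expg0 invg1 mulg1 mul1g; case: ifP.
rewrite (expgS f) (expgSr b) -[(f * _) _]/(f ((f ^+ n) (gen x))) IH.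
case: ifP => xC; last by rewrite hf xC.
by rewrite !autM autV hf xC !(morphX (@autM _ f)) fb invgM !mulgA.
Qed.

(** A vertex [y] outside the support and the star makes every power of [P_v^C]
    nontrivial: after all other vertices are killed, an inner representative
    would be conjugation by an element of [<v>] that also centralizes [y]. *)
Lemma opc_infinite_order v C y n : C \in components (st v) -> y \notin C ->
  y \notin st v -> (0 < n)%N -> opc v C ^+ n <> 1.
Proof.
move=> hC yC yv n0; rewrite opcE -(morphX (@outM _)) => /out_eq1[a Ha].
have [x xC] := components_neq0 hC.
have xv := component_notin hC xC.
have vC := pc_center hC.
have neq : [/\ x != v, y != v & x != y].
  split; [by apply: contraNneq vC => <-| |by apply: contraNneq yC => <-].
  by apply: contraNneq yv => ->; rewrite !inE eqxx.
case: neq => xv' yv' xy.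
pose one : zgroup := (1%Z : int).
pose f u : freeprod Gamma zgroup := if u \in [:: v; x; y] then fpin u one else 1.
have f_comm u w : adj u w -> commute (f u) (f w).
  move=> uw; have [->|uw'] := eqVneq u w; first exact: commute_refl.
  rewrite /f; case: ifP => hu; last exact/commute_sym/commute1.
  case: ifP => hw; last exact: commute1.
  exfalso; move: hu hw uw uw'; rewrite !inE => /or3P[] /eqP-> /or3P[] /eqP->;
    rewrite ?eqxx // => uw _.
  - by move: xv; rewrite !inE uw orbT.
  - by move: yv; rewrite !inE uw orbT.
  - by move: xv; rewrite !inE adj_sym uw orbT.
  - by have := component_step hC xC uw; rewrite (negPf yC) (negPf yv).
  - by move: yv; rewrite !inE adj_sym uw orbT.
  - by have := component_step hC xC (etrans (adj_sym _ _) uw);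
      rewrite (negPf yC) (negPf yv).
pose F := raag_hom f; have FM : {morph F : r s / r * s} := raag_homM f_comm.
have Fg u : F (gen u) = f u := raag_hom_gen f_comm u.
have fv : f v = fpin v one by rewrite /f !inE eqxx.
have fx : f x = fpin x one by rewrite /f !inE eqxx orbT.
have fy : f y = fpin y one by rewrite /f !inE eqxx !orbT.
have hn := conj_onX n (pc_conj_on hC) (conj_on_notin (pc_conj_on hC) vC).
have one1 : one != 1 by [].
have fix_ z : z \notin C -> f z = fpin z one -> exists d, F a = fpin z d.
  move=> zC fz; apply: (@fpin_malnormal _ _ _ one one) => //.
  by rewrite -fz -Fg -(morphV FM) -!FM -Ha (conj_on_notin hn zC).
have [d Ed] := fix_ v vC fv; have [d' Ed'] := fix_ y yC fy.
have d1 : d = 1.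
  by apply: (@fpin_disjoint _ _ v y d d'); rewrite -?Ed // eq_sym.
have Fa : F a = 1 by rewrite Ed d1 fpin1.
have := congr1 F (Ha (gen x)); rewrite hn xC !FM !(morphV FM) Fa mul1g invg1 mulg1.
rewrite (morphX FM) !Fg fv fx => E.
have [d2 Ed2] : exists d2, fpin v one ^+ n = fpin x d2.
  by apply: (fpin_malnormal one1 E).
have : one ^+ n = 1.
  apply: (@fpin_disjoint _ _ v x _ d2); first by rewrite eq_sym.
  by rewrite -Ed2 -(morphX (@fpinM _ _ v)).
by rewrite /one zgroup_exp => -[] n0'; rewrite n0' in n0.
Qed.

Lemma opc_trivial v C : C \in components (st v) ->
  (forall u, u \notin st v -> u \in C) -> opc v C = 1.
Proof.
move=> hC all_in; rewrite opcE -out1; apply/out_classP; exists (gen v).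
rewrite mulg1; apply: raag_aut_ext => x.
rewrite (pc_conj_on hC) [RHS]/= conjgE invgK mulgA.
case: ifP => // xC; have : x \in st v by apply: contraFT xC => /all_in.
rewrite !inE => xv; suff -> : gen v * gen x = gen x * gen v by rewrite mulgK.
by case/orP: xv => [/eqP->//|/raag_gen_comm].
Qed.

Lemma in_bigcup_list (s : seq {set Gamma}) x :
  (x \in \bigcup_(D <- s) D) = has (fun D => x \in D) s.
Proof. by elim: s => [|D s IH]; rewrite ?big_nil ?big_cons inE ?IH. Qed.

(** The product over all components of [Gamma - st v] is conjugation by [v], so
    each factor is a product of the others and their inverses. *)
Lemma opc_prod_components (M : Out A -> Prop) v D0 : M 1 ->
  (forall p q : Out A, M p -> M q -> M (p * q)) ->
  (forall p : Out A, M p -> M p^-1) ->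
  D0 \in components (st v) ->
  (forall D, D \in components (st v) -> D != D0 -> M (opc v D)) -> M (opc v D0).
Proof.
move=> M1 MM MV hD0 HD.
have prodE (s : seq {set Gamma}) : uniq s -> all (mem (components (st v))) s ->
    conj_on (\prod_(D <- s) pc v D) (gen v) (\bigcup_(D <- s) D).
  elim: s => [|D s IH] /=; first by move=> _ _ x; rewrite !big_nil inE.
  case/andP=> Ds us /andP[hD hs] x; rewrite !big_cons inE.
  rewrite aut_mulE (IH us hs).
  have vD := conj_on_notin (pc_conj_on hD) (pc_center hD).
  case: ifP => xs; last by rewrite (pc_conj_on hD) orbF.
  have xD : x \notin D.
    apply/negP => xD; move: xs; rewrite in_bigcup_list => /hasP[E Es xE].
    have hE : E \in components (st v) by exact: (allP hs).
    by rewrite (components_meet hD hE xD xE) Es in Ds.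
  by rewrite orbT !autM autV vD (conj_on_notin (pc_conj_on hD) xD).
pose s := enum (components (st v)).
have us : uniq s := enum_uniq _.
have hs : all (mem (components (st v))) s.
  by apply/allP => D; rewrite mem_enum.
have : \prod_(D <- s) opc v D = 1.
  have -> : \prod_(D <- s) opc v D = out_class (\prod_(D <- s) pc v D).
    elim: (s) => [|D r IH]; first by rewrite !big_nil.
    by rewrite !big_cons IH outM.
  rewrite -out1; apply/out_classP; exists (gen v); rewrite mulg1.
  apply: raag_aut_ext => x; rewrite (prodE s us hs) [RHS]/= conjgE invgK mulgA.
  case: ifP => // xs; suff : x \in st v.
    rewrite !inE => xv; suff -> : gen v * gen x = gen x * gen v by rewrite mulgK.
    by case/orP: xv => [/eqP->//|/raag_gen_comm].
  apply: contraFT xs => xv; rewrite in_bigcup_list; apply/hasP.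
  exists (component (st v) x); last exact: component_refl.
  by rewrite mem_enum component_components.
have : D0 \in s by rewrite mem_enum.
move: us hs => + + Ds; case/splitPr: Ds => s1 s2.
rewrite cat_uniq /= all_cat /= => /and3P[_ /norP[D01 _] /andP[D02 _]] /and3P[h1 _ h2].
rewrite big_cat big_cons /=.
have Mprod r : all (mem (components (st v))) r -> D0 \notin r ->
    M (\prod_(D <- r) opc v D).
  elim: r => [|D r IH] /=; first by rewrite big_nil.
  case/andP=> hD hr; rewrite inE => /norP[DD0 D0r]; rewrite big_cons.
  by apply: MM; [apply: HD => //; rewrite eq_sym|exact: IH].
move: (Mprod s1 h1 D01) (Mprod s2 h2 D02).
move: (\prod_(D <- s1) opc v D) (\prod_(D <- s2) opc v D) => p q Mp Mq E.
have -> : opc v D0 = p^-1 * (p * (opc v D0 * q)) * q^-1 by rewrite mulKg mulgK.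
by rewrite E mulg1; apply: MM; exact: MV.
Qed.

End PartialConjugations.

(** * The shared components of the system *)

Section System.
Local Open Scope group_scope.
Variables (Gamma : sgraph) (w1 w2 w3 : Gamma).
Local Notation A := (raag Gamma).
Local Notation gen := (@raag_gen Gamma).
Local Notation pc := (@partial_conj Gamma).
Local Notation opc := (@out_partial_conj Gamma).
Local Notation W := [set w1; w2; w3]%SET.
Local Notation L := (common_link W).
Local Notation C := (shared_component W).
Implicit Types (u v w x l : Gamma) (D E : {set Gamma}) (f g : aut A) (a b : A).

Hypothesis w_distinct : uniq [:: w1; w2; w3].
Hypothesis W_system : maximal_SIL_system W.
Hypothesis W_no_add : no_additional_components W.
Hypothesis cond1 : forall w v, w \in W -> v \in shared_component W w ->
       connected_minus (st v) \/
       (defines_only_subordinate W v /\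
        forall C, subordinate W v C ->
          exists2 u, u \in C & defines_subordinate W u).

Lemma W_cases w : w \in W -> [\/ w = w1, w = w2 | w = w3].
Proof.
by rewrite !inE -orbA => /or3P[] /eqP->; [constructor 1|constructor 2|constructor 3].
Qed.

Lemma w_neq : [/\ w1 != w2, w1 != w3 & w2 != w3].
Proof.
by move: w_distinct; rewrite /= !inE negb_or andbT => /andP[/andP[-> ->] ->].
Qed.

Lemma w1W : w1 \in W. Proof. by rewrite !inE eqxx. Qed.
Lemma w2W : w2 \in W. Proof. by rewrite !inE eqxx orbT. Qed.
Lemma w3W : w3 \in W. Proof. by rewrite !inE eqxx !orbT. Qed.

Lemma two_others w : w \in W -> exists w' w'',
  [/\ w' \in W, w'' \in W, w' != w, w'' != w & w' != w''].
Proof.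
have [h12 h13 h23] := w_neq; have h1 := w1W; have h2 := w2W; have h3 := w3W.
case/W_cases=> ->.
- by exists w2, w3; split; rewrite // eq_sym.
- by exists w1, w3; split; rewrite // eq_sym.
- by exists w1, w2.
Qed.

Lemma L_link w : w \in W -> L \subset lk w.
Proof. by move=> wW; apply/fintype.subsetP => l /finset.bigcapP; apply. Qed.

Lemma L_adj w l : w \in W -> l \in L -> adj w l.
Proof. by move=> wW /(fintype.subsetP (L_link wW)); rewrite inE. Qed.

Lemma W_notin_L w : w \in W -> w \notin L.
Proof. by move=> wW; apply/negP => /(L_adj wW); rewrite adj_irrefl. Qed.

Lemma C_refl w : w \in C w. Proof. exact: component_refl. Qed.

Lemma C_comp w : w \in W -> C w \in components L.
Proof. by move=> wW; apply: component_components; exact: W_notin_L. Qed.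

Lemma C_meet w w' x : w \in W -> w' \in W -> x \in C w -> x \in C w' -> w = w'.
Proof.
move=> wW wW' xw xw'; apply/eqP; apply: contraT => ww'.
have E := components_meet (C_comp wW) (C_comp wW') xw xw'.
case: W_system => _ _ _ /(_ w w' wW wW') + _; rewrite eq_sym ww' => /(_ isT).
by rewrite E C_refl.
Qed.

Lemma C_cover x : x \notin L -> exists2 w, w \in W & x \in C w.
Proof.
move=> xL; have [w wW wx] := W_no_add (component_components xL).
by exists w => //; move: wx; rewrite !inE connect_minus_sym.
Qed.

Lemma C_notin_L w x : w \in W -> x \in C w -> x \notin L.
Proof. by move=> wW; exact: component_notin (C_comp wW). Qed.

Lemma C_step w v x : w \in W -> v \in C w -> adj v x -> (x \in C w) || (x \in L).
Proof. by move=> wW; exact: component_step (C_comp wW). Qed.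

Lemma C_adj w w' v x : w \in W -> w' \in W -> v \in C w -> x \in C w' ->
  adj v x -> w = w'.
Proof.
move=> wW wW' vw xw' /(C_step wW vw) /orP[xw|xL]; first exact: C_meet xw xw'.
by have := C_notin_L wW' xw'; rewrite xL.
Qed.

Lemma C_disjoint_st w w' v : w \in W -> w' \in W -> w' != w -> v \in C w ->
  [disjoint C w' & st v].
Proof.
move=> wW wW' ww' vw; rewrite disjoint_subset; apply/fintype.subsetP => x xw'.
rewrite !inE; apply/norP; split.
  by apply: contra ww' => /eqP E; rewrite (C_meet wW wW' vw) // -E.
by apply: contra ww' => /(C_adj wW wW' vw xw') ->.
Qed.

(** The vertices of [C w] that can define nontrivial partial conjugations, as
    [notU_trivial] will show. *)
Definition U w : {set Gamma} := [set v in C w | L \subset lk v].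

Lemma UP w v : reflect (v \in C w /\ L \subset lk v) (v \in U w).
Proof. by rewrite /U finset.in_set; exact: andP. Qed.

Lemma U_C w v : v \in U w -> v \in C w. Proof. by case/UP. Qed.

Lemma W_U w : w \in W -> w \in U w.
Proof. by move=> wW; apply/UP; split; [exact: C_refl|exact: L_link]. Qed.

Lemma U_st w v : v \in U w -> L \subset st v.
Proof. by case/UP=> _ /fintype.subset_trans; apply; apply: finset.subsetUr. Qed.

(** [C w'] is connected and misses [st v], and it cannot grow because [st v] contains
    [L]. *)
Lemma U_comp w w' v : w \in W -> w' \in W -> w' != w -> v \in U w ->
  C w' \in components (st v).
Proof.
move=> wW wW' ww' vU; have dj := C_disjoint_st wW wW' ww' (U_C vU).
have w'v : w' \notin st v by rewrite (disjointFr dj) // C_refl.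
suff -> : C w' = component (st v) w' by exact: component_components.
apply/eqP; rewrite finset.eqEsubset; apply/andP; split; last first.
  apply: (component_sub (U_st vU) (C_comp wW') (component_components w'v) (C_refl _)).
  exact: component_refl.
apply/fintype.subsetP => x xw'; rewrite inE.
exact: component_avoid (C_comp wW') dj (C_refl _) xw'.
Qed.

Lemma U_cases w v D : w \in W -> v \in U w -> D \in components (st v) ->
  (exists w', [/\ w' \in W, w' != w & D = C w']) \/ D \subset C w.
Proof.
move=> wW vU hD; have [x xD] := components_neq0 hD.
have xL : x \notin L.
  by apply: contra (component_notin hD xD); exact: fintype.subsetP (U_st vU) x.
have [w' wW' xw'] := C_cover xL; have [E|ww'] := eqVneq w' w.
  right; rewrite -E; exact: component_sub (U_st vU) (C_comp wW') hD xw' xD.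
left; exists w'; split=> //.
exact: components_meet hD (U_comp wW wW' ww' vU) xD xw'.
Qed.

Lemma sub_C_notin w w' v D : w \in W -> w' \in W -> w' != w -> v \in C w ->
  D \subset C w -> (w' \notin D) /\ (w' \notin st v).
Proof.
move=> wW wW' ww' vw Dw; split.
  apply: contra ww' => /(fintype.subsetP Dw) h.
  by rewrite (C_meet wW wW' h (C_refl _)).
by rewrite (disjointFr (C_disjoint_st wW wW' ww' vw)) // C_refl.
Qed.

Lemma opc_nontrivial v D y : D \in components (st v) -> y \notin D ->
  y \notin st v -> opc v D <> 1.
Proof.
move=> hD yD yv; have := opc_infinite_order hD yD yv (ltn0Sn 0).
by rewrite expg1.
Qed.

(** If [L] is not contained in [lk v], a vertex [l] of [L] outside [lk v]
    connects all that is not in [C w], so every component without [l] has a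
    partial conjugation of type (5). *)
Lemma notU_trivial w v D : w \in W -> v \in C w -> ~~ (L \subset lk v) ->
  D \in components (st v) -> opc v D = 1.
Proof.
move=> wW vw notL hD; case: (cond1 wW vw) => [conn|[only _]].
  apply: opc_trivial => // u uv; have [x xD] := components_neq0 hD.
  rewrite (componentE hD xD) inE; apply: conn => //; exact: component_notin xD.
have [l lL lv] := fintype.subsetPn notL.
have lst : l \notin st v.
  rewrite !inE negb_or; apply/andP; split; last by rewrite inE in lv.
  by apply: contraNneq (C_notin_L wW vw) => <-.
have reach w' E : w' \in W -> w' != w -> E \in components (st v) -> w' \in E -> l \in E.
  move=> wW' ww' hE wE; have := component_step hE wE (L_adj wW' lL).
  by rewrite (negPf lst) orbF.
have far E : E \in components (st v) -> l \notin E -> E \subset C w.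
  move=> hE lE; apply/fintype.subsetP => x xE; apply: contraT => xw.
  have xv := component_notin hE xE.
  have [w' [_ [wW' _ ww' _ _]]] := two_others wW.
  case: (boolP (x \in L)) => xL.
    have w'v : w' \notin st v.
      by rewrite (disjointFr (C_disjoint_st wW wW' ww' vw)) // C_refl.
    have := component_step hE xE (etrans (adj_sym _ _) (L_adj wW' xL)).
    rewrite (negPf w'v) orbF => wE; by rewrite (reach w' E) in lE.
  have [w0 wW0 xw0] := C_cover xL.
  have ww0 : w0 != w by apply: contraNneq xw => <-.
  suff wE : w0 \in E by rewrite (reach w0 E) in lE.
  rewrite (componentE hE xE) inE.
  exact: component_avoid (C_comp wW0) (C_disjoint_st wW wW0 ww0 vw) xw0 (C_refl _).
have no5 E y : E \in components (st v) -> l \notin E -> y \notin E -> y \notin st v -> False.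
  move=> hE lE yE yv; apply: only; exists E; split; last exact: opc_nontrivial yE yv.
  by right; exists w; split=> //; exact: far.
apply: contrapT => nt; apply: nt; apply: opc_trivial => // y yv.
apply: contraT => yD; exfalso; case: (boolP (l \in D)) => lD; last exact: no5 yD yv.
have hE := component_components yv; have yE := component_refl (st v) y.
apply: (no5 _ l hE) => //; apply: contra yD => lE.
  by rewrite (components_meet hD hE lD lE).
by rewrite (components_meet hD hE lD lE).
Qed.

(** The first alternative of the hypothesis on [v] is excluded, since the two other
    shared components are separated by [st v]; the second one excludes type (4). *)
Lemma U_sub w v D : w \in W -> v \in U w -> D \in components (st v) ->
  D \subset C w -> subordinate W v D.
Proof.
move=> wW vU hD Dw; have /UP[vw Lv] := vU.
have [w' [w'' [wW' wW'' ww' ww'' w'w'']]] := two_others wW.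
case: (cond1 wW vw) => [conn|[only _]].
  have w'v : w' \notin st v.
    by rewrite (disjointFr (C_disjoint_st wW wW' ww' vw)) // C_refl.
  have w''v : w'' \notin st v.
    by rewrite (disjointFr (C_disjoint_st wW wW'' ww'' vw)) // C_refl.
  have E : C w' = component (st v) w'.
    by apply: componentE (C_refl _); exact: U_comp vU.
  have : w'' \in C w' by rewrite E inE; exact: conn.
  by move/(C_meet wW' wW'')/(_ (C_refl _)) => h; rewrite h eqxx in w'w''.
exists w; split=> //; split=> //; apply: contrapT => no; apply: only; exists D.
split; first by left; exists w.
have [h1 h2] := sub_C_notin wW wW' ww' vw Dw.
exact: opc_nontrivial h1 h2.
Qed.

Lemma subP v D : subordinate W v D ->
  exists w, [/\ w \in W, v \in U w, D \in components (st v) & D \subset C w].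
Proof. by case=> w [wW vw hD Lv [Dw _]]; exists w; split=> //; apply/UP. Qed.

(** * The factors of the free product and the complement *)

(** The shared component that the vertices of [U w] conjugate in the generators of
    [H_3]. *)
Definition partner w := if w == w3 then w2 else w3.

Lemma partner_W w : partner w \in W.
Proof. by rewrite /partner; case: ifP => _; [exact: w2W|exact: w3W]. Qed.

Lemma partner_neq w : partner w != w.
Proof.
have [_ _ h23] := w_neq; rewrite /partner.
by have [->|] := eqVneq w w3; rewrite // eq_sym.
Qed.

(** The subgroups [P w1], [P w2] and [P w3] generate [H_3]; it will be their free
    product. *)
Definition Pgen w : set (Out A) :=
  [set p | w \in W /\ exists2 v, v \in U w & p = opc v (C (partner w))].

Definition P w : set (Out A) := subgroup_generated (Pgen w).
Definition Ks : set (Out A) := subgroup_generated (K_generators W).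
Definition SU w : set A := subgroup_generated [set gen v | v in [set v | v \in U w]]%classic.

Lemma P_W w p : P w p -> p <> 1 -> w \in W.
Proof.
move=> Pp; apply: contra_notT => wW; move: p Pp; apply: sg_ind; first by [].
- by move=> p q -> ->; rewrite mulg1.
- by move=> p ->; rewrite invg1.
by move=> p [h _]; move: wW; rewrite h.
Qed.

Lemma SU_gen w u : u \in U w -> SU w (gen u).
Proof. by move=> uw; apply: sg_gen; exists u. Qed.

Lemma SU_ind w (H : A -> Prop) : H 1 -> (forall a b, H a -> H b -> H (a * b)) ->
  (forall a, H a -> H a^-1) -> (forall u, u \in U w -> H (gen u)) ->
  forall a, SU w a -> H a.
Proof. by move=> H1 HM HV Hg; apply: sg_ind => // _ [u uw <-]; exact: Hg. Qed.

Lemma conj_on_SU f b w a : w \in W -> conj_on f b (C (partner w)) -> SU w a -> f a = a.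
Proof.
move=> wW hf; move: a; apply: SU_ind; first exact: aut_unit.
- by move=> a c fa fc; rewrite autM fa fc.
- by move=> a fa; rewrite autV fa.
move=> u /U_C uw; apply: conj_on_notin hf _; apply: contra (partner_neq w) => ut.
by rewrite (C_meet (partner_W w) wW ut uw).
Qed.

Lemma conj_onV f b D : conj_on f b D -> f b = b -> conj_on f^-1 b^-1 D.
Proof.
move=> hf fb x; apply: (can_inj (@aut_funK _ f)); rewrite [LHS](@aut_ifunK _ f).
case: ifP => xD; last by rewrite hf xD.
by rewrite invgK !autM autV fb hf xD !mulgA mulVg mul1g mulgVK.
Qed.

Lemma P_spec w p : w \in W -> P w p -> exists f b,
  [/\ p = out_class f, conj_on f b (C (partner w)) & SU w b].
Proof.
move=> wW; move: p; apply: sg_ind.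
- exists 1, 1; split; [by []| |exact: sg1].
  by move=> x; rewrite mul1g invg1 mulg1; case: ifP.
- move=> _ _ [f [b [-> hf Sb]]] [g [c [-> hg Sc]]]; exists (f * g), (c * b).
  split; [by rewrite outM| |exact: sgM].
  move=> x; rewrite aut_mulE hg; have hx := hf x; case: ifP hx => xD hx //.
  by rewrite !autM autV hx (conj_on_SU wW hf Sc) invgM !mulgA.
- move=> _ [f [b [-> hf Sb]]]; exists f^-1, b^-1.
  split; [by rewrite outV| |exact: sgV].
  by apply: (conj_onV hf); exact: (conj_on_SU wW hf Sb).
move=> _ [_ [v vw ->]]; exists (pc v (C (partner w))), (gen v).
split; [by []| |exact: SU_gen].
by apply: pc_conj_on; exact: (U_comp wW (partner_W w) (partner_neq w) vw).
Qed.

Definition preserves f := forall w, w \in W -> forall u, u \in U w -> SU w (f (gen u)).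

Lemma preserves_SU f w a : preserves f -> w \in W -> SU w a -> SU w (f a).
Proof.
move=> hf wW; move: a; apply: SU_ind.
- by rewrite aut_unit; exact: sg1.
- by move=> a b ha hb; rewrite autM; exact: sgM.
- by move=> a ha; rewrite autV; exact: sgV.
- by move=> u uw; exact: hf.
Qed.

Lemma Ks_spec k : Ks k -> exists f, [/\ k = out_class f, preserves f & preserves f^-1].
Proof.
have conj_pres f b D w0 : w0 \in W -> D \subset C w0 -> SU w0 b -> conj_on f b D ->
    preserves f.
  move=> wW0 Dw Sb hf w wW u uw; rewrite hf; case: ifP => uD; last exact: SU_gen.
  have E : w0 = w by apply: (C_meet wW0 wW _ (U_C uw)); exact: fintype.subsetP Dw u uD.
  by rewrite E in Sb; apply: sgM; [apply: sgM => //; exact: SU_gen|exact: sgV].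
have mul_pres f g : preserves f -> preserves g -> preserves (f * g).
  by move=> hf hg w wW u uw; rewrite aut_mulE; apply: preserves_SU => //; exact: hg.
move: k; apply: sg_ind.
- exists 1; split; rewrite ?invg1 // => w _ u uw; exact: SU_gen.
- move=> _ _ [f [-> hf hf']] [g [-> hg hg']]; exists (f * g).
  by split; [rewrite outM|exact: mul_pres|rewrite invgM; exact: mul_pres].
- by move=> _ [f [-> hf hf']]; exists f^-1; rewrite invgK; split; rewrite ?outV.
move=> _ [v [D [/subP[w [wW vw hD Dw]] ->]]]; exists (pc v D).
have hf := pc_conj_on hD; split; first by [].
  exact: conj_pres wW Dw (SU_gen vw) hf.
apply: conj_pres wW Dw (sgV (SU_gen vw)) (conj_onV hf _).
exact: conj_on_notin hf (pc_center hD).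
Qed.

(** * Ping-pong on the Bass-Serre tree *)

Local Notation F := (freeprod Gamma A).
Implicit Types (y : Gamma -> F) (i j k : Gamma).

(** The free product of three copies of [A], one for each element of [W], receives [A]
    by sending [U w] into the copy indexed by [w] and killing the other vertices. *)
Definition phi u : F := if [pick w in W | u \in U w] is Some w then fpin w (gen u) else 1.

Lemma phi_U w u : w \in W -> u \in U w -> phi u = fpin w (gen u).
Proof.
move=> wW uw; rewrite /phi; case: pickP => [w' /andP[wW' uw']|/(_ w)].
  by rewrite (C_meet wW wW' (U_C uw) (U_C uw')).
by rewrite /= wW uw.
Qed.

Lemma phi_commute u v : adj u v -> commute (phi u) (phi v).
Proof.
move=> uv; rewrite /phi; case: pickP => [w /andP[wW uw]|_]; last first.
  exact/commute_sym/commute1.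
case: pickP => [w' /andP[wW' vw]|_]; last exact: commute1.
rewrite -(C_adj wW wW' (U_C uw) (U_C vw) uv) /commute -!fpinM.
by rewrite raag_gen_comm.
Qed.

Definition Phi : A -> F := raag_hom phi.

Lemma PhiM : {morph Phi : a b / a * b}. Proof. exact: raag_homM phi_commute. Qed.

Lemma Phi_gen u : Phi (gen u) = phi u. Proof. exact: raag_hom_gen phi_commute u. Qed.

Lemma Phi_SU w a : w \in W -> SU w a -> Phi a = fpin w a.
Proof.
move=> wW; move: a; apply: SU_ind.
- by rewrite (morph1 PhiM) fpin1.
- by move=> a b ha hb; rewrite PhiM ha hb fpinM.
- by move=> a ha; rewrite (morphV PhiM) ha fpinV.
- by move=> u uw; rewrite Phi_gen (phi_U wW uw).
Qed.

(** The image under [f] of the three base vertices of the tree: the factor [w]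
    is sent to its conjugate by [y w]. *)
Definition tripod f y := forall w, w \in W -> forall u, u \in U w ->
  Phi (f (gen u)) = y w * fpin w (gen u) * (y w)^-1.

(** Whether the other two vertices lie in the same direction from the vertex [i]. *)
Definition flat y i := forall j k, j \in W -> k \in W -> j != i -> k != i ->
  first i ((y i)^-1 * y j) = first i ((y i)^-1 * y k).
Definition bent y i := forall j k, j \in W -> k \in W -> j != i -> k != i ->
  j != k -> first i ((y i)^-1 * y j) <> first i ((y i)^-1 * y k).

(** If the vertex [i] lies strictly between the other two, then from each of those the
    rest of the tripod is seen beyond [i]. *)
Lemma bent_flat y i j : i \in W -> j \in W -> j != i -> bent y i -> flat y j.
Proof.
move=> iW jW ji hb; suff toward k : k \in W -> k != j ->
    first j ((y j)^-1 * y k) = first j ((y j)^-1 * y i).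
  by move=> k l kW lW kj lj; rewrite !toward.
move=> kW kj; have [->//|ki] := eqVneq k i.
have ij : i != j by rewrite eq_sym.
have jk : j != k by rewrite eq_sym.
have := first_div ij (hb j k jW kW ji ki jk).
by rewrite !invgM !invgK !mulgA mulgK.
Qed.

Definition move_tripod y i b : Gamma -> F := fun w =>
  if w == partner i then y i * fpin i b * (y i)^-1 * y w else y w.

(** Of the two directions at the vertex [i], which coincide, a move by a nontrivial
    [b] of the factor [i] changes exactly one. *)
Lemma move_bent y i b : i \in W -> b <> 1 -> flat y i -> bent (move_tripod y i b) i.
Proof.
move=> iW b1 hf j k jW kW ji ki jk.
have Ei : move_tripod y i b i = y i.
  by rewrite /move_tripod eq_sym (negPf (partner_neq i)).
have Et : first i ((y i)^-1 * move_tripod y i b (partner i)) =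
    b * first i ((y i)^-1 * y (partner i)).
  by rewrite /move_tripod eqxx -first_fpinM !mulgA mulVg mul1g.
have Eo w : w != partner i -> move_tripod y i b w = y w.
  by rewrite /move_tripod => /negPf ->.
have b_moves (c : A) : b * c <> c.
  by move=> E; apply: b1; apply: (@mulIg _ c); rewrite E mul1g.
have ti := partner_neq i; have tW := partner_W i; rewrite Ei.
have [Ej|jt] := eqVneq j (partner i).
  have kt : k != partner i by rewrite -Ej eq_sym.
  by rewrite Ej Et (Eo k kt) (hf k (partner i)) //; exact: b_moves.
have [Ek|kt] := eqVneq k (partner i).
  by rewrite Ek Et (Eo j jt) (hf j (partner i)) //; apply: nesym; exact: b_moves.
exfalso; move: iW jW kW tW ji ki jk ti jt kt.
by move=> /W_cases[]-> /W_cases[]-> /W_cases[]-> /W_cases[]->; rewrite ?eqxx.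
Qed.

Lemma tripod_SU f y w a : tripod f y -> w \in W -> SU w a ->
  Phi (f a) = y w * fpin w a * (y w)^-1.
Proof.
move=> hy wW; move: a; apply: SU_ind.
- by rewrite aut_unit (morph1 PhiM) fpin1 mulg1 mulgV.
- by move=> a b ha hb; rewrite autM PhiM ha hb fpinM conj_mul.
- by move=> a ha; rewrite autV (morphV PhiM) ha fpinV conj_inv.
- by move=> u uw; exact: hy.
Qed.

Lemma tripod_move f g y i b : i \in W -> tripod f y -> SU i b ->
  conj_on g b (C (partner i)) -> tripod (f * g) (move_tripod y i b).
Proof.
move=> iW hy Sb hg w wW u uw; rewrite aut_mulE hg /move_tripod.
have [Ew|wt] := eqVneq w (partner i).
  rewrite -Ew (U_C uw) !autM autV !PhiM (morphV PhiM) (hy w wW u uw).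
  by rewrite (tripod_SU hy iW Sb) !invgM !invgK !mulgA.
case: ifP => [ut|_]; last exact: hy.
by rewrite (C_meet wW (partner_W i) (U_C uw) ut) eqxx in wt.
Qed.

Lemma gen_neq1 u : gen u <> 1.
Proof.
move=> E; pose one : zgroup := (1%Z : int); pose h := raag_hom (fun _ : Gamma => one).
have hM : {morph h : a b / a * b} by apply: raag_homM => *; exact: commute_refl.
have : h (gen u) = one by apply: raag_hom_gen => *; exact: commute_refl.
by rewrite E (morph1 hM).
Qed.

Local Notation inP_out := (inP P).

(** The state reached by a reduced word whose last letter lies in the factor
    [i]: the vertex [i] is strictly between the other two. *)
Lemma ping_pong (s : seq (Gamma * Out A)) : reduced s -> inP_out s -> exists f y,
  [/\ evalw s = out_class f, tripod f y,
      (forall i, i \in W -> (forall s' p, s = rcons s' p -> i != p.1) -> flat y i) &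
      (forall s' p, s = rcons s' p -> p.1 \in W /\ bent y p.1)].
Proof.
elim/last_ind: s => [|s [i p] IH] rs is_.
  exists 1, (fun=> 1); split=> //; first by rewrite evalw0.
  - by move=> w wW u uw; rewrite mul1g invg1 mulg1 -(phi_U wW uw) -Phi_gen.
  - by case.
have rs' : reduced s by move: rs; rewrite -cats1; exact: reduced_catl.
have is' : inP_out s by move=> q qs; apply: is_; rewrite mem_rcons inE qs orbT.
have [f [y [Ef hy hflat hbent]]] := IH rs' is'.
have Pp : P i p by apply: (is_ (i, p)); rewrite mem_rcons inE eqxx.
have p1 : p <> 1.
  by apply/eqP; move: rs; rewrite /reduced all_rcons => /andP[/andP[]].
have iW := P_W Pp p1; have [g [b [Ep hg Sb]]] := P_spec iW Pp.
have b1 : b <> 1.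
  move=> E; apply: p1; rewrite Ep -out1; congr out_class.
  apply: raag_aut_ext => x; rewrite hg E invg1 mulg1 mul1g.
  by case: ifP.
have hb : bent (move_tripod y i b) i.
  apply: move_bent => //; apply: hflat => // s' q Es.
  move: rs; rewrite Es /reduced -!cats1 -catA /= sorted_cat_cons /=.
  by rewrite /alternates /= eq_sym => /andP[_ /andP[_ /andP[]]].
exists (f * g), (move_tripod y i b); split.
- by rewrite -cats1 evalw_cat Ef evalw_cons evalw0 mulg1 Ep outM.
- exact: tripod_move.
- move=> j jW /(_ s (i, p) erefl) ji; exact: bent_flat hb.
- by move=> s' q /rcons_inj[_ <-].
Qed.

(** An automorphism that preserves the subgroups [SU w], composed with an inner one,
    translates the three base vertices by one element, so its tripod is flat, while
    the last letter of a nonempty reduced word leaves a bent one. *)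
Theorem reduced_notin_K (s : seq (Gamma * Out A)) : reduced s -> inP_out s ->
  Ks (evalw s) -> s = [::].
Proof.
move=> rs is_ hk; case/lastP: s rs is_ hk => // s p rs is_ hk; exfalso.
have [f [y [Ef hy _ /(_ s p erefl)[iW hb]]]] := ping_pong rs is_.
have [g [Eg hg _]] := Ks_spec hk; rewrite Ef in Eg.
have [a Ea] := (out_classP f g).1 Eg.
have shape w : w \in W -> exists d, y w = Phi a * fpin w d.
  move=> wW; have Sg := hg w wW w (W_U wW).
  have [d Ed] : exists d, (Phi a)^-1 * y w = fpin w d.
    apply: (@fpin_malnormal _ _ _ (gen w) (g (gen w))); first exact/eqP/gen_neq1.
    have := hy w wW w (W_U wW); rewrite Ea aut_mulE /= conjgE invgK !PhiM.
    rewrite (morphV PhiM) (Phi_SU wW Sg) => E.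
    rewrite invgM invgK !mulgA -(mulgA _ (y w)) -(mulgA _ (y w * _)) -E.
    by rewrite !mulgA mulVg mul1g mulgVK.
  by exists d; rewrite -Ed mulVKg.
have dir j : j \in W -> j != p.1 -> forall d, y p.1 = Phi a * fpin p.1 d ->
    first p.1 ((y p.1)^-1 * y j) = d^-1.
  move=> jW jp d Ed; have [d' Ed'] := shape j jW.
  rewrite Ed Ed' invgM -fpinV -!mulgA mulKg first_fpinM first_fpin ?mulg1 //.
  by rewrite eq_sym.
have [d Ed] := shape p.1 iW; have [j [k [jW kW jp kp jk]]] := two_others iW.
by apply: (hb j k jW kW jp kp jk); rewrite !(dir _ _ _ d Ed).
Qed.

(** * The semidirect product structure *)

Section Normalize.
Variables (w v i u : Gamma) (D : {set Gamma}).
Hypotheses (wW : w \in W) (vw : v \in U w) (hD : D \in components (st v))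
  (Dw : D \subset C w) (iW : i \in W) (ui : u \in U i).

Let E := C (partner i).
Let hE : E \in components (st u). Proof. exact: (U_comp iW (partner_W i) (partner_neq i) ui). Qed.
Let hf := pc_conj_on hD.
Let hg := pc_conj_on hE.
Let fv : pc v D (gen v) = gen v. Proof. exact: conj_on_notin hf (pc_center hD). Qed.

(** The supports are disjoint, or [D] and [v] both lie in the support [E]. *)
Let pc_far : u \notin D -> commute (opc v D) (opc u E).
Proof.
move=> uD; have fu : pc v D (gen u) = gen u by exact: conj_on_notin hf uD.
suff c : commute (pc v D) (pc u E) by rewrite /commute !opcE -!outM c.
have [vE|vE] := boolP (v \in E); last first.
  apply: conj_on_commute hf hg fu (conj_on_notin hg vE) _ => x xD xE.
  have Ew : w = partner i.
    by apply: (C_meet wW (partner_W i) _ xE); exact: fintype.subsetP Dw x xD.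
  by rewrite /E -Ew (U_C vw) in vE.
have DE x : x \in D -> x \in E.
  move=> xD; rewrite /E -(C_meet wW (partner_W i) (U_C vw) vE).
  exact: fintype.subsetP Dw x xD.
apply: raag_aut_ext => x; rewrite !aut_mulE hg hf.
have [xD|xD] := boolP (x \in D).
  rewrite (DE x xD) !autM !autV fu hf xD hg vE hg (DE x xD).
  by rewrite !invgM !invgK !mulgA !mulgVK.
case: ifP => xE; last by rewrite hf (negPf xD) hg xE.
by rewrite !autM !autV fu hf (negPf xD) hg xE.
Qed.

(** [P_v^E P_v^D] conjugates the vertex [u] and the support [E] by [v], so it commutes
    with [P_u^E]. *)
Let pc_near : u \in D -> v \in U i /\
  opc v E * (opc v D * opc u E) = opc u E * (opc v E * opc v D) /\
  commute (opc v D) (opc v E).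
Proof.
move=> uD; have Ew : w = i.
  by apply: (C_meet wW iW _ (U_C ui)); exact: fintype.subsetP Dw u uD.
have vi : v \in U i by rewrite -Ew.
have hvE : E \in components (st v) := U_comp iW (partner_W i) (partner_neq i) vi.
have hh := pc_conj_on hvE.
have hv : pc v E (gen v) = gen v by exact: conj_on_notin hh (pc_center hvE).
have notE x : x \in C i -> x \notin E.
  by move=> xi; apply: contra (partner_neq i) => xE; rewrite (C_meet (partner_W i) iW xE xi).
have hu : pc v E (gen u) = gen u by exact: conj_on_notin hh (notE u (U_C ui)).
have gv : pc u E (gen v) = gen v by exact: conj_on_notin hg (notE v (U_C vi)).
split=> //; split; last first.
  suff c : commute (pc v D) (pc v E) by rewrite /commute !opcE -!outM c.
  by apply: conj_on_commute hf hh fv hv _ => *; exact: commute_refl.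
rewrite !opcE -!outM; congr out_class; apply: raag_aut_ext => x.
rewrite !aut_mulE hg [pc v D (gen x)]hf.
have [xD|xD] := boolP (x \in D).
  have xE : x \notin E.
    by apply: notE; rewrite -Ew; exact: fintype.subsetP Dw x xD.
  by rewrite (negPf xE) hf xD !autM !autV hv hh (negPf xE) gv hg (negPf xE).
case: ifP => xE; last by rewrite hf (negPf xD) hh xE hg xE.
rewrite !autM !autV hf uD hf (negPf xD) hh xE !autM !autV hv hu gv hg xE.
by rewrite !invgM !invgK !mulgA !mulgVK.
Qed.

Lemma sub_normalizes : P i (opc v D * opc u E * (opc v D)^-1) /\
  P i ((opc v D)^-1 * opc u E * opc v D).
Proof.
have Pu : P i (opc u E) by apply: sg_gen; split=> //; exists u.
have [uD|uD] := boolP (u \in D); last first.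
  have c := pc_far uD; split; first by rewrite c mulgK.
  by rewrite -mulgA -c mulKg.
have [vi [h c]] := pc_near uD.
have Pv : P i (opc v E) by apply: sg_gen; split=> //; exists v.
move: (opc v D) (opc u E) (opc v E) Pu Pv h c => k a p Pa Pp h c.
have E1 : k * a * k^-1 = p^-1 * a * p.
  apply: (@mulgI _ p); apply: (@mulIg _ k).
  by rewrite !mulgA mulgVK mulgV mul1g -(mulgA p) h mulgA.
have E2 : k^-1 * a * k = p * a * p^-1.
  have E3 : k * (p * a * p^-1) * k^-1 = a.
    have -> : k * (p * a * p^-1) * k^-1 = k * p * a * (k * p)^-1.
      by rewrite invgM !mulgA.
    rewrite c; have -> : p * k * a * (p * k)^-1 = p * (k * a * k^-1) * p^-1.
      by rewrite invgM !mulgA.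
    by rewrite E1 !mulgA mulgV mul1g mulgK.
  by rewrite -{1}E3 !mulgA mulVg mul1g mulgVK.
by rewrite E1 E2; split; apply: sgM; try (apply: sgM => //); try exact: sgV.
Qed.

End Normalize.

Lemma K_normalizes i (k p : Out A) : Ks k -> P i p -> P i (k * p * k^-1).
Proof.
move=> hk; suff [h _] : (forall q, P i q -> P i (k * q * k^-1)) /\
    (forall q, P i q -> P i (k^-1 * q * k)) by exact: h.
move: k hk; apply: sg_ind.
- by split=> q; rewrite invg1 mulg1 mul1g.
- move=> k k' [h1 h2] [h1' h2']; split=> q Pq.
    have -> : k * k' * q * (k * k')^-1 = k * (k' * q * k'^-1) * k^-1.
      by rewrite invgM !mulgA.
    exact: h1 (h1' _ Pq).
  have -> : (k * k')^-1 * q * (k * k') = k'^-1 * (k^-1 * q * k) * k'.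
    by rewrite invgM !mulgA.
  exact: h2' (h2 _ Pq).
- by move=> k [h1 h2]; rewrite invgK.
move=> _ [v [D [/subP[w [wW vw hD Dw]] ->]]].
have main (S : Out A -> Out A) : {morph S : x y / x * y} ->
    (forall u, i \in W -> u \in U i -> P i (S (opc u (C (partner i))))) ->
    forall q, P i q -> P i (S q).
  move=> SM Sg; apply: sg_ind.
  - by rewrite (morph1 SM); exact: sg1.
  - by move=> x y hx hy; rewrite SM; exact: sgM.
  - by move=> x hx; rewrite (morphV SM); exact: sgV.
  - by move=> _ [iW [u ui ->]]; exact: Sg.
split.
  apply: (main (fun q => opc v D * q * (opc v D)^-1)) => [x y|u iW ui].
    exact: conj_mul.
  by case: (sub_normalizes wW vw hD Dw iW ui).
apply: (main (fun q => (opc v D)^-1 * q * opc v D)) => [x y|u iW ui].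
  by rewrite !mulgA mulgK.
by case: (sub_normalizes wW vw hD Dw iW ui).
Qed.

(** * Acylindrical hyperbolicity of the pure symmetric outer group *)

Local Notation PC := (@partial_conjugations Gamma).

Lemma pc_PC v D : D \in components (st v) -> subgroup_generated PC (opc v D).
Proof. by move=> hD; apply: sg_gen; exists v, D. Qed.

Lemma P_PC w p : P w p -> subgroup_generated PC p.
Proof.
move: p; apply: sg_ind; [exact: sg1|exact: sgM|exact: sgV|].
by move=> _ [wW [v vw ->]]; apply: pc_PC; exact: (U_comp wW (partner_W w) (partner_neq w) vw).
Qed.

Lemma Ks_PC (k : Out A) : Ks k -> subgroup_generated PC k.
Proof.
move: k; apply: sg_ind; [exact: sg1|exact: sgM|exact: sgV|].
by move=> _ [v [D [/subP[w [_ _ hD _]] ->]]]; exact: pc_PC.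
Qed.

(** The factors and the complement inside the group [PSO Gamma]. *)
Definition PQ w (g : PSO Gamma) := P w (val g).
Definition KQ (g : PSO Gamma) := Ks (val g).
Definition valw (s : seq (Gamma * PSO Gamma)) := [seq (p.1, val p.2) | p <- s].

Let PSO_neq1 (g : PSO Gamma) : (val g != 1) = (g != 1).
Proof. by rewrite -(inj_eq val_inj) sg_val1. Qed.

Lemma reduced_valw s : reduced (valw s) = reduced s.
Proof.
pose neq1 (p : Gamma * PSO Gamma) := p.2 != 1.
by rewrite /reduced all_map sorted_map (eq_all (a2 := neq1)) // => p; exact: PSO_neq1.
Qed.

Lemma evalw_valw s : evalw (valw s) = val (evalw s).
Proof.
elim: s => [|p s IH]; first by rewrite !evalw0 sg_val1.
by rewrite /= !evalw_cons IH sg_valM.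
Qed.

Lemma inP_valw s : inP_out (valw s) <-> inP PQ s.
Proof.
split=> h p ps; first by apply: (h (p.1, val p.2)); apply/mapP; exists p.
by case/mapP: ps => q qs ->; exact: (h q qs).
Qed.

Lemma inP_lift (s : seq (Gamma * Out A)) : inP_out s -> exists s', valw s' = s.
Proof.
elim: s => [|[i p] s IH] hs; first by exists [::].
have [|s' Es'] := IH; first by move=> q qs; apply: hs; rewrite inE qs orbT.
have [|g Eg] := @sg_lift _ PC p.
  by apply: (@P_PC i); apply: (hs (i, p)); rewrite inE eqxx.
by exists ((i, g) :: s'); rewrite /= Eg Es'.
Qed.

Lemma PQ_M w (g h : PSO Gamma) : PQ w g -> PQ w h -> PQ w (g * h).
Proof. by rewrite /PQ sg_valM; exact: sgM. Qed.
Lemma PQ_V w (g : PSO Gamma) : PQ w g -> PQ w g^-1.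
Proof. by rewrite /PQ sg_valV; exact: sgV. Qed.
Lemma KQ_1 : KQ 1.
Proof. by rewrite /KQ sg_val1; exact: sg1. Qed.
Lemma KQ_M (g h : PSO Gamma) : KQ g -> KQ h -> KQ (g * h).
Proof. by rewrite /KQ sg_valM; exact: sgM. Qed.
Lemma KQ_V (g : PSO Gamma) : KQ g -> KQ g^-1.
Proof. by rewrite /KQ sg_valV; exact: sgV. Qed.
Lemma KQ_normalizes w (k g : PSO Gamma) : KQ k -> PQ w g -> PQ w (k * g * k^-1).
Proof. by rewrite /KQ /PQ !sg_valM sg_valV; exact: K_normalizes. Qed.

Lemma KQ_free (s : seq (Gamma * PSO Gamma)) :
  reduced s -> inP PQ s -> KQ (evalw s) -> s = [::].
Proof.
move=> rs /inP_valw is_ ks; apply/eqP; rewrite -size_eq0 -(size_map (fun p => (p.1, val p.2))).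
rewrite size_eq0; apply/eqP; apply: reduced_notin_K => //.
  by rewrite reduced_valw.
by rewrite evalw_valw.
Qed.

Section NoLink.
Hypothesis L_trivial : forall v D, v \in L -> D \in components (st v) -> opc v D = 1.

Local Notation factored_out := (factored P Ks).

Let factored_mul p q : factored_out p -> factored_out q -> factored_out (p * q).
Proof. by apply: factoredM; [move=> *; exact: sgM|move=> *; exact: sgM|exact: K_normalizes]. Qed.

Let factored_inv p : factored_out p -> factored_out p^-1.
Proof. by apply: factoredV; [move=> *; exact: sgV|move=> *; exact: sgV|exact: K_normalizes]. Qed.

Let factored_one : factored_out 1. Proof. by apply: factored_K; exact: sg1. Qed.

(** [P_v^D] for the third shared component [D] is expressed by the product of
    all the partial conjugations by [v], which is inner. *)
Lemma opc_factored v D : D \in components (st v) -> factored_out (opc v D).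
Proof.
move=> hD; have [vL|vL] := boolP (v \in L).
  by rewrite L_trivial.
have [w wW vw] := C_cover vL.
have [Lv|Lv] := boolP (L \subset lk v); last first.
  by rewrite (notU_trivial wW vw).
have vU : v \in U w by apply/UP.
have inner_factored E : E \in components (st v) -> E \subset C w -> factored_out (opc v E).
  move=> hE Ew; apply: factored_K; apply: sg_gen; exists v, E; split=> //.
  exact: U_sub wW vU hE Ew.
have tgt_factored : factored_out (opc v (C (partner w))).
  by apply: (@factored_P _ _ _ _ _ w); [exact: sg1|apply: sg_gen; split=> //; exists v].
have [[w' [wW' ww' ED]]|Dw] := U_cases wW vU hD; last exact: inner_factored.
rewrite {}ED in hD *; have [->//|w't] := eqVneq w' (partner w).
apply: (opc_prod_components factored_one factored_mul factored_inv hD) => E hE EC.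
have [[w0 [wW0 ww0 EE]]|Ew] := U_cases wW vU hE; last exact: inner_factored.
rewrite EE in EC *; suff -> : w0 = partner w by [].
have w0w' : w0 != w' by apply: contraNneq EC => ->.
have tw := partner_neq w; have tW := partner_W w.
apply/eqP; apply: contraT => w0t; exfalso.
move: wW wW' wW0 tW ww' ww0 w't w0w' tw w0t.
by move=> /W_cases[]-> /W_cases[]-> /W_cases[]-> /W_cases[]->; rewrite ?eqxx.
Qed.

Lemma PSO_factored (g : PSO Gamma) : factored PQ KQ g.
Proof.
have : factored_out (val g).
  move: (val g) (sg_val g); apply: sg_ind => //.
  by move=> _ [v [D [hD ->]]]; exact: opc_factored.
case=> s [k [rs is_ Kk Eg]]; have [s' Es'] := inP_lift is_.
have [k' Ek'] := sg_lift (Ks_PC Kk).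
exists s', k'; split.
- by rewrite -reduced_valw Es'.
- by apply/inP_valw; rewrite Es'.
- by rewrite /KQ Ek'.
by apply: val_inj; rewrite sg_valM -evalw_valw Es' Ek'.
Qed.

Hypothesis conj_inj : injective (@conj_hom Gamma w1 w2 w3).

(** The injectivity of the conjugation homomorphism, read on the generators of [H_3]. *)
Lemma Ks_faithful (k : Out A) : Ks k ->
  (forall w u, w \in W -> u \in U w -> k * opc u (C (partner w)) * k^-1 = opc u (C (partner w))) ->
  k = 1.
Proof.
move=> /sg_lift[k' Ek'] hk; suff E : k' = 1 by rewrite -Ek' E sg_val1.
apply: conj_inj; apply/funext => h; rewrite /conj_hom Ek' sg_val1 mul1g invg1 mulg1.
have [h12 h13 h23] := w_neq.
have t1 : partner w1 = w3 by rewrite /partner (negPf h13).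
have t2 : partner w2 = w3 by rewrite /partner (negPf h23).
have t3 : partner w3 = w2 by rewrite /partner eqxx.
move: (val h) (sg_val h); apply: sg_ind.
- by rewrite mulg1 mulgV.
- by move=> x y hx hy; rewrite conj_mul hx hy.
- by move=> x hx; rewrite -conj_inv hx.
move=> x [v [Lv [[+ ->]|[vw ->]]]]; last first.
  by have := hk w3 v w3W; rewrite t3; apply; apply/UP.
rewrite finset.inE => /orP[] vw.
  by have := hk w1 v w1W; rewrite t1; apply; apply/UP.
by have := hk w2 v w2W; rewrite t2; apply; apply/UP.
Qed.

(** The generator of [P w] given by [u]; for [u] outside [U w] the vertex [w] replaces
    [u], so that all blocks are reduced words of the same shape. *)
Definition letter w u : Gamma * PSO Gamma :=
  (w, insubd (1 : PSO Gamma) (opc (if u \in U w then u else w) (C (partner w)))).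

Lemma letterP w u : w \in W -> exists2 v, v \in U w &
  val (letter w u).2 = opc v (C (partner w)) /\ (u \in U w -> v = u).
Proof.
move=> wW; exists (if u \in U w then u else w); first by case: ifP => // _; exact: W_U.
split; last by move=> ->.
rewrite /= insubdK //; apply/mem_set; apply: (@P_PC w); apply: sg_gen; split=> //.
by exists (if u \in U w then u else w) => //; case: ifP => // _; exact: W_U.
Qed.

Lemma letter_PQ w u : w \in W -> PQ w (letter w u).2.
Proof.
move=> wW; have [v vw [E _]] := letterP u wW.
by rewrite /PQ E; apply: sg_gen; split=> //; exists v.
Qed.

Lemma letter_neq1 w u : w \in W -> (letter w u).2 != 1.
Proof.
move=> wW; have [v vw [E _]] := letterP u wW.
rewrite -PSO_neq1 E; apply/eqP.
have [w' [w'' [wW' wW'' ww' ww'' w'w'']]] := two_others wW.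
have hD := U_comp wW (partner_W w) (partner_neq w) vw.
have [z [zW zw zt]] : exists z, [/\ z \in W, z != w & z != partner w].
  have [e|ne] := eqVneq w' (partner w); last by exists w'.
  by exists w''; rewrite -e; split=> //; rewrite eq_sym.
apply: (opc_nontrivial hD (y := z)).
  by apply: contra zt => zC; rewrite (C_meet zW (partner_W w) (C_refl z) zC).
by rewrite (disjointFr (C_disjoint_st wW zW zw (U_C vw))) // C_refl.
Qed.

Definition block u := [:: letter w1 u; letter w2 u; letter w3 u].

(** Every generator of [H_3] occurs in the marker, so only the trivial element
    of [K] fixes it. *)
Definition marker_word := flatten [seq block u | u <- enum Gamma].

Lemma reduced_blocks (us : seq Gamma) (r : seq (Gamma * PSO Gamma)) : reduced r ->
  (if r is p :: _ then p.1 != w3 else true) -> reduced (flatten [seq block u | u <- us] ++ r).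
Proof.
have [h12 h13 h23] := w_neq.
move=> rr hr; elim: us => [//|u us IH]; set r' := flatten _ ++ r in IH.
rewrite -[flatten _ ++ r]/[:: letter w1 u, letter w2 u, letter w3 u & r'].
rewrite !reduced_cons /= !letter_neq1 ?w1W ?w2W ?w3W //= h12 h23 IH /= andbT.
rewrite /r'; case: us {IH r'} => [|u' us] /=; last by rewrite eq_sym.
by case: r hr {rr} => //= p r; rewrite eq_sym.
Qed.

Lemma marker_word_stab (k : PSO Gamma) : KQ k -> conjw k marker_word = marker_word -> k = 1.
Proof.
move=> Kk E; apply: val_inj; rewrite sg_val1; apply: Ks_faithful => // w u wW uw.
have hp : letter w u \in marker_word.
  apply/flattenP; exists (block u); first by apply/mapP; exists u; rewrite ?mem_enum.
  by rewrite !inE; case/W_cases: wW => ->; rewrite eqxx ?orbT.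
have [v _ [Ev Euv]] := letterP u wW.
have fixp : all (fun p => (p.1, k * p.2 * k^-1) == p) marker_word.
  move: E; rewrite /conjw; elim: (marker_word) => //= p s IH [Ep Es].
  by rewrite IH // andbT; case: p Ep => /= ? ? <-.
move: (allP fixp _ hp) => /eqP[] /(congr1 val).
by rewrite !sg_valM sg_valV Ev (Euv uw).
Qed.

Theorem PSO_acylindrically_hyperbolic (R : realType) :
  acylindrically_hyperbolic R (PSO Gamma).
Proof.
have [h12 h13 h23] := w_neq.
have rm : reduced marker_word.
  by have := @reduced_blocks (enum Gamma) [::] isT isT; rewrite cats0.
have head_m : if marker_word is p :: _ then p.1 == w1 else false.
  rewrite /marker_word; case E : (enum Gamma) => [|u us] //=.
  by have := mem_enum Gamma w1; rewrite E.
have l2 := letter_neq1 w2 w2W.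
apply: (@marker_acylindrically_hyperbolic Gamma (PSO Gamma) PQ KQ PQ_M PQ_V KQ_1
  KQ_M KQ_V KQ_normalizes PSO_factored KQ_free marker_word (letter w2 w2)).
- apply: reduced_blocks => //; move: head_m; case: (marker_word) => // p s /eqP ->.
  by [].
- move=> p /flattenP[_ /mapP[u _ ->]]; rewrite !inE => /or3P[] /eqP ->.
  + exact: (letter_PQ u w1W).
  + exact: (letter_PQ u w2W).
  + exact: (letter_PQ u w3W).
- by move: head_m; case: (marker_word).
- exact: marker_word_stab.
- exact: (letter_PQ w2 w2W).
- rewrite reduced_cons l2 rm andbT /=; move: head_m.
  by case: (marker_word) => // p s /eqP ->; rewrite eq_sym.
rewrite -reduced_invw invw_cons invwK -cats1; apply: reduced_blocks => //.
by rewrite reduced_cons /= invg_eq1 l2.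
Qed.

End NoLink.

(** * The obstruction from the common link *)

Definition link_generators : set (Out A) :=
  [set x | exists v D, [/\ v \in L, D \in components (st v) & x = opc v D]].

Definition offlink_generators : set (Out A) :=
  [set x | exists v D, [/\ v \notin L, L \subset lk v, D \in components (st v) & x = opc v D]].

(** A vertex of [L] is adjacent to every [v] with [L] contained in [lk v]. *)
Lemma link_commute (p q : Out A) : subgroup_generated link_generators p ->
  subgroup_generated offlink_generators q -> commute p q.
Proof.
apply: sg_commute => _ _ [l [D [lL hD ->]]] [v [E [_ Lv hE ->]]].
have lv : adj l v by rewrite adj_sym; have := fintype.subsetP Lv _ lL; rewrite inE.
by rewrite /commute !opcE -!outM (pc_commute_adj lv hD hE).
Qed.

(** The remaining vertices define only trivial partial conjugations, by
    [notU_trivial]. *)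
Lemma link_factored (p : Out A) : subgroup_generated PC p -> exists a b : Out A,
  [/\ subgroup_generated link_generators a, subgroup_generated offlink_generators b
    & p = a * b].
Proof.
move: p; apply: sg_ind.
- by exists 1, 1; split; rewrite ?mulg1 //; exact: sg1.
- move=> p q [a [b [ha hb ->]]] [a' [b' [ha' hb' ->]]].
  exists (a * a'), (b * b'); split; [exact: sgM|exact: sgM|].
  by rewrite !mulgA -[a * a' * b]mulgA (link_commute ha' hb) !mulgA.
- move=> p [a [b [ha hb ->]]]; exists a^-1, b^-1; split; [exact: sgV|exact: sgV|].
  by rewrite -invgM (link_commute ha hb).
move=> _ [v [D [hD ->]]]; have [vL|vL] := boolP (v \in L).
  by exists (opc v D), 1; split; rewrite ?mulg1 //; [apply: sg_gen; exists v, D|exact: sg1].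
have [w wW vw] := C_cover vL; have [Lv|Lv] := boolP (L \subset lk v).
  by exists 1, (opc v D); split; rewrite ?mul1g //; [exact: sg1|apply: sg_gen; exists v, D].
by exists 1, 1; split; rewrite ?mulg1 ?(notU_trivial wW vw) //; exact: sg1.
Qed.

Lemma opc_nontrivial_order v D n : D \in components (st v) -> opc v D <> 1 ->
  (0 < n)%N -> opc v D ^+ n <> 1.
Proof.
move=> hD nt n0; have [y [yv yD]] : exists y : Gamma, y \notin st v /\ y \notin D.
  apply: contrapT => none; apply: nt; apply: opc_trivial => // u uv.
  by apply: contrapT => /negP uD; apply: none; exists u.
exact: (opc_infinite_order hD yD yv n0).
Qed.

(** Infinite order is witnessed by the given partial conjugation and by that of [w1]
    on the shared component of [w2]. *)
Theorem PSO_not_acylindrically_hyperbolic (R : realType) v0 D0 :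
  v0 \in L -> D0 \in components (st v0) -> opc v0 D0 <> 1 ->
  ~ acylindrically_hyperbolic R (PSO Gamma).
Proof.
move=> v0L hD0 nt [X [act [hyp iso acyl ne]]].
have infinite (S : set (Out A)) v D : S (opc v D) -> D \in components (st v) ->
    opc v D <> 1 ->
    exists2 g : PSO Gamma, subgroup_generated S (val g) & forall n, (0 < n)%N -> g ^+ n <> 1.
  move=> Sv hD ntD; have [g Eg] := sg_lift (pc_PC hD).
  exists g; first by rewrite Eg; exact: sg_gen.
  move=> n n0 /(congr1 val); rewrite (morphX (@sg_valM _ _)) sg_val1 Eg.
  exact: (opc_nontrivial_order hD ntD n0).
apply: (no_commuting_factors iso hyp acyl
  (A := fun q : PSO Gamma => subgroup_generated link_generators (val q))
  (B := fun q : PSO Gamma => subgroup_generated offlink_generators (val q))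
  _ _ _ _ _ _ _ _ ne).
- by move=> a b; rewrite sg_valM; exact: sgM.
- by move=> a; rewrite sg_valV; exact: sgV.
- by move=> a b; rewrite sg_valM; exact: sgM.
- by move=> a; rewrite sg_valV; exact: sgV.
- move=> a b ha hb; apply: val_inj; rewrite !sg_valM; exact: link_commute.
- move=> g; have [a [b [ha hb E]]] := link_factored (sg_val g).
  have PCsub (S : set (Out A)) (x : Out A) :
      (forall z : Out A, S z -> PC z) -> subgroup_generated S x -> subgroup_generated PC x.
    move=> h; move: x; apply: sg_ind; [exact: sg1|exact: sgM|exact: sgV|].
    by move=> y /h; exact: sg_gen.
  have [a' Ea] : exists a' : PSO Gamma, val a' = a.
    by apply: sg_lift; apply: PCsub ha => _ [v [D [_ hD ->]]]; exists v, D.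
  have [b' Eb] : exists b' : PSO Gamma, val b' = b.
    by apply: sg_lift; apply: PCsub hb => _ [v [D [_ _ hD ->]]]; exists v, D.
  exists a', b'; split; rewrite ?Ea ?Eb //.
  by apply: val_inj; rewrite sg_valM Ea Eb.
- by apply: (infinite _ v0 D0) => //; exists v0, D0.
have [h12 h13 h23] := w_neq.
have w1U : w1 \in U w1 by exact: W_U w1W.
have w21 : w2 != w1 by rewrite eq_sym.
have w31 : w3 != w1 by rewrite eq_sym.
have hD := U_comp w1W w2W w21 w1U.
apply: (infinite _ w1 (C w2)) => //.
  by exists w1, (C w2); split=> //; [exact: W_notin_L w1W|exact: L_link w1W].
apply: (opc_nontrivial hD (y := w3)).
  by apply: contra h23 => w3C; rewrite (C_meet w3W w2W (C_refl w3) w3C).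
by rewrite (disjointFr (C_disjoint_st w1W w3W w31 (C_refl w1))) // C_refl.
Qed.

End System.

Theorem theorem4p9 (R : realType) (Gamma : sgraph) (w1 w2 w3 : Gamma)
    (W : {set Gamma}) (hW : W = [set w1; w2; w3]%SET)
    (w_distinct : uniq [:: w1; w2; w3])
    (W_system : maximal_SIL_system W)
    (W_no_add : no_additional_components W)
    (cond1 : forall w v, w \in W -> v \in shared_component W w ->
       connected_minus (st v) \/
       (defines_only_subordinate W v /\
        forall C, subordinate W v C ->
          exists2 u, u \in C & defines_subordinate W u))
    (cond2 : injective (@conj_hom Gamma w1 w2 w3)) :
  acylindrically_hyperbolic R (PSO Gamma) <->
  ~ exists (v : Gamma) (C : {set Gamma}),
      [/\ v \in common_link W, C \in components (st v) &
          out_partial_conj v C <> 1%g].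
Proof.
subst W; split=> [AH [v [D [vL hD nt]]]|none].
  by apply: (PSO_not_acylindrically_hyperbolic w_distinct W_system W_no_add cond1 vL hD nt AH).
apply: (PSO_acylindrically_hyperbolic w_distinct W_system W_no_add cond1) => // v D vL hD.
by apply: contrapT => nt; apply: none; exists v, D.
Qed.
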